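(* Let $Z_1=S_2/S_1$ and $Z_2=\|\boldsymbol X_1\|^2/S_1$. (i) Under the squared error loss $L_1$, the estimator of $\sigma_1^2$ $$\delta_{12}^Q=\begin{cases}\dfrac{1+Z_1+Z_2}{m_1+m_2+p+2}\,\dfrac{E(\tau^{-1})}{E(\tau^{-2})}\,S_1,&\text{if }0\le Z_2\le\dfrac{m_2+p}{m_1+2}-Z_1\text{ and }0\le Z_1\le\dfrac{m_2}{m_1+2},\\[1em] \dfrac{S_1}{m_1+2}\,\dfrac{E(\tau^{-1})}{E(\tau^{-2})},&\text{otherwise,}\end{cases}$$ dominates $\delta_{01}^Q=\dfrac{E(\tau^{-1})}{(m_1+2)E(\tau^{-2})}S_1$. (ii) Under the entropy loss $L_2$, the estimator of $\sigma_1^2$ $$\delta_{12}^E=\begin{cases}\dfrac{1+Z_1+Z_2}{m_1+m_2+p-4}\,\dfrac{1}{E(\tau^{-1})}\,S_1,&\text{if }0\le Z_2\le\dfrac{m_2+p-4}{m_1}-Z_1\text{ and }0\le Z_1\le\dfrac{m_2}{m_1},\\[1em] \dfrac{S_1}{m_1}\,\dfrac{1}{E(\tau^{-1})},&\text{otherwise,}\end{cases}$$ dominates $\delta_{01}^E=\dfrac{S_1}{m_1E(\tau^{-1})}$.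
   Context: Model: $p,q,m_1,m_2$ are positive integers; $\tau$ is a positive random variable (mixing variable) with known distribution $\Pi$ on $(0,\infty)$, and $E(\tau^{-1})$, $E(\tau^{-2})$ denote the (finite) moments appearing in the formulas. Conditionally on $\tau$, the variables $\boldsymbol X_1,S_1,\boldsymbol X_2,S_2$ are independent with $\boldsymbol X_1\sim N_p(\boldsymbol\theta_1,\frac{\sigma_1^2}{\tau}I)$, $S_1\sim\frac{\sigma_1^2}{\tau}\chi^2_{m_1}$, $\boldsymbol X_2\sim N_q(\boldsymbol\theta_2,\frac{\sigma_2^2}{\tau}I)$, $S_2\sim\frac{\sigma_2^2}{\tau}\chi^2_{m_2}$ (the same $\tau$ for all four). The unknown parameters are $\boldsymbol\theta_1\in\mathbb R^p$, $\boldsymbol\theta_2\in\mathbb R^q$, $\sigma_1,\sigma_2>0$ with the order restriction $\sigma_1\le\sigma_2$. Losses for estimating $\sigma^2$ by $\delta$: squared error loss $L_1(\delta,\sigma^2)=(\delta/\sigma^2-1)^2$ and entropy loss $L_2(\delta,\sigma^2)=\delta/\sigma^2-\ln(\delta/\sigma^2)-1$. The risk $R(\delta)$ of an estimator $\delta$ of $\sigma_1^2$ is the expected loss, a function of the parameters. $\delta_{01}^Q$ and $\delta_{01}^E$ are the best affine equivariant estimators (BAEE) of $\sigma_1^2$ under $L_1$ and $L_2$. An estimator $\delta'$ dominates $\delta$ if $R(\delta')\le R(\delta)$ for all parameter values satisfying the order restriction, with strict inequality for at least one.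
   Formalization: In (ii), R(δ12^E) ≤ R(δ01^E) is proved in general; the strict inequality in ''dominates'' also assumes m2+p > 4 (otherwise the two estimators coincide almost surely) and E|ln τ| < ∞ (otherwise both entropy risks are infinite everywhere). *)

(* Defs.v *)
From HB Require Import structures.
From mathcomp Require Import all_boot all_order all_algebra.
From mathcomp Require Import all_classical all_reals all_analysis.

Set Implicit Arguments.
Unset Strict Implicit.
Unset Printing Implicit Defensive.

Import Order.TTheory GRing.Theory Num.Theory.
Import numFieldNormedType.Exports.

Local Open Scope classical_set_scope.
Local Open Scope ring_scope.

Section chi_square.
Context {R : realType}.

Definition Gamma (a : R) : R :=
  \int[lebesgue_measure]_(x in `]0, +oo[) (x `^ (a - 1) * expR (- x)).

Definition chi2_pdf (k : nat) (x : R) : R :=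
  if 0 < x then
    x `^ (k%:R / 2 - 1) * expR (- x / 2) / (2 `^ (k%:R / 2) * Gamma (k%:R / 2))
  else 0.

Definition chi2_prob (k : nat) (A : set R) : \bar R :=
  (\int[lebesgue_measure]_(x in A) (chi2_pdf k x)%:E)%E.

(* the law of v * chi^2_k *)
Definition scaled_chi2_prob (v : R) (k : nat) (A : set R) : \bar R :=
  chi2_prob k [set x | A (v * x)].

(* The value of N_n(theta, v I) on the rectangle A_0 x ... x A_(n-1), that is,
   the law of n independent N(theta_i, v) coordinates. [normal_prob] takes the
   standard deviation, hence the square root. *)
Definition normal_rect (n : nat) (theta : n.-tuple R) (v : R)
    (A : 'I_n -> set R) : \bar R :=
  (\prod_(i < n) normal_prob (tnth theta i) (Num.sqrt v) (A i))%E.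

End chi_square.

Section model.
Context {R : realType} {p q : nat}.

Record param := Param {
  theta1 : p.-tuple R;
  theta2 : q.-tuple R;
  sigma1 : R;
  sigma2 : R }.

Definition ordered_param (w : param) : Prop :=
  [/\ 0 < sigma1 w, 0 < sigma2 w & sigma1 w <= sigma2 w].

(* Under P, tau has law Pi and, for Pi-almost every t, given tau = t the
   variables X1, S1, X2, S2 are independent with laws N_p(theta1, sigma1^2/t I),
   (sigma1^2/t) chi^2_m1, N_q(theta2, sigma2^2/t I), (sigma2^2/t) chi^2_m2.
   This is the disintegration of the joint law along tau; the measurable
   rectangles used below generate the product sigma-algebra and are stable by
   intersection, so they determine that law. *)
Definition scale_mixture_model {d : measure_display} {T : measurableType d}
    (m1 m2 : nat) (Pi : probability R R) (P : probability T R) (w : param)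
    (tau : T -> R) (X1 : T -> p.-tuple R) (S1 : T -> R)
    (X2 : T -> q.-tuple R) (S2 : T -> R) : Prop :=
  forall (B : set R) (A1 : 'I_p -> set R) (C1 : set R)
         (A2 : 'I_q -> set R) (C2 : set R),
    measurable B ->
    (forall i, measurable (A1 i)) -> measurable C1 ->
    (forall j, measurable (A2 j)) -> measurable C2 ->
    P [set x | [/\ B (tau x),
                   (forall i, A1 i (tnth (X1 x) i)), C1 (S1 x),
                   (forall j, A2 j (tnth (X2 x) j)) & C2 (S2 x)]] =
    (\int[Pi]_(t in B)
       (normal_rect (theta1 w) (sigma1 w ^+ 2 / t)%R A1 *
        scaled_chi2_prob (sigma1 w ^+ 2 / t)%R m1 C1 *
        normal_rect (theta2 w) (sigma2 w ^+ 2 / t)%R A2 *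
        scaled_chi2_prob (sigma2 w ^+ 2 / t)%R m2 C2))%E.

Definition sq_loss (delta s : R) : R := (delta / s - 1) ^+ 2.

Definition entropy_loss (delta s : R) : R := delta / s - ln (delta / s) - 1.

(* an estimator is a function of the observation (X1, S1, X2, S2) *)
Definition estimator := p.-tuple R -> R -> q.-tuple R -> R -> R.

Definition risk {d : measure_display} {T : measurableType d}
    (L : R -> R -> R) (P : param -> probability T R)
    (X1 : T -> p.-tuple R) (S1 : T -> R) (X2 : T -> q.-tuple R) (S2 : T -> R)
    (delta : estimator) (w : param) : \bar R :=
  ('E_(P w)[fun x =>
     L (delta (X1 x) (S1 x) (X2 x) (S2 x)) (sigma1 w ^+ 2)%R])%E.

Definition no_worse (Rk : estimator -> param -> \bar R)
    (delta' delta : estimator) : Prop :=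
  forall w, ordered_param w -> (Rk delta' w <= Rk delta w)%E.

Definition dominates (Rk : estimator -> param -> \bar R)
    (delta' delta : estimator) : Prop :=
  no_worse Rk delta' delta /\
  exists2 w, ordered_param w & (Rk delta' w < Rk delta w)%E.

(* E(tau^-k) *)
Definition inv_moment (Pi : probability R R) (k : nat) : R :=
  \int[Pi]_t (t ^- k).

Definition sqnorm {n : nat} (x : n.-tuple R) : R :=
  \sum_(i < n) tnth x i ^+ 2.

Definition delta01Q (m1 : nat) (Pi : probability R R) : estimator :=
  fun _ s1 _ _ =>
    inv_moment Pi 1 / ((m1%:R + 2) * inv_moment Pi 2) * s1.

Definition delta12Q (m1 m2 : nat) (Pi : probability R R) : estimator :=
  fun x1 s1 _ s2 =>
    let Z1 := s2 / s1 in
    let Z2 := sqnorm x1 / s1 in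
    if (0 <= Z2 <= (m2%:R + p%:R) / (m1%:R + 2) - Z1) &&
       (0 <= Z1 <= m2%:R / (m1%:R + 2))
    then (1 + Z1 + Z2) / (m1%:R + m2%:R + p%:R + 2) *
         (inv_moment Pi 1 / inv_moment Pi 2) * s1
    else s1 / (m1%:R + 2) * (inv_moment Pi 1 / inv_moment Pi 2).

Definition delta01E (m1 : nat) (Pi : probability R R) : estimator :=
  fun _ s1 _ _ => s1 / (m1%:R * inv_moment Pi 1).

Definition delta12E (m1 m2 : nat) (Pi : probability R R) : estimator :=
  fun x1 s1 _ s2 =>
    let Z1 := s2 / s1 in
    let Z2 := sqnorm x1 / s1 in
    if (0 <= Z2 <= (m2%:R + p%:R - 4) / m1%:R - Z1) &&
       (0 <= Z1 <= m2%:R / m1%:R)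
    then (1 + Z1 + Z2) / (m1%:R + m2%:R + p%:R - 4) *
         (inv_moment Pi 1)^-1 * s1
    else s1 / m1%:R * (inv_moment Pi 1)^-1.

End model.

Arguments param : clear implicits.
Arguments estimator : clear implicits.

(* Main.v *)
(** Given tau = t, put everything in units of sigma1^2 / t: the observation
becomes (u, r v, z) with u, v independent chi-squares, z a noncentral
chi-square whose noncentrality is proportional to t, and
r = (sigma2 / sigma1)^2 >= 1. Both losses are convex in the factor of S1, so
on the region where the new factor f1 = (1 + Z1 + Z2) / N is below the old
factor f0 it suffices to compare f1 with the conditionally optimal factor.
This comparison is an Euler-type inequality
  E[h (u + r v + z)] >= (m1 + m2 + p + 2 kappa) E[h]
for h >= 0 homogeneous of degree kappa: scaling (u, r v, z) by b^2 >= 1 costs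
at most the factor b^(m1 + m2 + p) and the weight
exp (- (b^2 - 1) (u + r v + z) / 2) (for the noncentral part this is
cosh (a x) <= cosh (a b x) after symmetrization), and one differentiates at
b = 1. The mixture over tau is then handled by Chebyshev's association
inequality, because f0 - f1 decreases in z, and hence its conditional
expectation decreases in t (noncentral Gaussians are reflected about the
midpoint of two centers). *)

(* Let [gap] be [f0 - f1] on the region and [0] elsewhere; it is nonnegative because the two factors
   agree exactly where [Z1 + Z2] reaches its bound. With [W = S1 / sigma1 ^+ 2] and [c] the moment
   factor, the squared error loss drops by [c ^+ 2 * W ^+ 2 * gap * (2 * f0 - gap) - 2 * c * W *
   gap], the entropy loss by [c * W * gap - ln (f0 / (f0 - gap))]. The Euler inequality is used for
   [u * gap] (kappa = 1) in the first case, whence [N = m1 + m2 + p + 2], and for [gap / (f0 - gap)]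
   (kappa = 0) in the second. Strictness comes from a leftover square of [gap] in the first case and
   from the [4] subtracted in [N] in the second. Two obstacles shape the rest. Integrals may be
   infinite, so differences are written as equalities of sums, and strict entropy dominance is
   asserted for integrable [ln t]. The model only gives probabilities of rectangles, so conditional
   laws are rebuilt by adjoining one observation at a time, down to the coordinates of [X1], to the
   conditioning variable. *)
Require Import Defs.
From HB Require Import structures.
From mathcomp Require Import all_boot all_order all_algebra.
From mathcomp Require Import all_classical all_reals all_analysis.
From mathcomp Require Import simple_functions measurable_realfun.
From mathcomp Require Import measurable_fun_approximation.
From mathcomp Require Import ring lra.

Set Implicit Arguments.
Unset Strict Implicit.
Unset Printing Implicit Defensive.

Import Order.TTheory GRing.Theory Num.Theory.
Import numFieldNormedType.Exports.

Local Open Scope classical_set_scope.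
Local Open Scope ring_scope.

(** * Measures given by densities, and positivity of integrals *)

Section density.
Local Open Scope ereal_scope.
Context d (T : measurableType d) (R : realType).
Variables mu nu : {measure set T -> \bar R}.
Variable g : T -> R.
Hypotheses (mg : measurable_fun [set: T] g) (g0 : forall x, (0 <= g x)%R).
Hypothesis nuE : forall A, measurable A -> nu A = \int[mu]_(x in A) (g x)%:E.

Import HBNNSimple.

(** The hypothesis [nuE] is the claim for indicators; linearity extends it to the simple functions
    [nnsfun_approx], monotone convergence to [f]. Both [normal_prob] and [chi2_law] come with such
    an [nuE]. *)
Lemma ge0_integral_density (f : T -> \bar R) :
  measurable_fun [set: T] f -> (forall x, 0 <= f x) ->
  \int[nu]_x f x = \int[mu]_x (f x * (g x)%:E).
Proof.
move=> mf f0; pose h := nnsfun_approx measurableT mf.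
have mgE : measurable_fun [set: T] (EFin \o g) by exact/measurable_EFinP.
have -> : \int[nu]_x f x = lim (\int[nu]_x (EFin \o h n) x @[n --> \oo]).
  rewrite -monotone_convergence//.
  - apply: eq_integral => x _; apply/esym/cvg_lim => //.
    exact: cvg_nnsfun_approx.
  - by move=> n; exact/measurable_EFinP.
  - by move=> n x _ //=; rewrite lee_fin.
  - by move=> x _ a b ab; rewrite lee_fin; exact/lefP/nd_nnsfun_approx.
have -> : \int[mu]_x (f x * (g x)%:E) =
    lim (\int[mu]_x ((EFin \o h n) \* (EFin \o g)) x @[n --> \oo]).
  rewrite -monotone_convergence//.
  - apply: eq_integral => x _; apply/esym/cvg_lim => //.
    by apply: cvgeZr => //; exact: cvg_nnsfun_approx.
  - by move=> n; apply: emeasurable_funM => //; exact/measurable_EFinP.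
  - by move=> n x _ /=; rewrite mule_ge0 ?lee_fin.
  - move=> x _ a b ab/=; rewrite lee_wpmul2r ?lee_fin//.
    exact/lefP/nd_nnsfun_approx.
congr (lim (_ @[n --> \oo])); apply/funext => n.
transitivity (\int[nu]_x
   (\sum_(y \in range (h n)) (y * \1_(h n @^-1` [set y]) x)%:E)).
  by apply: eq_integral => t tE; rewrite /= fimfunE -fsumEFin.
have indich m r : measurable_fun [set: T]
    (fun x => (r * \1_(h m @^-1` [set r]) x)%:E).
  by apply: (measurable_comp measurableT) => //; exact: measurable_funM.
rewrite ge0_integral_fsum//; last by move=> m y Ey; exact: nnfun_muleindic_ge0.
transitivity (\int[mu]_x (\sum_(y \in range (h n))
    (y * \1_(h n @^-1` [set y]) x)%:E * (g x)%:E)); last first.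
  apply: eq_integral => x _.
  rewrite -ge0_mule_fsuml => [|y]; last exact: nnfun_muleindic_ge0.
  by rewrite fsumEFin // -(fimfunE _ x).
rewrite ge0_integral_fsum//; last 2 first.
  - by move=> y; exact: emeasurable_funM.
  - by move=> m y Ey; rewrite mule_ge0 ?lee_fin// -lee_fin nnfun_muleindic_ge0.
apply: eq_fsbigr => r rhn.
under eq_integral do rewrite EFinM.
rewrite integralZl_indic_nnsfun => //.
under [RHS]eq_integral do rewrite EFinM -muleA.
have [k _ hk] := set_mem rhn.
have mi : measurable_fun [set: T] (fun x => (\1_(h n @^-1` [set r]) x)%:E : \bar R).
  exact/measurable_EFinP.
rewrite ge0_integralZl//.
- under [in RHS]eq_integral do rewrite muleC.
  rewrite [in RHS](eq_integral ((EFin \o g) \_ (h n @^-1` [set r]))); last first.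
    by move=> x xE; rewrite epatch_indic.
  by rewrite -integral_mkcond -nuE// integral_indic// setIT.
- exact: emeasurable_funM.
- by move=> x _; rewrite mule_ge0 ?lee_fin.
- by rewrite lee_fin -hk.
Qed.

End density.

Section measure_with_density.
Local Open Scope ereal_scope.
Context d (T : measurableType d) (R : realType).
Variables (mu : {measure set T -> \bar R}) (g : T -> \bar R).
Variables (mg : measurable_fun [set: T] g) (g0 : forall x, 0 <= g x).

(** The measurability and sign proofs are arguments of the set function so that the canonical
    measure structure attached to it can recover them. *)
Definition with_density (_ : measurable_fun [set: T] g)
  (_ : forall x, 0 <= g x) (A : set T) := \int[mu]_(x in A) g x.
Local Notation wd := (with_density mg g0).

Let wd0 : wd set0 = 0. Proof. exact: integral_set0. Qed.

Let wd_ge0 A : 0 <= wd A. Proof. exact: integral_ge0. Qed.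

Let wd_sigma_additive : semi_sigma_additive wd.
Proof.
move=> F mF tF mUF; rewrite /with_density ge0_integral_bigcup//; last first.
  exact: measurable_funTS.
by apply: is_cvg_ereal_nneg_natsum_cond => n _ _; exact: integral_ge0.
Qed.

HB.instance Definition _ := isMeasure.Build _ _ _ wd
  wd0 wd_ge0 wd_sigma_additive.

End measure_with_density.

(** A nonnegative function with zero integral vanishes almost everywhere, which would make [A] a
    null set. *)
Lemma integral_gt0 d (T : measurableType d) (R : realType)
    (mu : {measure set T -> \bar R}) (A : set T) (f : T -> \bar R) :
  measurable A -> measurable_fun [set: T] f -> (forall x, 0 <= f x)%E ->
  (0 < mu A)%E -> (forall x, A x -> 0 < f x)%E -> (0 < \int[mu]_x f x)%E.
Proof.
move=> mA mf f0 muA fA; rewrite lt0e integral_ge0 ?andbT//.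
apply/negP => /eqP if0; move: muA; rewrite lt0e => /andP[/negP + _]; apply.
have /(ae_eq_integral_abs mu measurableT mf) : (\int[mu]_x `|f x| = 0)%E.
  by rewrite -[RHS]if0; apply: eq_integral => x _; rewrite gee0_abs.
move=> [N [mN N0 sub]]; apply/eqP; apply: (subset_measure0 _ _ _ N0) => //.
move=> x Ax; apply: sub => /= /(_ I) fx0; have := fA _ Ax.
by rewrite fx0 ltxx.
Qed.

Notation pushm :=
  measure_function_pushforward__canonical__measure_function_Measure.

Section affine_substitution.
Context {R : realType}.
Local Notation mu := (@lebesgue_measure R).

(** The image of Lebesgue measure under [x |-> b * x + a], multiplied by [b], gives half-open
    intervals their length, so it is Lebesgue measure by uniqueness. *)
Lemma ge0_integral_affine (a b : R) (f : R -> \bar R) : 0 < b ->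
  measurable_fun [set: R] f -> (forall x, 0 <= f x)%E ->
  (\int[mu]_x f x = b%:E * \int[mu]_x f (b * x + a)%R)%E.
Proof.
move=> b0 mf f0.
pose phi (x : measurableTypeR R) : measurableTypeR R := b * x + a.
have mphi : measurable_fun [set: R] phi.
  by apply: measurable_funD => //; exact: measurable_funM.
pose nb : {nonneg R} := NngNum (ltW b0).
transitivity (\int[mscale nb (pushm mu mphi)]_x f x)%E; last first.
  by rewrite ge0_integral_mscale//= ge0_integral_pushforward.
apply: eq_measure_integral => A mA _; apply: lebesgue_measure_unique => //.
move=> _ [[x y] /= _ <-].
rewrite /mscale/= /pushforward.
rewrite (_ : phi @^-1` `]x, y]%classic = `](x - a) / b, (y - a) / b]%classic).
  rewrite !lebesgue_measure_itv/= !lte_fin ltr_pM2r ?invr_gt0// ltrD2r.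
  case: ifPn => _; last by rewrite mule0.
  rewrite -EFinM; congr (_%:E); field; exact: lt0r_neq0.
apply/seteqP; split => z; rewrite /phi /= !in_itv/=.
  by rewrite ltr_pdivrMr// ler_pdivlMr// ltrBlDr lerBrDr mulrC.
by rewrite ltr_pdivrMr// ler_pdivlMr// ltrBlDr lerBrDr mulrC.
Qed.

Lemma ge0_integral_opp (f : R -> \bar R) :
  measurable_fun [set: R] f -> (forall x, 0 <= f x)%E ->
  (\int[mu]_x f x = \int[mu]_x f (- x)%R)%E.
Proof.
move=> mf f0; transitivity
    (\int[pushforward mu (-%R : _ -> measurableTypeR R)]_x f x)%E.
  by apply: eq_measure_integral => A mA _; exact/esym/lebesgue_measureN.
by rewrite ge0_integral_pushforward.
Qed.

End affine_substitution.

(** * Measurability rules and a tactic that applies them *)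

Section measurability.
Context d (T : measurableType d) (R : realType).
Implicit Types f g : T -> R.

Lemma mfunD f g : measurable_fun [set: T] f -> measurable_fun [set: T] g ->
  measurable_fun [set: T] (fun x => f x + g x).
Proof. exact: measurable_funD. Qed.

Lemma mfunM f g : measurable_fun [set: T] f -> measurable_fun [set: T] g ->
  measurable_fun [set: T] (fun x => f x * g x).
Proof. exact: measurable_funM. Qed.

Lemma mfunN f : measurable_fun [set: T] f ->
  measurable_fun [set: T] (fun x => - f x).
Proof. exact: measurableT_comp. Qed.

Lemma mfunX n f : measurable_fun [set: T] f ->
  measurable_fun [set: T] (fun x => f x ^+ n).
Proof. exact: measurable_funX. Qed.

Lemma mfun_expR f : measurable_fun [set: T] f ->
  measurable_fun [set: T] (fun x => expR (f x)).
Proof. by move=> mf; apply: measurableT_comp => //; exact: measurable_expR. Qed.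

Lemma mfun_ln f : measurable_fun [set: T] f ->
  measurable_fun [set: T] (fun x => ln (f x)).
Proof. by move=> mf; apply: measurableT_comp => //; exact: measurable_ln. Qed.

Lemma mfun_EFin f : measurable_fun [set: T] f ->
  measurable_fun [set: T] (fun x => (f x)%:E).
Proof. by move=> mf; exact/measurable_EFinP. Qed.

(** Inversion is continuous only off [0]; the point [0], where its value is [0] by convention, is a
    measurable singleton treated apart. *)
Lemma mfun_inv f : measurable_fun [set: T] f ->
  measurable_fun [set: T] (fun x => (f x)^-1).
Proof.
move=> mf; have minv : measurable_fun [set: R] (fun x : R => x^-1).
  have -> : [set: R] = [set x | x != 0] `|` [set 0].
    by apply/seteqP; split => // x _; have [->|] := eqVneq x 0; [right|left].
  apply/measurable_funU => //.
  - rewrite (_ : [set x | x != 0] = ~` [set 0]); first exact: measurableC.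
    by apply/seteqP; split => x /= /eqP.
  - split; last exact: measurable_fun_set1.
    apply: open_continuous_measurable_fun.
      exact: open_neq.
    by move=> x; rewrite inE /= => x0; exact: inv_continuous.
exact: (measurableT_comp minv).
Qed.

Lemma mfun_fst d1 d2 (T1 : measurableType d1) (T2 : measurableType d2)
    (f : T -> T1 * T2) : measurable_fun [set: T] f ->
  measurable_fun [set: T] (fun x => (f x).1).
Proof. exact: (measurableT_comp measurable_fst). Qed.

Lemma mfun_snd d1 d2 (T1 : measurableType d1) (T2 : measurableType d2)
    (f : T -> T1 * T2) : measurable_fun [set: T] f ->
  measurable_fun [set: T] (fun x => (f x).2).
Proof. exact: (measurableT_comp measurable_snd). Qed.

Lemma mfun_pair d1 d2 (T1 : measurableType d1) (T2 : measurableType d2)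
    (f : T -> T1) (g : T -> T2) : measurable_fun [set: T] f ->
  measurable_fun [set: T] g -> measurable_fun [set: T] (fun x => (f x, g x)).
Proof. exact: measurable_fun_pair. Qed.

Lemma mfun_emul (f g : T -> \bar R) :
  measurable_fun [set: T] f -> measurable_fun [set: T] g ->
  measurable_fun [set: T] (fun x => f x * g x)%E.
Proof. exact: emeasurable_funM. Qed.

Lemma mfun_eadd (f g : T -> \bar R) :
  measurable_fun [set: T] f -> measurable_fun [set: T] g ->
  measurable_fun [set: T] (fun x => f x + g x)%E.
Proof. exact: emeasurable_funD. Qed.

Lemma mfun_lt f g : measurable_fun [set: T] f -> measurable_fun [set: T] g ->
  measurable_fun [set: T] (fun x => f x < g x).
Proof. exact: measurable_fun_ltr. Qed.

Lemma mfun_le f g : measurable_fun [set: T] f -> measurable_fun [set: T] g ->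
  measurable_fun [set: T] (fun x => f x <= g x).
Proof. exact: measurable_fun_ler. Qed.

Lemma mfun_and (f g : T -> bool) :
  measurable_fun [set: T] f -> measurable_fun [set: T] g ->
  measurable_fun [set: T] (fun x => f x && g x).
Proof. exact: measurable_and. Qed.

Lemma mfun_if d' (T' : measurableType d') (b : T -> bool) (f g : T -> T') :
  measurable_fun [set: T] b ->
  measurable_fun [set: T] f -> measurable_fun [set: T] g ->
  measurable_fun [set: T] (fun x => if b x then f x else g x).
Proof. exact: measurable_fun_ifT. Qed.

Lemma measurable_bool_set (b : T -> bool) : measurable_fun [set: T] b ->
  measurable [set x | b x].
Proof.
move=> mb; rewrite (_ : [set x | b x] = setT `&` b @^-1` [set true]).
  exact: mb.
by rewrite setTI; apply/seteqP; split.
Qed.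

End measurability.

(** Syntax-directed on the outermost operation. The generic composition pattern comes last, so that
    it only catches functions without a rule of their own. *)
Ltac mfun := lazymatch goal with
  | |- measurable_fun _ (fun x => x) => exact: measurable_id
  | |- measurable_fun _ (fun _ => ?c) => exact: measurable_cst
  | |- measurable_fun _ (fun x => ((@?f x)%:E)%E) => apply: (@mfun_EFin _ _ _ f); mfun
  | |- measurable_fun _ (fun x => ((@?f x) * (@?g x))%E) => apply: (@mfun_emul _ _ _ f g); mfun
  | |- measurable_fun _ (fun x => ((@?f x) + (@?g x))%E) => apply: (@mfun_eadd _ _ _ f g); mfun
  | |- measurable_fun _ (fun x => (@?f x) + (@?g x)) => apply: (@mfunD _ _ _ f g); mfun
  | |- measurable_fun _ (fun x => (@?f x) * (@?g x)) => apply: (@mfunM _ _ _ f g); mfun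
  | |- measurable_fun _ (fun x => - (@?f x)) => apply: (@mfunN _ _ _ f); mfun
  | |- measurable_fun _ (fun x => (@?f x) ^+ ?n) => apply: (@mfunX _ _ _ n f); mfun
  | |- measurable_fun _ (fun x => (@?f x) < (@?g x)) => apply: (@mfun_lt _ _ _ f g); mfun
  | |- measurable_fun _ (fun x => (@?f x) <= (@?g x)) => apply: (@mfun_le _ _ _ f g); mfun
  | |- measurable_fun _ (fun x => (@?f x) && (@?g x)) => apply: (@mfun_and _ _ f g); mfun
  | |- measurable_fun _ (fun x => if _ then _ else _) => apply: mfun_if; mfun
  | |- measurable_fun _ (fun x => (@?f x)^-1) => apply: (@mfun_inv _ _ _ f); mfun
  | |- measurable_fun _ (fun x => expR (@?f x)) => apply: (@mfun_expR _ _ _ f); mfun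
  | |- measurable_fun _ (fun x => ln (@?f x)) => apply: (@mfun_ln _ _ _ f); mfun
  | |- measurable_fun _ (fun x => (@?f x).1) => apply: (@mfun_fst _ _ _ _ _ _ f); mfun
  | |- measurable_fun _ (fun x => (@?f x).2) => apply: (@mfun_snd _ _ _ _ _ _ f); mfun
  | |- measurable_fun _ (fun x => (@?f x, @?g x)) => apply: (@mfun_pair _ _ _ _ _ _ f g); mfun
  | |- measurable_fun _ (fun x => ?h (@?f x)) => apply: (@measurableT_comp _ _ _ _ _ _ h _ f); [try done|mfun]
  | |- _ => try done
  end.

Section integral_total.
Local Open Scope ereal_scope.
Context d (T : measurableType d) (R : realType) (mu : {measure set T -> \bar R}).
Implicit Types f g : T -> \bar R.

Lemma ge0_integralTD f g : measurable_fun [set: T] f ->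
  measurable_fun [set: T] g -> (forall x, 0 <= f x) -> (forall x, 0 <= g x) ->
  \int[mu]_x f x + \int[mu]_x g x = \int[mu]_x (f x + g x).
Proof. by move=> mf mg f0 g0; rewrite ge0_integralD. Qed.

Lemma ge0_integralTZ (k : R) f : measurable_fun [set: T] f ->
  (forall x, 0 <= f x) -> (0 <= k)%R ->
  \int[mu]_x (k%:E * f x) = k%:E * \int[mu]_x f x.
Proof. by move=> mf f0 k0; rewrite ge0_integralZl. Qed.

Lemma ge0_le_integralT f g : measurable_fun [set: T] f ->
  measurable_fun [set: T] g -> (forall x, 0 <= f x) ->
  (forall x, f x <= g x) -> \int[mu]_x f x <= \int[mu]_x g x.
Proof. by move=> mf mg f0 fg; exact: ge0_le_integral. Qed.

End integral_total.

(** * Symmetrization, and the standard normal law under scaling and shifting *)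

Section lebesgue_symmetrization.
Context {R : realType}.
Local Notation mu := (@lebesgue_measure R).

(** Symmetrization doubles both sides of an inequality; this halves them again, infinite values
    included. *)
Lemma lee_add_self (x y : \bar R) : (0 <= y -> x + x <= y + y -> x <= y)%E.
Proof.
move=> _ xy; rewrite leNgt; apply/negP => yx.
by move: xy; rewrite leNgt lteD.
Qed.

(** Twice the hyperbolic cosine is even and increases with the modulus of its argument. For
    [x = expR u <= y = expR v] the increment is [(y - x) * (1 - (x * y)^-1)], nonnegative since
    [x * y = expR (u + v) >= 1]. *)
Lemma expR_cosh_le (s t : R) : s ^+ 2 <= t ^+ 2 ->
  expR s + expR (- s) <= expR t + expR (- t).
Proof.
have pos u v : 0 <= u -> u <= v -> expR u + expR (- u) <= expR v + expR (- v).
  move=> u0 uv.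
  have e1 : expR (u + v) >= 1 by rewrite -expR0 ler_expR; lra.
  rewrite !expRN; move: e1; rewrite expRD.
  have : expR u <= expR v by rewrite ler_expR.
  have := expR_gt0 u; have := expR_gt0 v.
  move: (expR u) (expR v) => x y y0 x0 xy e1.
  have -> : y + y^-1 = x + x^-1 + (y - x) * (1 - (x * y)^-1).
    by field; rewrite !gt_eqF.
  rewrite lerDl mulr_ge0 ?subr_ge0// invf_le1//; exact: mulr_gt0.
have norm u : expR u + expR (- u) = expR `|u| + expR (- `|u|) :> R.
  by case: (ger0P u) => // _; rewrite opprK addrC.
by rewrite -ler_sqrt ?sqr_ge0// !sqrtr_sqr (norm s) (norm t) => st; exact: pos.
Qed.

(** As [h] is even, adding the reflected integral replaces [expR (c * x)] by twice a hyperbolic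
    cosine, which grows with [c ^+ 2] at each [x]. *)
Lemma integral_even_expR_le (h : R -> \bar R) (c c' : R) :
  measurable_fun [set: R] h -> (forall x, 0 <= h x)%E ->
  (forall x, h (- x) = h x) -> c ^+ 2 <= c' ^+ 2 ->
  (\int[mu]_x (h x * (expR (c * x))%:E) <=
   \int[mu]_x (h x * (expR (c' * x))%:E))%E.
Proof.
move=> mh h0 hN cc'.
have me k : measurable_fun [set: R] (fun x => (expR (k * x))%:E).
  by mfun.
have dbl k : (\int[mu]_x (h x * (expR (k * x))%:E) +
    \int[mu]_x (h x * (expR (k * x))%:E) =
    \int[mu]_x (h x * (expR (k * x) + expR (- (k * x)))%:E))%E.
  rewrite [X in (_ + X)%E]ge0_integral_opp; last 2 first.
  - by mfun.
  - by move=> x; rewrite mule_ge0// lee_fin expR_ge0.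
  rewrite -ge0_integralD//=.
  - by apply: eq_integral => x _; rewrite hN mulrN EFinD ge0_muleDr ?lee_fin ?expR_ge0.
  - by move=> x _; rewrite mule_ge0// lee_fin expR_ge0.
  - by mfun.
  - by move=> x _; rewrite mule_ge0// lee_fin expR_ge0.
  - by mfun.
apply: lee_add_self.
  by apply: integral_ge0 => x _; rewrite mule_ge0// lee_fin expR_ge0.
rewrite [leLHS](dbl c) [leRHS](dbl c'); apply: ge0_le_integralT.
- by mfun.
- by mfun.
- by move=> x; rewrite mule_ge0// lee_fin addr_ge0 ?expR_ge0.
move=> x; rewrite lee_wpmul2l// lee_fin expR_cosh_le// !exprMn.
by rewrite ler_wpM2r// sqr_ge0.
Qed.

End lebesgue_symmetrization.

Section standard_normal.
Context {R : realType}.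
Local Notation mu := (@lebesgue_measure R).
Local Notation G := (@normal_prob R 0 1).
Local Notation n01 := (@normal_pdf R 0 1).

Lemma normal_pdf01E x : n01 x = normal_peak 1 * expR (- (x ^+ 2 / 2)) :> R.
Proof.
by rewrite normal_pdfE ?oner_neq0// /normal_fun subr0 expr1n mulNr.
Qed.

Lemma normal_pdf_standard (m s y : R) : 0 < s ->
  s * normal_pdf m s (s * y + m) = n01 y.
Proof.
move=> s0; rewrite normal_pdf01E normal_pdfE ?gt_eqF// mulrA /normal_fun.
congr (_ * _).
  rewrite /normal_peak expr1n mul1r -mulrnAr sqrtrM ?sqr_ge0// sqrtr_sqr.
  rewrite gtr0_norm// invfM mulrA divff ?mul1r ?gt_eqF//.
congr expR; rewrite addrK; field; exact: lt0r_neq0.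
Qed.

(** Turns the normal laws of the model, whose scale depends on [tau], into images of one fixed
    standard normal law. *)
Lemma normal_prob_standard (m s : R) (A : set R) : 0 < s -> measurable A ->
  normal_prob m s A = G [set y | A (s * y + m)].
Proof.
move=> s0 mA.
have mphi : measurable_fun [set: R] (fun y => s * y + m) by mfun.
have mA' : measurable [set y | A (s * y + m)].
  by rewrite -[X in measurable X]setTI; exact: mphi.
rewrite /normal_prob integral_mkcond [in RHS]integral_mkcond.
rewrite (@ge0_integral_affine _ m s)//; last 2 first.
- apply/(measurable_restrictT _ _).1 => //; apply: measurable_funTS.
  by apply/measurable_EFinP; exact: measurable_normal_pdf.
- by move=> x; apply: erestrict_ge0 => y _; rewrite lee_fin normal_pdf_ge0.
rewrite -ge0_integralZl ?lee_fin ?ltW//.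
- apply: eq_integral => x _; rewrite !patchE -(@normal_pdf_standard m s x)//.
  have -> : (x \in [set y | A (s * y + m)]) = (s * x + m \in A).
    by apply/idP/idP => /set_mem ?; exact/mem_set.
  by case: ifP => _; rewrite ?mule0 ?EFinM.
- apply: measurableT_comp => //; apply/(measurable_restrictT _ _).1 => //.
  apply: measurable_funTS.
  by apply/measurable_EFinP; exact: measurable_normal_pdf.
- by move=> x _; apply: erestrict_ge0 => y _; rewrite lee_fin normal_pdf_ge0.
Qed.

Lemma ge0_integral_normal (f : R -> \bar R) :
  measurable_fun [set: R] f -> (forall x, 0 <= f x)%E ->
  (\int[G]_x f x = \int[mu]_x (f x * (n01 x)%:E))%E.
Proof.
by move=> mf f0; apply: ge0_integral_density => //;
  [exact: measurable_normal_pdf|exact: normal_pdf_ge0].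
Qed.

Lemma measurable_sqD (phi : R -> \bar R) (a : R) : measurable_fun [set: R] phi ->
  measurable_fun [set: R] (fun y => phi ((a + y) ^+ 2)).
Proof. by move=> mphi; apply: measurableT_comp => //; mfun. Qed.

Lemma integral_normal_shift (phi : R -> \bar R) (a b : R) : 0 < b ->
  measurable_fun [set: R] phi -> (forall x, 0 <= phi x)%E ->
  (\int[G]_y phi ((a + y) ^+ 2)%R =
   b%:E * \int[mu]_x (phi ((b * x) ^+ 2)%R * (n01 (b * x - a))%:E))%E.
Proof.
move=> b0 mphi phi0; rewrite ge0_integral_normal//; last exact: measurable_sqD.
rewrite (@ge0_integral_affine _ (- a) b)//.
- by congr (_ * _)%E; apply: eq_integral => x _; rewrite addrC subrK.
- apply: emeasurable_funM; first exact: measurable_sqD.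
  by apply/measurable_EFinP; exact: measurable_normal_pdf.
- by move=> x; rewrite mule_ge0// lee_fin normal_pdf_ge0.
Qed.

(** For [a = 0] both sides are equal by the change of variables [y |-> b * y]; a nonzero center can
    only make the right side larger. *)
Lemma normal_scale_le (phi : R -> \bar R) (a b : R) : 1 <= b ->
  measurable_fun [set: R] phi -> (forall x, 0 <= phi x)%E ->
  (b%:E * \int[G]_y (phi (b ^+ 2 * (a + y) ^+ 2)%R
      * (expR (- ((b ^+ 2 - 1) / 2 * (a + y) ^+ 2)))%:E) <=
   \int[G]_y phi ((a + y) ^+ 2)%R)%E.
Proof.
move=> b1 mphi phi0; have b0 : 0 < b by exact: lt_le_trans b1.
rewrite (@integral_normal_shift phi a b)//.
rewrite lee_pmul2l ?lte_fin//.
have mphi2 : measurable_fun [set: R] (fun x => phi (b ^+ 2 * x)%R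
    * (expR (- ((b ^+ 2 - 1) / 2 * x)))%:E)%E.
  apply: emeasurable_funM; first by apply: measurableT_comp => //; mfun.
  by mfun.
rewrite (@integral_normal_shift (fun x => phi (b ^+ 2 * x)%R
    * (expR (- ((b ^+ 2 - 1) / 2 * x)))%:E)%E a 1)//; last first.
  by move=> x; rewrite mule_ge0// lee_fin expR_ge0.
rewrite mul1e.
(* The even factor common to both integrands once the squares in the exponents are expanded. What
   remains is [expR (a * x)] on the left and [expR (a * b * x)] on the right. *)
pose h x := (phi (b ^+ 2 * x ^+ 2)%R *
  (normal_peak 1 * expR (- ((b ^+ 2 * x ^+ 2 + a ^+ 2) / 2)))%:E)%E.
have mh : measurable_fun [set: R] h.
  apply: emeasurable_funM; first by apply: measurableT_comp => //; mfun.
  by mfun.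
have h0 x : (0 <= h x)%E.
  by rewrite mule_ge0// lee_fin mulr_ge0 ?expR_ge0// normal_peak_ge0.
have hN x : h (- x) = h x by rewrite /h sqrrN.
have aab : a ^+ 2 <= (a * b) ^+ 2.
  by rewrite exprMn ler_peMr ?sqr_ge0// exprn_ege1.
have := integral_even_expR_le mh h0 hN aab.
rewrite (_ : (fun x => h x * (expR (a * x))%:E)%E = fun x =>
  (phi (b ^+ 2 * (1 * x) ^+ 2)%R *
    (expR (- ((b ^+ 2 - 1) / 2 * (1 * x) ^+ 2)))%:E * (n01 (1 * x - a))%:E)%E).
  rewrite (_ : (fun x => h x * (expR (a * b * x))%:E)%E = fun x =>
    (phi ((b * x) ^+ 2)%R * (n01 (b * x - a))%:E)%E)//.
  apply/funext => x; rewrite /h -muleA exprMn; congr (_ * _)%E.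
  rewrite -EFinM normal_pdf01E -[in LHS](mulrA (normal_peak 1)) -expRD.
  congr (_ * expR _)%:E.
  by field.
apply/funext => x; rewrite /h -!muleA mul1r; congr (_ * _)%E.
rewrite -!EFinM normal_pdf01E -[in LHS](mulrA (normal_peak 1)).
rewrite [in RHS](mulrCA _ (normal_peak 1)) -!expRD.
by congr (_ * expR _)%:E; field.
Qed.

(** The noncentral chi-square with one degree of freedom increases stochastically with [a ^+ 2].
    After doubling, the claim is a two-term rearrangement inequality at each [x]: the sum is larger
    when the larger value of [phi] meets the larger density. *)
Lemma normal_shift_noninc (phi : R -> \bar R) (a a' : R) :
  measurable_fun [set: R] phi -> (forall x, 0 <= phi x)%E ->
  (forall x y : R, 0 <= x -> x <= y -> (phi y <= phi x)%E) ->
  a ^+ 2 <= a' ^+ 2 ->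
  (\int[G]_y phi ((a' + y) ^+ 2)%R <= \int[G]_y phi ((a + y) ^+ 2)%R)%E.
Proof.
move=> mphi phi0 phidec aa'.
have I1 k : (\int[G]_y phi ((k + y) ^+ 2)%R =
    \int[mu]_x (phi (x ^+ 2)%R * (n01 (x - k))%:E))%E.
  rewrite (@integral_normal_shift phi k 1)// mul1e.
  by apply: eq_integral => x _; rewrite mul1r.
have mn k : measurable_fun [set: R] (fun x : R => (n01 (x - k))%:E).
  apply/measurable_EFinP; apply: measurableT_comp => //; last by mfun.
  exact: measurable_normal_pdf.
have mp : measurable_fun [set: R] (fun x => phi (x ^+ 2)).
  by apply: measurableT_comp => //; mfun.
have mp' k : measurable_fun [set: R] (fun x => phi ((k - x) ^+ 2)).
  by apply: measurableT_comp => //; mfun.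
have n0 x : (0 <= (n01 x)%:E)%E by rewrite lee_fin normal_pdf_ge0.
have nN x : n01 (- x) = n01 x by rewrite !normal_pdf01E sqrrN.
(* The reflection [x |-> k + l - x] exchanges the centers [k] and [l]. *)
have I2 k l : (\int[mu]_x (phi (x ^+ 2)%R * (n01 (x - k))%:E) =
    \int[mu]_x (phi (((k + l) - x) ^+ 2)%R * (n01 (x - l))%:E))%E.
  rewrite (@ge0_integral_affine _ (k + l) 1)//; last 2 first.
  - exact: emeasurable_funM.
  - by move=> x; rewrite mule_ge0.
  rewrite mul1e ge0_integral_opp.
  - apply: eq_integral => x _; rewrite mulrN mul1r.
    congr (phi (_ ^+ 2)%R * _)%E; first by rewrite addrC.
    by rewrite -nN; congr (n01 _)%:E; ring.
  - apply: emeasurable_funM; first by apply: measurableT_comp => //; mfun.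
    apply/measurable_EFinP; apply: measurableT_comp; last by mfun.
    exact: measurable_normal_pdf.
  - by move=> x; rewrite mule_ge0.
have I0 k : (0 <= \int[mu]_x (phi (x ^+ 2)%R * (n01 (x - k))%:E))%E.
  by apply: integral_ge0 => x _; rewrite mule_ge0.
rewrite (I1 a) (I1 a'); apply: lee_add_self; first exact: I0.
have dbl k l : (\int[mu]_x (phi (x ^+ 2)%R * (n01 (x - k))%:E) +
    \int[mu]_x (phi (x ^+ 2)%R * (n01 (x - k))%:E) =
    \int[mu]_x (phi (x ^+ 2)%R * (n01 (x - k))%:E +
      phi (((k + l) - x) ^+ 2)%R * (n01 (x - l))%:E))%E.
  rewrite [X in (_ + X)%E](I2 k l); apply: ge0_integralTD.
  - exact: mfun_emul (mp) (mn k).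
  - exact: mfun_emul (mp' (k + l)) (mn l).
  - by move=> x; rewrite mule_ge0.
  - by move=> x; rewrite mule_ge0.
rewrite [leLHS](dbl a' a) [leRHS](dbl a a').
apply: ge0_le_integralT.
- by apply: mfun_eadd; [exact: mfun_emul (mp) (mn _)|exact: mfun_emul (mp' _) (mn _)].
- by apply: mfun_eadd; [exact: mfun_emul (mp) (mn _)|exact: mfun_emul (mp' _) (mn _)].
- by move=> x; rewrite adde_ge0// mule_ge0.
(* The rearrangement inequality for two pairs, where the values of [phi] may be infinite. *)
have rearr (p q : \bar R) (s t : R) : (0 <= q -> q <= p)%E -> 0 <= t -> t <= s ->
    (0 <= q -> p * t%:E + q * s%:E <= p * s%:E + q * t%:E)%E.
  move=> qp t0 ts q0; have {}qp := qp q0.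
  case: q q0 qp => [q|//|//].
  - case: p => [p| |//] q0 qp.
      rewrite -!EFinM -!EFinD lee_fin; rewrite !lee_fin in q0 qp.
      have : (p - q) * (s - t) >= 0 by rewrite mulr_ge0 ?subr_ge0.
      by rewrite !mulrBr !mulrBl; lra.
    move: ts; rewrite le_eqVlt => /orP[/eqP ->//|ts].
    have -> : (+oo * s%:E = +oo)%E.
      by rewrite gt0_mulye ?lte_fin ?(le_lt_trans t0 ts).
    by rewrite -[(q%:E * t%:E)%E]EFinM addye ?leey.
  - by move=> _; rewrite leye_eq => /eqP ->; rewrite addeC.
move=> x.
have nle u v : u ^+ 2 <= v ^+ 2 -> n01 v <= n01 u.
  move=> uv; rewrite !normal_pdf01E ler_wpM2l ?normal_peak_ge0// ler_expR.
  lra.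
(* With [w = a + a' - x *+ 2], the sign of [(a + a') * w] tells which of [x ^+ 2] and
   [(a + a' - x) ^+ 2] is smaller, and that of [(a' - a) * w] tells which center is nearer to [x].
   The two signs agree because [(a + a') * (a' - a) >= 0]. *)
have same_sign (c w e : R) : 0 < c * w -> 0 <= c * e -> 0 <= e * w.
  move=> cw ce; rewrite leNgt; apply/negP => ew.
  have : (c * w) * (e * w) < 0 by rewrite pmulr_rlt0.
  by rewrite mulrACA -expr2 ltNge mulr_ge0// sqr_ge0.
have ca : 0 <= (a + a') * (a' - a) by lra.
rewrite (addrC a' a).
have [e|e|e] := ltgtP (x ^+ 2) ((a + a' - x) ^+ 2).
- apply: rearr => //; first by move=> _; apply: phidec; rewrite ?sqr_ge0 ?ltW.
    exact: normal_pdf_ge0.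
  apply: nle; have := @same_sign (a + a') (a + a' - x *+ 2) (a' - a).
  by move=> /(_ _ ca) h; rewrite -subr_ge0 (le_trans (h _))//; lra.
- rewrite addeC [leRHS]addeC; apply: rearr => //.
  + by move=> _; apply: phidec; rewrite ?sqr_ge0 ?ltW.
  + exact: normal_pdf_ge0.
  + apply: nle; have := @same_sign (a + a') (x *+ 2 - (a + a')) (a' - a).
    by move=> /(_ _ ca) h; rewrite -subr_ge0 (le_trans (h _))//; lra.
- by rewrite e addeC.
Qed.

End standard_normal.

(** * The chi-square law: total mass and scaling *)

Section chi_square_law.
Context {R : realType}.
Local Notation mu := (@lebesgue_measure R).

Lemma measurable_fun_gt0 (f : R -> R) : measurable_fun [set: R] f ->
  measurable_fun [set: R] (fun x => if 0 < x then f x else 0).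
Proof.
by move=> mf; apply: measurable_fun_ifT => //; exact: measurable_fun_ltr.
Qed.

Lemma Gamma_ge0 (a : R) : 0 <= Gamma a.
Proof.
by apply: Rintegral_ge0 => x _; rewrite mulr_ge0 ?expR_ge0// powR_ge0.
Qed.

Lemma chi2_pdf_ge0 k (x : R) : 0 <= chi2_pdf k x.
Proof.
rewrite /chi2_pdf; case: ifP => // _.
by rewrite divr_ge0// mulr_ge0 ?powR_ge0 ?expR_ge0// Gamma_ge0.
Qed.

Lemma measurable_chi2_pdf k : measurable_fun [set: R] (@chi2_pdf R k).
Proof.
apply: measurable_fun_gt0; apply: mfunM; last exact: measurable_cst.
apply: mfunM; first exact: measurable_powR.
by mfun.
Qed.

(* [lebesgue_measure] lives on [measurableTypeR R], which is not the canonical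
   measurable structure of [R] although it has the same measurable sets. *)
Definition chi2_law (k : nat) (A : set (measurableTypeR R)) : \bar R :=
  chi2_prob k A.

Section measure.
Variable k : nat.

Let chi20 : chi2_law k set0 = 0%E. Proof. exact: integral_set0. Qed.

Let chi2_ge0 A : (0 <= chi2_law k A)%E.
Proof. by apply: integral_ge0 => x _; rewrite lee_fin chi2_pdf_ge0. Qed.

Let chi2_sigma_additive : semi_sigma_additive (chi2_law k).
Proof.
move=> F mF tF mUF; rewrite /chi2_law /chi2_prob ge0_integral_bigcup//.
- apply: is_cvg_ereal_nneg_natsum_cond => n _ _.
  by apply: integral_ge0 => x _; rewrite lee_fin chi2_pdf_ge0.
- by apply: measurable_funTS; apply: mfun_EFin; exact: measurable_chi2_pdf.
- by move=> x _; rewrite lee_fin chi2_pdf_ge0.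
Qed.

HB.instance Definition _ := isMeasure.Build _ _ _ (chi2_law k)
  chi20 chi2_ge0 chi2_sigma_additive.

(* If the integral defining [Gamma] were infinite, [Gamma] would be the junk
   value 0 and the density would vanish. *)
Lemma chi2_probT : chi2_law k setT = 0%E \/ chi2_law k setT = 1%E.
Proof.
set a : R := k%:R / 2.
pose h (x : R) := if 0 < x then x `^ (a - 1) * expR (- x / 2) else 0.
pose g (x : R) := if 0 < x then x `^ (a - 1) * expR (- x) else 0.
have mh : measurable_fun [set: R] h.
  by apply: measurable_fun_gt0; apply: mfunM; [exact: measurable_powR|mfun].
have mg : measurable_fun [set: R] g.
  by apply: measurable_fun_gt0; apply: mfunM; [exact: measurable_powR|mfun].
have h0 x : (0 <= (h x)%:E)%E.
  by rewrite lee_fin /h; case: ifP => // _; rewrite mulr_ge0 ?powR_ge0 ?expR_ge0.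
have g0 x : (0 <= (g x)%:E)%E.
  by rewrite lee_fin /g; case: ifP => // _; rewrite mulr_ge0 ?powR_ge0 ?expR_ge0.
have GammaE : Gamma a = fine (\int[mu]_x (g x)%:E).
  rewrite /Gamma /Rintegral; congr fine; rewrite integral_mkcond.
  apply: eq_integral => x _; rewrite patchE /g.
  rewrite (_ : (x \in `]0, +oo[%classic) = (0 < x)); first by case: ifP.
  by rewrite mem_setE in_itv/= andbT.
(* Substituting [2 * x] passes from rate [1 / 2] to rate [1]; the power of [2] it produces cancels
   the one in [chi2_pdf]. *)
have hE : (\int[mu]_x (h x)%:E = (2 `^ a)%:E * \int[mu]_x (g x)%:E)%E.
  apply: (etrans (@ge0_integral_affine _ 0 2 _ _ (mfun_EFin mh) h0)) => //.
  apply: (etrans _ (ge0_integralTZ mu (mfun_EFin mg) g0 (powR_ge0 _ _))).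
  apply: (etrans (esym (@ge0_integralTZ _ _ _ mu 2
    (fun x : R => (h (2 * x + 0))%:E) _ (fun x => h0 (2 * x + 0)) _))).
  - by apply: (measurableT_comp (mfun_EFin mh)); mfun.
  - exact: ler0n.
  apply: eq_integral => x _; rewrite -!EFinM addr0 /h /g pmulr_rgt0//.
  case: ifPn => [x0|_]; last by rewrite !mulr0.
  rewrite powRM ?ltW// !mulrA; congr (_ * _ * expR _)%:E; last by field.
  rewrite -{1}(powRr1 (_ : 0 <= 2 :> R))// -powRD ?pnatr_eq0 ?implybT//.
  by congr (_ `^ _); ring.
have -> : chi2_law k setT = ((2 `^ a * Gamma a)^-1%:E * \int[mu]_x (h x)%:E)%E.
  rewrite -ge0_integralTZ//; last 2 first.
  - exact: mfun_EFin.
  - by rewrite invr_ge0 mulr_ge0 ?powR_ge0// Gamma_ge0.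
  apply: eq_integral => x _; rewrite -EFinM; congr EFin.
  by rewrite /chi2_pdf /h -/a; case: ifP => _; rewrite ?mulr0// mulrC.
have [G0|G0] := eqVneq (Gamma a) 0.
  by left; rewrite G0 mulr0 invr0 mul0e.
right; have gfin : (\int[mu]_x (g x)%:E)%E \is a fin_num.
  have : (0 <= \int[mu]_x (g x)%:E)%E by apply: integral_ge0.
  by move: GammaE G0; case: (\int[mu]_x (g x)%:E)%E => //= ->; rewrite eqxx.
rewrite hE -(fineK gfin) -GammaE -!EFinM; congr EFin.
by field; rewrite G0 gt_eqF// powR_gt0.
Qed.

Let chi2_prob_le1 : (chi2_law k setT <= 1)%E.
Proof. by case: chi2_probT => ->; rewrite lee_fin. Qed.

HB.instance Definition _ :=
  Measure_isSubProbability.Build _ _ _ (chi2_law k) chi2_prob_le1.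

Lemma ge0_integral_chi2 (f : R -> \bar R) :
  measurable_fun [set: R] f -> (forall x, 0 <= f x)%E ->
  (\int[chi2_law k]_x f x = \int[mu]_x (f x * (chi2_pdf k x)%:E))%E.
Proof.
by move=> mf f0; apply: ge0_integral_density => //;
  [exact: measurable_chi2_pdf|exact: chi2_pdf_ge0].
Qed.

(** Scaling by a square makes the resulting factor an integer power [b ^+ k] for odd [k] as well, so
    real powers do not appear after this point. *)
Lemma chi2_pdf_scale (b x : R) : 0 < b ->
  b ^+ 2 * chi2_pdf k (b ^+ 2 * x) =
  b ^+ k * expR (- ((b ^+ 2 - 1) / 2 * x)) * chi2_pdf k x.
Proof.
move=> b0; rewrite /chi2_pdf pmulr_rgt0 ?exprn_gt0//.
case: ifPn => [x0|_]; last by rewrite !mulr0.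
rewrite powRM ?ltW ?exprn_gt0//.
have -> : b ^+ k = b ^+ 2 * (b ^+ 2) `^ (k%:R / 2 - 1).
  have e : b ^+ 2 = (b ^+ 2) `^ 1 by rewrite powRr1 ?sqr_ge0.
  rewrite [X in X * _]e -powRD ?(gt_eqF (exprn_gt0 _ b0)) ?implybT//.
  rewrite -[b ^+ 2]powR_mulrn ?ltW// -powRrM -powR_mulrn ?ltW//.
  by congr (_ `^ _); field.
have -> : - (b ^+ 2 * x) / 2 = - ((b ^+ 2 - 1) / 2 * x) + - x / 2 by field.
by rewrite expRD; ring.
Qed.

Lemma chi2_scale (f : R -> \bar R) (b : R) : 0 < b ->
  measurable_fun [set: R] f -> (forall x, 0 <= f x)%E ->
  (\int[chi2_law k]_x f x = (b ^+ k)%:E * \int[chi2_law k]_x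
     (f (b ^+ 2 * x)%R * (expR (- ((b ^+ 2 - 1) / 2 * x)))%:E))%E.
Proof.
move=> b0 mf f0; have b20 : 0 < b ^+ 2 by rewrite exprn_gt0.
have mfb : measurable_fun [set: R] (fun x => f (b ^+ 2 * x)) by mfun.
have mf2 : measurable_fun [set: R] (fun x => f (b ^+ 2 * x)%R
    * (expR (- ((b ^+ 2 - 1) / 2 * x)))%:E)%E by mfun.
have f20 x : (0 <= f (b ^+ 2 * x)%R * (expR (- ((b ^+ 2 - 1) / 2 * x)))%:E)%E.
  by rewrite mule_ge0// lee_fin expR_ge0.
have mpdf := measurable_chi2_pdf k.
have mpdfE : measurable_fun [set: R] (fun x => (chi2_pdf k x)%:E) by exact: mfun_EFin.
have mfp := mfun_emul mf mpdfE.
have fp0 x : (0 <= f x * (chi2_pdf k x)%:E)%E.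
  by rewrite mule_ge0// lee_fin chi2_pdf_ge0.
have f2p0 x : (0 <= f (b ^+ 2 * x)%R * (expR (- ((b ^+ 2 - 1) / 2 * x)))%:E
    * (chi2_pdf k x)%:E)%E by rewrite mule_ge0// lee_fin chi2_pdf_ge0.
apply: (etrans (ge0_integral_chi2 mf f0)).
apply: (etrans (@ge0_integral_affine _ 0 (b ^+ 2) _ b20 mfp fp0)).
apply: (etrans (esym (@ge0_integralTZ _ _ _ mu (b ^+ 2)
  (fun x : R => f (b ^+ 2 * x + 0)%R * (chi2_pdf k (b ^+ 2 * x + 0))%:E)%E
  _ _ (ltW b20)))).
- by apply: (measurableT_comp mfp); mfun.
- by move=> x; exact: fp0.
rewrite (ge0_integral_chi2 mf2 f20).
apply: (etrans _ (ge0_integralTZ mu (mfun_emul mf2 mpdfE) f2p0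
  (exprn_ge0 k (ltW b0)))).
apply: eq_integral => x _; rewrite addr0 muleCA -(EFinM (b ^+ 2)) chi2_pdf_scale//.
by rewrite EFinM [in LHS]EFinM -!muleA muleCA.
Qed.

End measure.

End chi_square_law.

Section canonical_real_measure.
Local Open Scope ereal_scope.
Context {R : realType}.

(** A measure on [measurableTypeR R] seen on the canonical measurable structure of [R], the one used
    by the observations and by the product spaces. *)
Definition onR (m : set (measurableTypeR R) -> \bar R) : set R -> \bar R := m.

Section measure.
Variable m : {measure set (measurableTypeR R) -> \bar R}.

Let onR0 : onR m set0 = 0. Proof. exact: measure0. Qed.

Let onR_ge0 A : 0 <= onR m A. Proof. exact: measure_ge0. Qed.

Let onR_sigma_additive : semi_sigma_additive (onR m).
Proof. exact: (@measure_semi_sigma_additive _ _ _ m). Qed.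

HB.instance Definition _ := isMeasure.Build _ _ _ (onR m)
  onR0 onR_ge0 onR_sigma_additive.

Lemma ge0_integral_onR (f : R -> \bar R) : measurable_fun [set: R] f ->
  (forall x, 0 <= f x) -> \int[onR m]_x f x = \int[m]_x f x.
Proof.
move=> mf f0; have mid : measurable_fun [set: measurableTypeR R]
    (fun x : measurableTypeR R => x : R).
  by move=> _ A mA; rewrite setTI.
have := @ge0_integral_pushforward _ _ _ _ R _ mid m setT f measurableT mf
  (fun x _ => f0 x).
by move=> <-; apply: eq_measure_integral.
Qed.

End measure.

Section sub_probability.
Variable m : subprobability (measurableTypeR R) R.
Let onR_le1 : onR m setT <= 1. Proof. exact: sprobability_setT. Qed.
HB.instance Definition _ :=
  Measure_isSubProbability.Build _ _ _ (onR m) onR_le1.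
End sub_probability.

End canonical_real_measure.

(** * The squared norm of independent normal variables with arbitrary centers *)

Section gaussian_square_norm.
Context {R : realType}.
Local Notation N01 := (onR (@normal_prob R 0 1)).

Let sq_comp (phi : R -> \bar R) (a : R) : measurable_fun [set: R] phi ->
  measurable_fun [set: R] (fun y => phi ((a + y) ^+ 2)).
Proof. exact: measurable_sqD. Qed.

Lemma onR_normal_scale_le (phi : R -> \bar R) (a b : R) : 1 <= b ->
  measurable_fun [set: R] phi -> (forall x, 0 <= phi x)%E ->
  (b%:E * \int[N01]_y (phi (b ^+ 2 * (a + y) ^+ 2)%R
      * (expR (- ((b ^+ 2 - 1) / 2 * (a + y) ^+ 2)))%:E) <=
   \int[N01]_y phi ((a + y) ^+ 2)%R)%E.
Proof.
move=> b1 mphi phi0.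
rewrite (ge0_integral_onR _ (sq_comp a mphi) (fun x => phi0 _)).
rewrite ge0_integral_onR; first exact: normal_scale_le.
- by mfun.
- by move=> x; rewrite mule_ge0// lee_fin expR_ge0.
Qed.

Lemma onR_normal_shift_noninc (phi : R -> \bar R) (a a' : R) :
  measurable_fun [set: R] phi -> (forall x, 0 <= phi x)%E ->
  (forall x y : R, 0 <= x -> x <= y -> (phi y <= phi x)%E) ->
  a ^+ 2 <= a' ^+ 2 ->
  (\int[N01]_y phi ((a' + y) ^+ 2)%R <= \int[N01]_y phi ((a + y) ^+ 2)%R)%E.
Proof.
move=> mphi phi0 phid aa'.
rewrite (ge0_integral_onR _ (sq_comp a mphi) (fun x => phi0 _)).
rewrite (ge0_integral_onR _ (sq_comp a' mphi) (fun x => phi0 _)).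
exact: normal_shift_noninc.
Qed.

Lemma onR_normalT : N01 setT = 1%E.
Proof. exact: (@probability_setT _ _ _ (@normal_prob R 0 1)). Qed.

(* E g(sum_i (l * s_i + y_i)^2) for independent standard normal y_i *)
Fixpoint sqI (s : seq R) (l : R) (g : R -> \bar R) : \bar R :=
  if s is a :: s' then
    (\int[N01]_y sqI s' l (fun z => g ((l * a + y) ^+ 2 + z)%R))%E
  else g 0.

(** The parameter space is quantified inside the induction: each coordinate is adjoined to it before
    being integrated out by Tonelli's theorem. *)
Lemma measurable_sqI (s : seq R) : forall (d : measure_display)
    (T : measurableType d) (l : T -> R) (f : T * R -> \bar R),
  measurable_fun [set: T] l -> measurable_fun [set: T * R] f ->
  (forall x, 0 <= f x)%E ->
  measurable_fun [set: T] (fun x => sqI s (l x) (fun z => f (x, z))) /\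
  (forall x, 0 <= sqI s (l x) (fun z => f (x, z)))%E.
Proof.
elim: s => [|a s IH] d T l f ml mf f0 /=.
  by split => //; apply: (measurableT_comp mf); mfun.
pose f' (w : (T * R) * R) := f (w.1.1, (l w.1.1 * a + w.1.2) ^+ 2 + w.2).
have mf' : measurable_fun setT f'.
  by apply: (measurableT_comp mf); mfun.
have [|mI I0] := IH _ [the measurableType _ of (T * R)%type] (fun w => l w.1) f' _ mf' (fun w => f0 _).
  by mfun.
split.
  exact: (@measurable_fun_fubini_tonelli_F _ _ _ _ R N01 _ mI I0).
by move=> x; apply: integral_ge0 => y _; exact: (I0 (x, y)).
Qed.

Lemma sqI_ge0 s l (g : R -> \bar R) : (forall z, 0 <= g z)%E -> (0 <= sqI s l g)%E.
Proof.
elim: s g => [|a s IH] g g0 //=.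
by apply: integral_ge0 => y _; exact: IH.
Qed.

Lemma measurable_sqI_shift s l (g : R -> \bar R) : measurable_fun [set: R] g ->
  (forall z, 0 <= g z)%E ->
  measurable_fun [set: R] (fun x => sqI s l (fun z => g (x + z))).
Proof.
move=> mg g0.
have mg2 : measurable_fun [set: R * R] (fun w => g (w.1 + w.2)) by mfun.
by have [] := measurable_sqI s (measurable_cst l) mg2 (fun w => g0 _).
Qed.

Lemma measurable_sqI_cons s l a (g : R -> \bar R) : measurable_fun [set: R] g ->
  (forall z, 0 <= g z)%E ->
  measurable_fun [set: R] (fun y => sqI s l (fun z => g ((l * a + y) ^+ 2 + z))).
Proof.
move=> mg g0; have mh := measurable_sqI_shift s l mg g0.
by apply: (measurableT_comp mh); mfun.
Qed.

Lemma measurable_addl (c : R) (g : R -> \bar R) : measurable_fun [set: R] g ->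
  measurable_fun [set: R] (fun z => g (c + z)).
Proof. by move=> mg; mfun. Qed.

Lemma sqI_le s l (g g' : R -> \bar R) : measurable_fun [set: R] g ->
  measurable_fun [set: R] g' -> (forall z, 0 <= g z)%E ->
  (forall z, 0 <= g' z)%E -> (forall z : R, 0 <= z -> (g z <= g' z)%E) ->
  (sqI s l g <= sqI s l g')%E.
Proof.
elim: s g g' => [|a s IH] g g' mg mg' g0 g'0 gg' /=; first exact: gg'.
apply: ge0_le_integralT.
- exact: measurable_sqI_cons.
- exact: measurable_sqI_cons.
- by move=> y; exact: sqI_ge0.
move=> y; apply: IH => //; try exact: measurable_addl.
by move=> z z0; rewrite gg'// addr_ge0 ?sqr_ge0.
Qed.

Lemma sqI_cst s l (c : R) : 0 <= c -> sqI s l (fun=> c%:E) = c%:E.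
Proof.
move=> c0; elim: s => [//|a s IH] /=.
under eq_integral do rewrite IH.
by rewrite integral_cst// [X in (_ * X)%E]onR_normalT mule1.
Qed.

Lemma sqID s l (g g' : R -> \bar R) : measurable_fun [set: R] g ->
  measurable_fun [set: R] g' -> (forall z, 0 <= g z)%E ->
  (forall z, 0 <= g' z)%E ->
  (sqI s l (fun z => g z + g' z) = sqI s l g + sqI s l g')%E.
Proof.
elim: s g g' => [|a s IH] g g' mg mg' g0 g'0 //=.
rewrite [RHS]ge0_integralTD; first last.
- by move=> y; exact: sqI_ge0.
- by move=> y; exact: sqI_ge0.
- exact: measurable_sqI_cons.
- exact: measurable_sqI_cons.
by apply: eq_integral => y _; rewrite -IH//; exact: measurable_addl.
Qed.

Lemma sqIZ s l (k : R) (g : R -> \bar R) : measurable_fun [set: R] g ->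
  (forall z, 0 <= g z)%E -> 0 <= k ->
  (sqI s l (fun z => k%:E * g z) = k%:E * sqI s l g)%E.
Proof.
move=> + + k0; elim: s g => [|a s IH] g mg g0 //=.
apply: etrans; last apply: ge0_integralTZ => //.
- by apply: eq_integral => y _; rewrite -IH//; exact: measurable_addl.
- exact: measurable_sqI_cons.
- by move=> y; exact: sqI_ge0.
Qed.

(** Each coordinate contributes one factor [b]. The exponential weight of a sum is a product, so the
    induction hypothesis absorbs the inner coordinates and [onR_normal_scale_le] the outermost
    one. *)
Lemma sqI_scale_le s l (g : R -> \bar R) (b : R) : 1 <= b ->
  measurable_fun [set: R] g -> (forall z, 0 <= g z)%E ->
  ((b ^+ size s)%:E * sqI s l (fun z => g (b ^+ 2 * z)%R *
     (expR (- ((b ^+ 2 - 1) / 2 * z)))%:E) <= sqI s l g)%E.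
Proof.
move=> b1; have b0 : 0 < b by exact: lt_le_trans b1.
have bn n : 0 <= b ^+ n by rewrite exprn_ge0// ltW.
elim: s g => [|a s IH] g mg g0 /=.
  by rewrite mul1e !mulr0 oppr0 expR0 mule1.
set e := fun z : R => (expR (- ((b ^+ 2 - 1) / 2 * z)))%:E.
have e0 z : (0 <= e z)%E by rewrite lee_fin expR_ge0.
have me : measurable_fun [set: R] e by rewrite /e; mfun.
pose phi x := sqI s l (fun z => g (x + z)).
have mphi : measurable_fun [set: R] phi by exact: measurable_sqI_shift.
have phi0 x : (0 <= phi x)%E by exact: sqI_ge0.
have mgb x : measurable_fun [set: R] (fun z => g (b ^+ 2 * (x + z))) by mfun.
have mgbe x : measurable_fun [set: R] (fun z => g (b ^+ 2 * (x + z))%R * e z)%E.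
  exact: mfun_emul.
(* The inner coordinates, with the outer square frozen at [x]: the part of the weight that depends
   on [x] is a constant for [sqI]. *)
have key (x : R) : ((b ^+ size s)%:E * sqI s l (fun z =>
    g (b ^+ 2 * (x + z))%R * e (x + z)%R) <= phi (b ^+ 2 * x)%R * e x)%E.
  have -> : (fun z => g (b ^+ 2 * (x + z))%R * e (x + z)%R)%E =
      (fun z => (expR (- ((b ^+ 2 - 1) / 2 * x)))%:E *
        (g (b ^+ 2 * (x + z))%R * e z))%E.
    apply/funext => z; rewrite muleCA; congr (_ * _)%E; rewrite -EFinM -expRD.
    by congr (expR _)%:E; ring.
  rewrite sqIZ ?expR_ge0//; last by move=> z; rewrite mule_ge0.
  rewrite muleCA muleC lee_wpmul2r//.
  have := IH (fun z => g (b ^+ 2 * x + z)) (measurable_addl _ mg) (fun z => g0 _).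
  apply: le_trans; rewrite lee_wpmul2l ?lee_fin//.
  have -> : (fun z => g (b ^+ 2 * (x + z))%R * e z)%E =
      (fun z => g (b ^+ 2 * x + b ^+ 2 * z)%R * e z)%E.
    by apply/funext => z; rewrite mulrDr.
  exact: lexx.
apply: le_trans (onR_normal_scale_le (l * a) b1 mphi phi0).
rewrite exprS EFinM -muleA lee_wpmul2l ?lee_fin ?(ltW b0)//.
have mF : measurable_fun [set: R] (fun y => sqI s l (fun z =>
    (g (b ^+ 2 * ((l * a + y) ^+ 2 + z))%R * e ((l * a + y) ^+ 2 + z)%R)%E)).
  apply: (@measurable_sqI_cons s l a (fun z => g (b ^+ 2 * z)%R * e z)%E).
  - by apply: mfun_emul => //; mfun.
  - by move=> z; rewrite mule_ge0.
have F0 y : (0 <= sqI s l (fun z =>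
    (g (b ^+ 2 * ((l * a + y) ^+ 2 + z))%R * e ((l * a + y) ^+ 2 + z)%R)))%E.
  by apply: sqI_ge0 => z; rewrite mule_ge0.
rewrite -(ge0_integralTZ N01 mF F0 (bn _)).
apply: ge0_le_integralT.
- by apply: mfun_emul => //; exact: measurable_cst.
- by mfun.
- by move=> y; rewrite mule_ge0// lee_fin.
- by move=> y; exact: key.
Qed.

(** The centers move from [l] to [l'] one coordinate at a time, the inner ones by induction and the
    outermost by stochastic monotonicity. Only squares of centers matter, so the signs in [s] are
    arbitrary. *)
Lemma sqI_noninc s (l l' : R) (g : R -> \bar R) : measurable_fun [set: R] g ->
  (forall z, 0 <= g z)%E ->
  (forall x y : R, 0 <= x -> x <= y -> (g y <= g x)%E) ->
  0 <= l -> l <= l' -> (sqI s l' g <= sqI s l g)%E.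
Proof.
move=> + + + l0 ll'; elim: s g => [|a s IH] g mg g0 gd //=.
pose phi x := sqI s l (fun z => g (x + z)).
have mphi : measurable_fun [set: R] phi by exact: measurable_sqI_shift.
have phi0 x : (0 <= phi x)%E by exact: sqI_ge0.
apply: (@le_trans _ _ (\int[N01]_y phi ((l' * a + y) ^+ 2)%R)%E).
  apply: ge0_le_integralT.
  - exact: measurable_sqI_cons.
  - by mfun.
  - by move=> y; exact: sqI_ge0.
  - move=> y; apply: IH => //; first exact: measurable_addl.
    by move=> x z x0 xz; apply: gd; rewrite ?lerD2l// addr_ge0 ?sqr_ge0.
apply: onR_normal_shift_noninc => //.
  move=> x y x0 xy; apply: sqI_le => //; try exact: measurable_addl.
  by move=> z z0; apply: gd; rewrite ?lerD2r// addr_ge0.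
by rewrite !exprMn ler_wpM2r ?sqr_ge0// lerXn2r// nnegrE (le_trans l0).
Qed.

Lemma lebesgue_measure_itvoo_gt0 (a b : R) : a < b ->
  (0 < @lebesgue_measure R `]a, b[%classic)%E.
Proof.
by move=> ab; rewrite lebesgue_measure_itv/= lte_fin ab lte_fin subr_gt0.
Qed.

Lemma onR_normal_gt0 (a c : R) : 0 < c -> (0 < N01 [set y | (a + y) ^+ 2 < c]%R)%E.
Proof.
move=> c0.
have m : measurable [set y : R | (a + y) ^+ 2 < c].
  by apply: measurable_bool_set; mfun.
have mpdf : measurable_fun [set: R] (fun x : R => (normal_pdf 0 1 x)%:E).
  by apply: mfun_EFin; exact: measurable_normal_pdf.
rewrite /onR /normal_prob integral_mkcond.
apply: (@integral_gt0 _ (measurableTypeR R) R lebesgue_measure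
  [set y : R | (a + y) ^+ 2 < c]) => //.
- by apply/(measurable_restrictT _ _).1 => //; exact: measurable_funTS.
- by move=> x; apply: erestrict_ge0 => y _; rewrite lee_fin normal_pdf_ge0.
- have -> : [set y : R | (a + y) ^+ 2 < c] =
      `](- a - Num.sqrt c), (- a + Num.sqrt c)[%classic.
    apply/seteqP; split => y /=; rewrite in_itv/=.
      rewrite -ltr_sqrt// sqrtr_sqr ltr_norml => /andP[h1 h2].
      by apply/andP; split; lra.
    move=> /andP[h1 h2]; rewrite -ltr_sqrt// sqrtr_sqr ltr_norml.
    by apply/andP; split; lra.
  have sc : 0 < Num.sqrt c by rewrite sqrtr_gt0.
  by apply: lebesgue_measure_itvoo_gt0; lra.
- move=> x hx; rewrite patchE mem_set// lte_fin normal_pdf01E.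
  by rewrite mulr_gt0 ?expR_gt0// normal_peak_gt0 ?oner_neq0.
Qed.

(** The bound [c] is a budget: what the first square leaves of it is available to the others, and
    each open condition has positive normal probability. *)
Lemma sqI_gt0 s l (g : R -> \bar R) (c : R) : measurable_fun [set: R] g ->
  (forall z, 0 <= g z)%E -> 0 < c ->
  (forall z, 0 <= z < c -> (0 < g z)%E) -> (0 < sqI s l g)%E.
Proof.
elim: s g c => [|a s IH] g c mg g0 c0 gc /=; first by apply: gc; rewrite lexx.
apply: (integral_gt0 (A := [set y | (l * a + y) ^+ 2 < c])).
- by apply: measurable_bool_set; mfun.
- exact: measurable_sqI_cons.
- by move=> y; exact: sqI_ge0.
- exact: onR_normal_gt0.
move=> y /= yc; apply: (IH _ (c - (l * a + y) ^+ 2)) => //.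
- exact: measurable_addl.
- by rewrite subr_gt0.
- move=> z /andP[z0 zc]; apply: gc; rewrite addr_ge0 ?sqr_ge0//=.
  by rewrite -ltrBrDl.
Qed.

End gaussian_square_norm.

Section chi_square_integrals.
Context {R : realType}.
Variable k : nat.
Local Notation chi2 := (onR (@chi2_law R k)).

Lemma onR_chi2_scale (f : R -> \bar R) (b : R) : 0 < b ->
  measurable_fun [set: R] f -> (forall x, 0 <= f x)%E ->
  (\int[chi2]_x f x = (b ^+ k)%:E * \int[chi2]_x
     (f (b ^+ 2 * x)%R * (expR (- ((b ^+ 2 - 1) / 2 * x)))%:E))%E.
Proof.
move=> b0 mf f0; rewrite (ge0_integral_onR _ mf f0) (chi2_scale k b0 mf f0).
congr (_ * _)%E; apply/esym/ge0_integral_onR; first by mfun.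
by move=> x; rewrite mule_ge0// lee_fin expR_ge0.
Qed.

Lemma onR_chi2_density (f : R -> \bar R) :
  measurable_fun [set: R] f -> (forall x, 0 <= f x)%E ->
  (\int[chi2]_x f x = \int[lebesgue_measure]_x (f x * (chi2_pdf k x)%:E))%E.
Proof. by move=> mf f0; rewrite (ge0_integral_onR _ mf f0) ge0_integral_chi2. Qed.

Lemma onR_chi2_le (f g : R -> \bar R) : measurable_fun [set: R] f ->
  measurable_fun [set: R] g -> (forall x, 0 <= f x)%E -> (forall x, 0 <= g x)%E ->
  (forall x, 0 < x -> (f x <= g x)%E) -> (\int[chi2]_x f x <= \int[chi2]_x g x)%E.
Proof.
move=> mf mg f0 g0 fg; rewrite (onR_chi2_density mf f0) (onR_chi2_density mg g0).
have mp : measurable_fun [set: R] (fun x : R => (chi2_pdf k x)%:E).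
  by apply: mfun_EFin; exact: measurable_chi2_pdf.
apply: ge0_le_integralT.
- exact: (mfun_emul mf mp).
- exact: (mfun_emul mg mp).
- by move=> x; rewrite mule_ge0// lee_fin chi2_pdf_ge0.
move=> x; have [x0|x0] := ltP 0 x.
  by rewrite lee_wpmul2r ?fg// lee_fin chi2_pdf_ge0.
by rewrite /chi2_pdf ltNge x0/= !mule0.
Qed.

(** Total mass one excludes a zero value of [Gamma], for which division by zero would make the
    density vanish identically. *)
Lemma chi2_pdf_gt0 (x : R) : chi2_law k [set: R] = 1%E -> 0 < x ->
  0 < chi2_pdf k x.
Proof.
move=> kT x0; rewrite /chi2_pdf x0 divr_gt0//.
  by rewrite mulr_gt0 ?powR_gt0 ?expR_gt0.
rewrite mulr_gt0 ?powR_gt0// lt0r Gamma_ge0 andbT.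
apply/eqP => G0; move: kT; rewrite /chi2_law /chi2_prob.
rewrite (eq_integral (fun=> 0%E)); last first.
  by move=> y _; rewrite /chi2_pdf G0 mulr0 invr0 mulr0 if_same.
by rewrite integral0 => /eqP; rewrite eq_sym onee_eq0.
Qed.

Lemma onR_chi2_gt0 (f : R -> \bar R) (a b : R) : chi2_law k [set: R] = 1%E ->
  measurable_fun [set: R] f -> (forall x, 0 <= f x)%E ->
  0 <= a -> a < b -> (forall x, a < x < b -> (0 < f x)%E) ->
  (0 < \int[chi2]_x f x)%E.
Proof.
move=> kT mf f0 a0 ab fab; rewrite (onR_chi2_density mf f0).
have mp : measurable_fun [set: R] (fun x : R => (chi2_pdf k x)%:E).
  by apply: mfun_EFin; exact: measurable_chi2_pdf.
apply: (@integral_gt0 _ (measurableTypeR R) R lebesgue_measure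
  (`]a, b[%classic : set R)).
- exact: measurable_itv.
- exact: (mfun_emul mf mp).
- by move=> x; rewrite mule_ge0// lee_fin chi2_pdf_ge0.
- exact: lebesgue_measure_itvoo_gt0.
- move=> x /=; rewrite in_itv/= => /andP[ax xb].
  rewrite mule_gt0 ?fab ?ax// lte_fin chi2_pdf_gt0//.
  exact: le_lt_trans ax.
Qed.

End chi_square_integrals.

(** * Conditional expectation given the mixing variable *)

Section conditional_expectation.
Context {R : realType}.
Variables (m1 m2 : nat) (s : seq R) (r : R).
Hypothesis r_ge1 : 1 <= r.
Local Notation chi2_1 := (onR (@chi2_law R m1)).
Local Notation chi2_2 := (onR (@chi2_law R m2)).

(* The conditional expectation of h(S1, S2, |X1|^2), all in units of
   sigma1^2 / tau, given tau = l^2; r is (sigma2 / sigma1)^2. *)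
Definition condE (l : R) (h : R * R * R -> \bar R) : \bar R :=
  (\int[chi2_1]_u \int[chi2_2]_v sqI s l (fun z => h (u, r * v, z)%R))%E.

(** The partial integrals are stated with the full one because each is the integrand of the next. *)
Lemma measurable_condE (d : measure_display) (T : measurableType d)
    (l : T -> R) (h : T * R * R * R -> \bar R) :
  measurable_fun [set: T] l -> measurable_fun [set: T * R * R * R] h ->
  (forall x, 0 <= h x)%E ->
  [/\ measurable_fun [set: T * R * R]
        (fun w => sqI s (l w.1.1) (fun z => h (w.1.1, w.1.2, r * w.2, z))),
      measurable_fun [set: T * R] (fun w => \int[chi2_2]_v
        sqI s (l w.1) (fun z => h (w.1, w.2, r * v, z)%R))%E &
      measurable_fun [set: T] (fun x => condE (l x)
        (fun w => h (x, w.1.1, w.1.2, w.2)))].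
Proof.
move=> ml mh h0.
pose f (w : T * R * R * R) := h (w.1.1.1, w.1.1.2, r * w.1.2, w.2).
have mf : measurable_fun setT f by apply: (measurableT_comp mh); mfun.
have mll : measurable_fun [set: T * R * R] (fun w => l w.1.1) by mfun.
have [mI I0] := measurable_sqI s mll mf (fun w => h0 _).
have mA : measurable_fun [set: T * R] (fun w => \int[chi2_2]_v
        sqI s (l w.1) (fun z => h (w.1, w.2, r * v, z)%R))%E.
  exact: (@measurable_fun_fubini_tonelli_F _ _ _ _ R chi2_2 _ mI I0).
split => //.
apply: (@measurable_fun_fubini_tonelli_F _ _ _ _ R chi2_1 _ mA) => w.
by apply: integral_ge0 => v _; exact: sqI_ge0.
Qed.

Section basics.
Variables (l : R) (h : R * R * R -> \bar R).
Hypotheses (mh : measurable_fun [set: R * R * R] h) (h0 : forall w, (0 <= h w)%E).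

Let mh' : measurable_fun [set: R * R * R * R] (fun w => h (w.1.1.2, w.1.2, w.2)).
Proof. by apply: (measurableT_comp mh); mfun. Qed.

Lemma measurable_condE_z u v : measurable_fun [set: R] (fun z => h (u, v, z)).
Proof. by mfun. Qed.

Lemma measurable_condE_uv :
  measurable_fun [set: R * R] (fun w => sqI s l (fun z => h (w.1, r * w.2, z))).
Proof.
have [mI _ _] := measurable_condE (measurable_cst l) mh' (fun w => h0 _).
have mj : measurable_fun [set: R * R] (fun w : R * R => ((0 : R), w.1, w.2)).
  by mfun.
exact: (measurableT_comp mI mj).
Qed.

Lemma measurable_condE_v u :
  measurable_fun [set: R] (fun v => sqI s l (fun z => h (u, r * v, z))).
Proof.
have mj : measurable_fun [set: R] (fun v : R => (u, v)) by mfun.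
exact: (measurableT_comp measurable_condE_uv mj).
Qed.

Lemma measurable_condE_u : measurable_fun [set: R]
  (fun u => \int[chi2_2]_v sqI s l (fun z => h (u, r * v, z)%R))%E.
Proof.
have [_ mI _] := measurable_condE (measurable_cst l) mh' (fun w => h0 _).
have mj : measurable_fun [set: R] (fun u : R => ((0 : R), u)) by mfun.
exact: (measurableT_comp mI mj).
Qed.

Lemma condE_uv_ge0 u v : (0 <= sqI s l (fun z => h (u, v, z)))%E.
Proof. exact: sqI_ge0. Qed.

Lemma condE_u_ge0 u :
  (0 <= \int[chi2_2]_v sqI s l (fun z => h (u, r * v, z)%R))%E.
Proof. by apply: integral_ge0 => v _; exact: condE_uv_ge0. Qed.

Lemma condE_ge0 : (0 <= condE l h)%E.
Proof. by apply: integral_ge0 => u _; exact: condE_u_ge0. Qed.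

End basics.

(** The chi-square densities vanish off the positive half-line and sums of squares are nonnegative,
    so comparing on the support suffices. *)
Lemma condE_le l (h h' : R * R * R -> \bar R) :
  measurable_fun [set: R * R * R] h -> measurable_fun [set: R * R * R] h' ->
  (forall w, 0 <= h w)%E -> (forall w, 0 <= h' w)%E ->
  (forall u v z : R, 0 < u -> 0 < v -> 0 <= z ->
     (h (u, v, z) <= h' (u, v, z))%E) ->
  (condE l h <= condE l h')%E.
Proof.
move=> mh mh' h0 h'0 hh'; have r0 : 0 < r by exact: lt_le_trans r_ge1.
apply: onR_chi2_le; try exact: measurable_condE_u; try exact: condE_u_ge0.
move=> u u0; apply: onR_chi2_le; try exact: measurable_condE_v;
  try (by move=> v; exact: condE_uv_ge0).
move=> v v0; apply: sqI_le; try exact: measurable_condE_z; try by [].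
by move=> z z0; apply: hh' => //; exact: mulr_gt0.
Qed.

Lemma condED l (h h' : R * R * R -> \bar R) :
  measurable_fun [set: R * R * R] h -> measurable_fun [set: R * R * R] h' ->
  (forall w, 0 <= h w)%E -> (forall w, 0 <= h' w)%E ->
  (condE l (fun w => h w + h' w) = condE l h + condE l h')%E.
Proof.
move=> mh mh' h0 h'0; rewrite [RHS]ge0_integralTD;
  try exact: measurable_condE_u; try exact: condE_u_ge0.
apply: eq_integral => u _; rewrite [RHS]ge0_integralTD;
  try exact: measurable_condE_v; try (by move=> v; exact: condE_uv_ge0).
apply: eq_integral => v _; rewrite sqID //; exact: measurable_condE_z.
Qed.

Lemma condEZ l (k : R) (h : R * R * R -> \bar R) : 0 <= k ->
  measurable_fun [set: R * R * R] h -> (forall w, 0 <= h w)%E ->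
  (condE l (fun w => k%:E * h w) = k%:E * condE l h)%E.
Proof.
move=> k0 mh h0.
apply: etrans; last first.
  by apply: ge0_integralTZ k0; [exact: measurable_condE_u|exact: condE_u_ge0].
apply: eq_integral => u _.
apply: etrans; last first.
  by apply: ge0_integralTZ k0; [exact: measurable_condE_v|
    move=> v; exact: condE_uv_ge0].
by apply: eq_integral => v _; rewrite sqIZ //; exact: measurable_condE_z.
Qed.

Lemma condE_noninc (l l' : R) (h : R * R * R -> \bar R) :
  measurable_fun [set: R * R * R] h -> (forall w, 0 <= h w)%E ->
  (forall u v x y : R, 0 <= x -> x <= y -> (h (u, v, y) <= h (u, v, x))%E) ->
  0 <= l -> l <= l' -> (condE l' h <= condE l h)%E.
Proof.
move=> mh h0 hd l0 ll'.
apply: ge0_le_integralT; try exact: measurable_condE_u; try exact: condE_u_ge0.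
move=> u; apply: ge0_le_integralT; try exact: measurable_condE_v;
  try (by move=> v; exact: condE_uv_ge0).
move=> v; apply: sqI_noninc => //; first exact: measurable_condE_z.
exact: hd.
Qed.

Lemma condE_gt0 l (h : R * R * R -> \bar R) (u0 u1 v1 z1 : R) :
  chi2_law m1 [set: R] = 1%E -> chi2_law m2 [set: R] = 1%E ->
  measurable_fun [set: R * R * R] h -> (forall w, 0 <= h w)%E ->
  0 <= u0 -> u0 < u1 -> 0 < v1 -> 0 < z1 ->
  (forall u v z, u0 < u < u1 -> 0 < v < v1 -> 0 <= z < z1 ->
    (0 < h (u, v, z))%E) -> (0 < condE l h)%E.
Proof.
move=> m1T m2T mh h0 u00 u01 v10 z10 hp.
have r0 : 0 < r by exact: lt_le_trans r_ge1.
apply: (onR_chi2_gt0 m1T _ _ u00 u01); first exact: measurable_condE_u.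
  exact: condE_u_ge0.
move=> u uu; apply: (@onR_chi2_gt0 _ m2 _ 0 (v1 / r)) => //.
- exact: measurable_condE_v.
- by move=> v; exact: condE_uv_ge0.
- exact: divr_gt0.
move=> v /andP[v0 vv]; apply: (@sqI_gt0 _ s l _ z1) => //.
  exact: measurable_condE_z.
move=> z zz; apply: hp => //; rewrite mulr_gt0//=.
by rewrite mulrC -ltr_pdivlMr.
Qed.

(** The scalings of [u], [v] and [z] are combined, the first two being equalities. The change of
    variables in [v] yields a weight in [v], whereas the claim has the weight in [r * v], which is
    smaller because [1 <= r]. This is where the order restriction enters, beyond the mere positivity
    of [r]. *)
Lemma condE_scale_le l (h : R * R * R -> \bar R) (b : R) : 1 <= b ->
  measurable_fun [set: R * R * R] h -> (forall w, 0 <= h w)%E ->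
  ((b ^+ (m1 + m2 + size s))%:E * condE l (fun w =>
    h (b ^+ 2 * w.1.1, b ^+ 2 * w.1.2, b ^+ 2 * w.2)%R *
    (expR (- ((b ^+ 2 - 1) / 2 * (w.1.1 + w.1.2 + w.2))))%:E) <=
   condE l h)%E.
Proof.
move=> b1 mh h0; have b0 : 0 < b by exact: lt_le_trans b1.
have bn n : 0 <= b ^+ n by rewrite exprn_ge0// ltW.
have r0 : 0 < r by exact: lt_le_trans r_ge1.
pose e (x : R) := expR (- ((b ^+ 2 - 1) / 2 * x)).
have e0 x : (0 <= (e x)%:E)%E by rewrite lee_fin expR_ge0.
have me : measurable_fun [set: R] (fun x => (e x)%:E) by rewrite /e; mfun.
pose h2 (w : R * R * R) := (h (b ^+ 2 * w.1.1, b ^+ 2 * w.1.2, b ^+ 2 * w.2)%R *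
    (e (w.1.1 + w.1.2 + w.2))%:E)%E.
have mh2 : measurable_fun [set: R * R * R] h2.
  by apply: mfun_emul; rewrite /e; mfun.
have h20 w : (0 <= h2 w)%E by rewrite mule_ge0.
rewrite -[X in (_ * condE l X)%E]/h2.
pose H u v := sqI s l (fun z => h (u, r * v, z)).
have H0 u v : (0 <= H u v)%E by exact: sqI_ge0.
have mHv u : measurable_fun [set: R] (H u) by exact: measurable_condE_v.
pose A u := (\int[chi2_2]_v H u v)%E.
have A0 u : (0 <= A u)%E by exact: condE_u_ge0.
have mA : measurable_fun [set: R] A by exact: measurable_condE_u.
have mHbv u : measurable_fun [set: R] (fun v => H (b ^+ 2 * u) (b ^+ 2 * v)).
  by mfun.
have step_v u v : 0 < v -> ((b ^+ size s)%:E * sqI s l (fun z => h2 (u, r * v, z)%R) <=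
    (e u)%:E * (H (b ^+ 2 * u)%R (b ^+ 2 * v)%R * (e v)%:E))%E.
  move=> v0; set g := fun z => h (b ^+ 2 * u, b ^+ 2 * (r * v), z).
  have mg : measurable_fun [set: R] g by exact: measurable_condE_z.
  have mgb : measurable_fun [set: R] (fun z => g (b ^+ 2 * z)%R * (e z)%:E)%E.
    by rewrite /e; mfun.
  have gb0 z : (0 <= g (b ^+ 2 * z)%R * (e z)%:E)%E.
    by rewrite mule_ge0// h0.
  have -> : (fun z => h2 (u, r * v, z)) = (fun z =>
      (e u * e (r * v))%:E * (g (b ^+ 2 * z)%R * (e z)%:E))%E.
    apply/funext => z; rewrite /h2 /= muleCA -EFinM; congr (_ * _)%E.
    by rewrite /e -!expRD; congr (expR _)%:E; ring.
  rewrite sqIZ//; last by rewrite mulr_ge0 ?expR_ge0.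
  have -> : ((e u)%:E * (H (b ^+ 2 * u)%R (b ^+ 2 * v)%R * (e v)%:E) =
      (e u * e v)%:E * sqI s l g)%E.
    rewrite EFinM -muleA (muleC (e v)%:E); congr (_ * (_ * _))%E.
    by rewrite /H /g mulrCA.
  rewrite muleCA; apply: lee_pmul.
  - by rewrite lee_fin mulr_ge0 ?expR_ge0.
  - by rewrite mule_ge0 ?lee_fin// sqI_ge0.
  - rewrite lee_fin ler_wpM2l ?expR_ge0// ler_expR lerN2 ler_wpM2l//.
      by rewrite divr_ge0// subr_ge0 exprn_ege1.
    by rewrite ler_peMl// ltW.
  - exact: (sqI_scale_le s l b1 mg (fun z => h0 _)).
have step_u u : ((b ^+ (m2 + size s))%:E *
    \int[chi2_2]_v sqI s l (fun z => h2 (u, r * v, z)%R) <=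
    A (b ^+ 2 * u)%R * (e u)%:E)%E.
  rewrite /A (onR_chi2_scale m2 b0 (mHv _) (H0 _)) exprD EFinM -!muleA.
  rewrite lee_wpmul2l ?lee_fin// [leRHS]muleC.
  have mX : measurable_fun [set: R] (fun v => H (b ^+ 2 * u)%R (b ^+ 2 * v)%R * (e v)%:E)%E.
    exact: mfun_emul.
  have X0 v : (0 <= H (b ^+ 2 * u)%R (b ^+ 2 * v)%R * (e v)%:E)%E by rewrite mule_ge0.
  have mY : measurable_fun [set: R] (fun v => sqI s l (fun z => h2 (u, r * v, z)%R)).
    exact: measurable_condE_v.
  have Y0 v : (0 <= sqI s l (fun z => h2 (u, r * v, z)%R))%E by exact: sqI_ge0.
  have eu0 : 0 <= e u by exact: expR_ge0.
  rewrite -[leRHS](ge0_integralTZ chi2_2 mX X0 eu0).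
  rewrite -[leLHS](ge0_integralTZ chi2_2 mY Y0 (bn _)).
  apply: onR_chi2_le.
  - exact: mfun_emul (measurable_cst _) mY.
  - exact: mfun_emul (measurable_cst _) mX.
  - by move=> v; rewrite mule_ge0 ?lee_fin.
  - by move=> v; rewrite mule_ge0 ?lee_fin ?expR_ge0.
  - by move=> v v0; exact: step_v.
rewrite -[X in (_ <= X)%E]/(\int[chi2_1]_u A u)%E.
rewrite (onR_chi2_scale m1 b0 mA A0) -addnA exprD EFinM -muleA.
rewrite lee_wpmul2l ?lee_fin//.
have mZ := measurable_condE_u l mh2 h20.
rewrite -(ge0_integralTZ chi2_1 mZ (condE_u_ge0 _ h20) (bn _)).
apply: ge0_le_integralT.
- exact: mfun_emul (measurable_cst _) mZ.
- by apply: mfun_emul => //; mfun.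
- by move=> u; rewrite mule_ge0 ?lee_fin// condE_u_ge0.
- by move=> u; exact: step_u.
Qed.

End conditional_expectation.

(** * The Euler-type inequality *)

Lemma bernoulli_limit {R : realType} (N : nat) (x y : R) : 0 <= y ->
  (forall b, 1 < b -> b ^+ N * x <= x + b ^+ N * ((b ^+ 2 - 1) / 2) * y) ->
  N%:R * x <= y.
Proof.
move=> y0 H.
have [x0|x0] := leP x 0.
  by apply: le_trans y0; rewrite mulr_ge0_le0.
(* A substitute for differentiating at [b = 1]: Bernoulli's inequality bounds [b ^+ N * x] below in
   [H], a factor [b - 1] cancels, and [(b + 1) / 2 <= b]. *)
have H' b : 1 < b -> N%:R * x <= b ^+ N.+1 * y.
  move=> b1; have {}H := H b b1.
  have bern : 1 + N%:R * (b - 1) <= b ^+ N.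
    elim: (N) => [|n IH]; first by rewrite mul0r addr0 expr0.
    have n0 : 0 <= n%:R * (b - 1) * (b - 1).
      by rewrite !mulr_ge0 ?ler0n ?subr_ge0 ?ltW.
    rewrite exprS; apply: (@le_trans _ _ (b * (1 + n%:R * (b - 1)))).
      by rewrite -natr1; lra.
    by rewrite ler_wpM2l// ltW// (lt_trans ltr01).
  have c0 : 0 <= b ^+ N * y by rewrite mulr_ge0// exprn_ge0// ltW// (lt_trans ltr01).
  have h1 : (b - 1) * (N%:R * x) <= (b - 1) * ((b + 1) / 2 * (b ^+ N * y)).
    have : (1 + N%:R * (b - 1)) * x <= b ^+ N * x by rewrite ler_wpM2r// ltW.
    lra.
  rewrite ler_pM2l ?subr_gt0// in h1.
  apply: (le_trans h1); rewrite exprS -[leRHS]mulrA ler_wpM2r//; lra.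
rewrite leNgt; apply/negP => yx.
have y1 : 0 < y.
  rewrite lt0r y0 andbT; apply/eqP => ye.
  by have := H' 2 (ltr1n _ 2); rewrite ye mulr0 leNgt -ye yx.
have rho : 1 < N%:R * x / y by rewrite ltr_pdivlMr ?mul1r.
(* For [b = expR t] one has [b ^+ N.+2 = N * x / y], hence [b ^+ N.+1 * y < N * x], against [H']. *)
pose t := ln (N%:R * x / y) / N.+2%:R.
have t0 : 0 < t by rewrite divr_gt0 ?ltr0n// ln_gt0.
have e1 : 1 < expR t by rewrite expR_gt1.
have := H' _ e1; rewrite -expRM_natl -ler_pdivrMr// leNgt => /negP; apply.
have rhoE : expR (ln (N%:R * x / y)) = N%:R * x / y.
  by rewrite lnK// posrE (lt_trans ltr01).
rewrite -[ltRHS]rhoE ltr_expR.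
rewrite (_ : ln _ = N.+2%:R * t); first by rewrite ltr_pM2r// ltr_nat.
by rewrite /t [RHS]mulrC divfK// pnatr_eq0.
Qed.

Section euler_inequality.
Context {R : realType}.
Variables (m1 m2 : nat) (s : seq R) (r : R).
Hypothesis r_ge1 : 1 <= r.
Local Notation condE := (condE m1 m2 s r).

(* Differentiating [condE_scale_le] at [b = 1] on a homogeneous function. *)
Lemma condE_euler l (kappa : nat) (h h' : R * R * R -> \bar R) :
  measurable_fun [set: R * R * R] h -> measurable_fun [set: R * R * R] h' ->
  (forall w, 0 <= h w)%E -> (forall w, 0 <= h' w)%E ->
  (forall (b : R) w, 0 < b ->
    h (b ^+ 2 * w.1.1, b ^+ 2 * w.1.2, b ^+ 2 * w.2) =
    ((b ^+ (2 * kappa))%:E * h w)%E) ->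
  (forall u v z : R, 0 < u -> 0 < v -> 0 <= z ->
    (h (u, v, z) * (u + v + z)%:E <= h' (u, v, z))%E) ->
  (condE l h < +oo)%E ->
  ((m1 + m2 + size s + 2 * kappa)%:R%:E * condE l h <= condE l h')%E.
Proof.
move=> mh mh' h0 h'0 homh hh' hfin.
have [->|h'fin] := eqVneq (condE l h') +oo%E; first exact: leey.
have X0 := condE_ge0 m1 m2 s r l h0; have Y0 := condE_ge0 m1 m2 s r l h'0.
have Xfin : condE l h \is a fin_num by rewrite (ge0_fin_numE X0).
have Yfin : condE l h' \is a fin_num by rewrite (ge0_fin_numE Y0) ltey.
set n := (m1 + m2 + size s)%N.
rewrite -(fineK Xfin) -(fineK Yfin) -EFinM lee_fin; apply: bernoulli_limit.
  exact: fine_ge0.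
move=> b b1; have b0 : 0 < b by exact: lt_trans b1.
pose e (w : R * R * R) := expR (- ((b ^+ 2 - 1) / 2 * (w.1.1 + w.1.2 + w.2))).
have me : measurable_fun [set: R * R * R] (fun w => (e w)%:E).
  by rewrite /e; mfun.
have mhe : measurable_fun [set: R * R * R] (fun w => h w * (e w)%:E)%E.
  exact: mfun_emul.
have he0 w : (0 <= h w * (e w)%:E)%E by rewrite mule_ge0// lee_fin expR_ge0.
have b21 : 0 <= (b ^+ 2 - 1) / 2 by rewrite divr_ge0// subr_ge0 exprn_ege1// ltW.
have bn k : 0 <= b ^+ k by rewrite exprn_ge0// ltW.
have I1 : ((b ^+ (n + 2 * kappa))%:E * condE l (fun w => h w * (e w)%:E) <=
    condE l h)%E.
  have := condE_scale_le m1 m2 s r_ge1 l (ltW b1) mh h0.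
  rewrite (_ : (fun w : R * R * R =>
      h (b ^+ 2 * w.1.1, b ^+ 2 * w.1.2, b ^+ 2 * w.2)%R * _)%E =
    (fun w => (b ^+ (2 * kappa))%:E * (h w * (e w)%:E))%E); last first.
    by apply/funext => w; rewrite homh// muleA.
  by rewrite (condEZ m1 m2 s r l (bn _) mhe he0) muleA -EFinM -exprD.
(* From [1 <= expR (- k) + k] with [k = (b ^+ 2 - 1) / 2 * (u + v + z)], multiplied by [h]; the
   bound [hh'] then brings in [h']. *)
have I2 : (condE l h <= condE l (fun w => h w * (e w)%:E) +
    ((b ^+ 2 - 1) / 2)%:E * condE l h')%E.
  have mk := mfun_emul (measurable_cst ((b ^+ 2 - 1) / 2)%:E) mh'.
  have k0 w : (0 <= ((b ^+ 2 - 1) / 2)%:E * h' w)%E by rewrite mule_ge0 ?lee_fin.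
  rewrite -(condEZ m1 m2 s r l b21 mh' h'0) -(condED m1 m2 s r l mhe mk he0 k0).
  apply: (condE_le m1 m2 s r_ge1 l mh (mfun_eadd mhe mk) h0).
    by move=> w; rewrite adde_ge0.
  move=> u v z u0 v0 z0.
  apply: (@le_trans _ _ (h (u, v, z) * (e (u, v, z))%:E +
      ((b ^+ 2 - 1) / 2)%:E * (h (u, v, z) * (u + v + z)%:E))%E); last first.
    by rewrite leeD2l// lee_wpmul2l ?lee_fin// hh'.
  have T0 : 0 <= u + v + z by rewrite !addr_ge0// ltW.
  have k1 := mulr_ge0 b21 T0.
  rewrite muleCA -EFinM -ge0_muleDr ?lee_fin ?expR_ge0//.
  rewrite -{1}[h _]mule1 lee_wpmul2l// lee_fin /e /=.
  by have := expR_ge1Dx (- ((b ^+ 2 - 1) / 2 * (u + v + z))); lra.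
have Z0 := condE_ge0 m1 m2 s r l he0.
have Zfin : condE l (fun w => h w * (e w)%:E)%E \is a fin_num.
  rewrite (ge0_fin_numE Z0); apply: le_lt_trans hfin.
  apply: le_trans I1; rewrite -{1}[condE l _]mul1e (lee_wpmul2r Z0)//.
  by rewrite lee_fin exprn_ege1// ltW.
move: I1 I2; rewrite -(fineK Xfin) -(fineK Yfin) -(fineK Zfin).
rewrite -!EFinM -EFinD !lee_fin => I1 I2.
(* [I1] bounds [E[h e]] above and [I2] bounds it below; multiplying [I2] by the power of [b]
   eliminates it and leaves the hypothesis of [bernoulli_limit]. *)
have := ler_wpM2l (bn (n + 2 * kappa)%N) I2; move: I1; clear.
move: (fine _) (fine _) (fine _) (b ^+ (n + 2 * kappa)) => x y z c I1 I2 /=.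
by lra.
Qed.

End euler_inequality.

(** * Finiteness of chi-square moments, including the logarithmic one *)

Section chi_square_moments.
Context {R : realType}.
Variable k : nat.
Local Notation chi2 := (onR (@chi2_law R k)).

(** Scaling the constant [1] evaluates the Laplace transform. It is an inequality because only total
    mass at most one is available here. *)
Lemma chi2_laplace (b : R) : 0 < b ->
  ((b ^+ k)%:E * \int[chi2]_x (expR (- ((b ^+ 2 - 1) / 2 * x)))%:E <= 1)%E.
Proof.
move=> b0; have := @onR_chi2_scale _ k (fun=> 1%E) b b0 (measurable_cst _) (fun=> lee01).
under [in X in _ = X -> _]eq_integral do rewrite mul1e.
move=> <-; rewrite integral_cst// mul1e; exact: (@sprobability_setT _ _ _ chi2).
Qed.

Lemma chi2_expR_lty : (\int[chi2]_x (expR (x / 4))%:E < +oo)%E.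
Proof.
(* With [b ^+ 2 = 1 / 2] the exponent [- ((b ^+ 2 - 1) / 2 * x)] is [x / 4]. *)
have b0 : 0 < Num.sqrt (2^-1 : R) by rewrite sqrtr_gt0.
have := chi2_laplace b0; rewrite sqr_sqrtr//.
rewrite (_ : (fun x : R => (expR (- ((2^-1 - 1) / 2 * x)))%:E) =
  (fun x => (expR (x / 4))%:E)); last first.
  by apply/funext => x; congr (expR _)%:E; field.
case: (\int[chi2]_x _)%E => [a| |]; rewrite ?ltry ?ltNyr//.
by rewrite gt0_muley ?lte_fin ?exprn_gt0.
Qed.

Lemma chi2_lty (f : R -> R) (c : R) : measurable_fun [set: R] f ->
  (forall x, 0 <= f x) -> 0 <= c -> (forall x, 0 < x -> f x <= c * expR (x / 4)) ->
  (\int[chi2]_x (f x)%:E < +oo)%E.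
Proof.
move=> mf f0 c0 fc.
have me : measurable_fun [set: R] (fun x : R => (expR (x / 4))%:E) by mfun.
have e0 x : (0 <= (expR (x / 4))%:E :> \bar R)%E by rewrite lee_fin expR_ge0.
apply: (@le_lt_trans _ _ (\int[chi2]_x (c%:E * (expR (x / 4))%:E))%E).
  apply: onR_chi2_le.
  - exact: mfun_EFin.
  - exact: mfun_emul (measurable_cst _) me.
  - by move=> x; rewrite lee_fin.
  - by move=> x; rewrite mule_ge0 ?lee_fin.
  - by move=> x x0; rewrite -EFinM lee_fin fc.
rewrite (ge0_integralTZ chi2 me e0 c0) lte_mul_pinfty ?lee_fin//.
exact: chi2_expR_lty.
Qed.

(** The number of [j] with [4 ^+ j * x <= 1] is about [- ln x / ln 4], so [- ln x] is dominated by a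
    multiple of the sum of the [f j x]. By [chi2_laplace] at [b = 2 ^+ j], the integral of [f j] is
    at most [2^-1 ^+ j] as soon as [k > 0], which is summable. *)
Lemma chi2_Nln_lty : (0 < k)%N ->
  (\int[chi2]_x (Num.max (- ln x) 0)%:E < +oo)%E.
Proof.
move=> k0; set c : R := ln 4.
have c0 : 0 < c by rewrite ln_gt0// ltr1n.
pose C := c * expR (2^-1).
have C0 : 0 <= C by rewrite mulr_ge0 ?expR_ge0// ltW.
pose f (j : nat) (x : R) := expR (- (((2 ^+ j) ^+ 2 - 1) / 2 * x)).
have f0 j x : 0 <= f j x by exact: expR_ge0.
have mf j : measurable_fun [set: R] (fun x => (f j x)%:E) by rewrite /f; mfun.
have part (N : nat) x : 0 < x ->
    Num.min (- ln x) (N%:R * c) <= C * \sum_(j < N) f j x.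
  move=> x0; elim: N => [|N IH].
    by rewrite big_ord0 mulr0 mul0r ge_min lexx orbT.
  rewrite big_ord_recr /= mulrDr.
  have [xN|xN] := leP (- ln x) (N%:R * c).
    rewrite ge_min; apply/orP; left.
    apply: (@le_trans _ _ (C * \sum_(j < N) f j x)).
      by apply: le_trans IH; rewrite le_min lexx xN.
    by rewrite lerDl mulr_ge0.
  rewrite ge_min; apply/orP; right; rewrite -natr1 mulrDl mul1r lerD//.
    by apply: le_trans IH; rewrite le_min (ltW xN) lexx.
  (* Here [- ln x > N * ln 4], so [4 ^+ N * x <= 1] and the new term is at least [expR (- 2^-1)];
     the constant [C] raises it to at least [c]. *)
  rewrite /C -mulrA ler_peMr ?(ltW c0)// /f -expRD.
  apply: le_trans (expR_ge1Dx _); rewrite lerDl.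
  have : x * (2 ^+ N) ^+ 2 <= 1.
    rewrite -ler_pdivlMr ?exprn_gt0// mul1r -[leLHS]lnK ?posrE//.
    rewrite -[leRHS]lnK ?posrE ?invr_gt0 ?exprn_gt0// ler_expR lnV ?posrE ?exprn_gt0//.
    rewrite -exprM mulnC exprM (_ : 2 ^+ 2 = 4 :> R); last by rewrite -natrX.
    by rewrite lnXn// -/c -mulr_natl; lra.
  by lra.
have intf j : (\int[chi2]_x (f j x)%:E <= ((2^-1) ^+ j)%:E)%E.
  have b0 : 0 < 2 ^+ j :> R by rewrite exprn_gt0.
  have := chi2_laplace b0; rewrite -/(f j) => h.
  rewrite exprVn; have := h.
  have I0 : (0 <= \int[chi2]_x (f j x)%:E)%E.
    by apply: integral_ge0 => x _; rewrite lee_fin.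
  move=> {}h; have : ((2 ^+ j)%:E * \int[chi2]_x (f j x)%:E <= 1)%E.
    apply: le_trans h; rewrite lee_wpmul2r// lee_fin -exprM ler_weXn2l ?ler1n//.
    by rewrite leq_pmulr.
  rewrite -[X in (X <= _ -> _)%E]muleC -lee_pdivlMr// => h'.
  by apply: (le_trans h'); rewrite mul1e.
have sumf : (\sum_(0 <= j <oo) \int[chi2]_x (f j x)%:E <= 2%:E)%E.
  apply: lime_le.
    by apply: is_cvg_nneseries => j _ _; apply: integral_ge0 => x _; rewrite lee_fin.
  apply: nearW => N.
  apply: (@le_trans _ _ (\sum_(0 <= j < N) ((2^-1) ^+ j)%:E)%E).
    by apply: lee_sum => j _; exact: intf.
  rewrite sumEFin lee_fin.
  suff -> : \sum_(0 <= j < N) (2^-1) ^+ j = 2 - 2 * (2^-1) ^+ N :> R.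
    by rewrite gerBl mulr_ge0// exprn_ge0.
  elim: N => [|N IH]; first by rewrite big_geq// expr0; lra.
  by rewrite big_nat_recr//= IH exprS; field.
have mS : measurable_fun [set: R] (fun x => \sum_(0 <= j <oo) (f j x)%:E)%E.
  by apply: ge0_emeasurable_sum => // j x _ _; rewrite lee_fin.
have S0 x : (0 <= \sum_(0 <= j <oo) (f j x)%:E)%E.
  by apply: nneseries_ge0 => j _ _; rewrite lee_fin.
apply: (@le_lt_trans _ _ (\int[chi2]_x (C%:E * \sum_(0 <= j <oo) (f j x)%:E))%E).
  apply: onR_chi2_le.
  - by apply: mfun_EFin; apply: measurable_maxr; [mfun|exact: measurable_cst].
  - exact: mfun_emul (measurable_cst _) mS.
  - by move=> x; rewrite lee_fin le_max lexx orbT.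
  - by move=> x; rewrite mule_ge0 ?lee_fin.
  move=> x x0.
  have [N NE] : exists N : nat, - ln x <= N%:R * c.
    exists (Num.truncn (`|ln x| / c)).+1.
    rewrite -ler_pdivrMr//; apply: (@le_trans _ _ (`|ln x| / c)).
      by rewrite ler_pM2r ?invr_gt0// -normrN ler_norm.
    by rewrite ltW// truncnS_gt.
  apply: (@le_trans _ _ (C%:E * \sum_(0 <= j < N) (f j x)%:E)%E); last first.
    rewrite lee_wpmul2l ?lee_fin//; apply: nneseries_lim_ge => j _.
    by rewrite lee_fin.
  rewrite sumEFin -EFinM lee_fin ge_max; apply/andP; split.
    by rewrite big_mkord; apply: le_trans (part N x x0); rewrite le_min lexx.
  by rewrite mulr_ge0// sumr_ge0.
rewrite (ge0_integralTZ chi2 mS S0 C0) lte_mul_pinfty ?lee_fin//.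
rewrite integral_nneseries//; last by move=> j x _; rewrite lee_fin.
by apply: (le_lt_trans sumf); rewrite ltry.
Qed.

End chi_square_moments.

(** * Chebyshev's association inequality for the mixing law *)

Section chebyshev.
Context {R : realType}.
Variable Pi : probability R R.
Variables (a : R -> R) (g : R -> \bar R) (Ma Mb : R).

(* [t |-> g t - g (Ma / Mb)] and [t |-> 1 / t - Mb / Ma] have the same sign. *)
Lemma chebyshev_inv :
  measurable_fun [set: R] a -> measurable_fun [set: R] g ->
  (forall t, 0 <= a t) -> (forall t, t <= 0 -> a t = 0) ->
  (forall t, 0 <= g t)%E -> (forall t, g t < +oo)%E ->
  (forall t t', 0 < t -> t <= t' -> (g t' <= g t)%E) ->
  (\int[Pi]_t (a t)%:E = Ma%:E)%E -> (\int[Pi]_t (a t / t)%:E = Mb%:E)%E ->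
  0 < Ma -> 0 < Mb ->
  (\int[Pi]_t ((a t)%:E * g t) <= (Ma / Mb)%:E * \int[Pi]_t ((a t / t)%:E * g t))%E.
Proof.
move=> ma mg a0 an g0 gfin gd iMa iMb Ma0 Mb0.
have at0 t : 0 <= a t / t.
  have [t0|/an ->] := ltP 0 t; last by rewrite mul0r.
  by rewrite divr_ge0// ltW.
have mat : measurable_fun [set: R] (fun t => a t / t) by mfun.
have maE : measurable_fun [set: R] (fun t => (a t)%:E) by exact: mfun_EFin.
have matE : measurable_fun [set: R] (fun t => (a t / t)%:E) by exact: mfun_EFin.
have mag := mfun_emul maE mg; have matg := mfun_emul matE mg.
have ag0 t : (0 <= (a t)%:E * g t)%E by rewrite mule_ge0 ?lee_fin.
have atg0 t : (0 <= (a t / t)%:E * g t)%E by rewrite mule_ge0 ?lee_fin.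
pose d := Mb / Ma; have d0 : 0 < d by rewrite divr_gt0.
have dV : Ma / Mb = d^-1 by rewrite /d invf_div.
set A := (\int[Pi]_t ((a t)%:E * g t))%E.
set B := (\int[Pi]_t ((a t / t)%:E * g t))%E.
have A0 : (0 <= A)%E by apply: integral_ge0.
have B0 : (0 <= B)%E by apply: integral_ge0.
suff dAB : (d%:E * A <= B)%E.
  rewrite dV; apply: (@le_trans _ _ (d^-1%:E * (d%:E * A))%E).
    by rewrite muleA -EFinM mulVf ?gt_eqF// mul1e.
  by rewrite lee_wpmul2l ?lee_fin ?invr_ge0 ?(ltW d0).
pose g1 := fine (g (d^-1)).
have g1E : g (d^-1) = g1%:E by rewrite fineK// ge0_fin_numE.
have g10 : 0 <= g1 by rewrite fine_ge0.
(* The integral of [a t * (g t - g1) * (1 / t - d)] is nonnegative. Its expansion is written with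
   the negative terms moved across; the two constant terms are both [Mb * g1] since
   [d * Ma = Mb]. *)
suff : (d%:E * A + (Mb * g1)%:E <= B + (Mb * g1)%:E)%E by rewrite leeD2rE.
have e1 : ((Mb * g1)%:E = \int[Pi]_t (g1%:E * (a t / t)%:E))%E.
  by rewrite ge0_integralTZ// iMb -EFinM mulrC.
have e2 : ((Mb * g1)%:E = \int[Pi]_t ((d * g1)%:E * (a t)%:E))%E.
  have aE0 t : (0 <= (a t)%:E)%E by rewrite lee_fin.
  have dg0 : 0 <= d * g1 by rewrite mulr_ge0// ltW.
  rewrite (ge0_integralTZ Pi maE aE0 dg0) iMa -EFinM; congr EFin.
  by rewrite /d; field; rewrite gt_eqF.
have mc1 := mfun_emul (measurable_cst (g1%:E)) matE.
have mc2 := mfun_emul (measurable_cst ((d * g1)%:E)) maE.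
have mc3 := mfun_emul (measurable_cst (d%:E)) mag.
rewrite {1}e1 e2 -(ge0_integralTZ Pi mag ag0 (ltW d0)).
rewrite [leLHS]ge0_integralTD//; last 2 first.
- by move=> t; rewrite mule_ge0 ?lee_fin// ltW.
- by move=> t; rewrite mule_ge0 ?lee_fin.
rewrite [leRHS]ge0_integralTD//; last first.
  by move=> t; rewrite mule_ge0 ?lee_fin// mulr_ge0// ltW.
apply: ge0_le_integralT.
- exact: mfun_eadd.
- exact: mfun_eadd.
- by move=> t; rewrite adde_ge0// mule_ge0 ?lee_fin// ltW.
move=> t.
have [t0|/an at_0] := ltP 0 t; last first.
  by rewrite at_0 !mul0r !mul0e !mule0 !adde0.
have gtE : g t = (fine (g t))%:E by rewrite fineK// ge0_fin_numE.
have t0' : t != 0 by rewrite gt_eqF.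
suff : 0 <= (fine (g t) - g1) * (t^-1 - d).
  rewrite gtE -!EFinM -!EFinD lee_fin => h.
  rewrite -subr_ge0 (_ : _ - _ = a t * ((fine (g t) - g1) * (t^-1 - d))).
    exact: mulr_ge0.
  by ring.
have [td|td] := leP t (d^-1).
  rewrite mulr_ge0// subr_ge0.
    by have := gd _ _ t0 td; rewrite g1E gtE lee_fin.
  by rewrite -[d]invrK lef_pV2// posrE invr_gt0.
rewrite -mulrNN mulr_ge0// opprB subr_ge0.
  have dp : 0 < d^-1 by rewrite invr_gt0.
  by have := gd _ _ dp (ltW td); rewrite g1E gtE lee_fin.
by rewrite -[d]invrK lef_pV2 ?posrE ?invr_gt0// ltW.
Qed.

End chebyshev.

(** * Conditional laws recovered from probabilities of rectangles *)

Lemma eq_measure_rectangles d1 d2 (T1 : measurableType d1)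
    (T2 : measurableType d2) (R : realType)
    (mu nu : {measure set (T1 * T2) -> \bar R}) :
  (forall A B, measurable A -> measurable B -> mu (A `*` B) = nu (A `*` B)) ->
  (mu setT < +oo)%E -> forall F, measurable F -> mu F = nu F.
Proof.
move=> munu mufin F mF.
pose C : set (set (T1 * T2)) :=
  [set C | exists A, measurable A /\ exists B, measurable B /\ C = A `*` B].
apply: (measure_unique C (fun=> setT)) => //.
- rewrite measurable_prod_measurableType; congr (<<s _ >>).
  rewrite predeqE => X; split => [[A mA [B mB <-]]|[A [mA [B [mB ->]]]]].
    by exists A; split => //; exists B.
  by exists A => //; exists B.
- move=> _ _ [X1 [mX1 [X2 [mX2 ->]]]] [Y1 [mY1 [Y2 [mY2 ->]]]].
  rewrite -setXI; exists (X1 `&` Y1); split; first exact: measurableI.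
  by exists (X2 `&` Y2); split => //; exact: measurableI.
- by move=> _; exists setT; split => //; exists setT; split => //; rewrite setXTT.
- by rewrite bigcup_const//; exists 0%N.
- by move=> _ [A [mA [B [mB ->]]]]; exact: munu.
Qed.

Section conditional_product.
Local Open Scope ereal_scope.
Context d dX (T : measurableType d) (X : measurableType dX) (R : realType).
Variables (P : probability T R) (nu : subprobability R R).
Variables (W : T -> X) (Y : T -> R) (phi : X * R -> R).
Hypotheses (mW : measurable_fun [set: T] W) (mY : measurable_fun [set: T] Y).
Hypothesis mphi : measurable_fun [set: X * R] phi.

(* On [D], given [W] the law of [Y] is that of [phi (W, y)], [y] of law [nu],
   and [g W] is the conditional probability of [D]. *)
Definition cond_rect (D : set T) (g : X -> R) := forall E B,
  measurable E -> measurable B ->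
  P (W @^-1` E `&` Y @^-1` B `&` D) =
  \int[P]_(x in W @^-1` E) ((g (W x))%:E * nu [set y | B (phi (W x, y))]).

Let WY x := (W x, Y x).
Let mWY : measurable_fun [set: T] WY. Proof. exact: mfun_pair. Qed.

Let psi (z : T * R) := (W z.1, phi (W z.1, z.2)).
Let mpsi : measurable_fun [set: T * R] psi.
Proof. by apply: mfun_pair; mfun. Qed.

Let measurable_pre (F : set (X * R)) : measurable F -> measurable (psi @^-1` F).
Proof. by move=> mF; rewrite -[X in measurable X]setTI; exact: mpsi. Qed.

(** Two finite measures on [X * R] are compared on rectangles: the image under [WY] of [P]
    restricted to [D], and the image under [psi] of the product [P \x nu] weighted by [g (W x)]. *)
Lemma cond_rect_measure (D : set T) (g : X -> R) : measurable D ->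
  measurable_fun [set: X] g -> (forall w, 0 <= g w)%R -> cond_rect D g ->
  forall F, measurable F -> P (WY @^-1` F `&` D) =
    \int[P]_x \int[nu]_y ((g (W x))%:E * (\1_F (W x, phi (W x, y)))%:E).
Proof.
move=> mD mg g0 H.
have mgE : measurable_fun [set: T * R] (fun z => (g (W z.1))%:E) by mfun.
have gE0 (z : T * R) : 0 <= (g (W z.1))%:E by rewrite lee_fin.
pose mu1 := pushm (mrestr P mD) mWY.
pose mu2 := pushm (with_density (P \x nu) mgE gE0) mpsi.
have mu2E F : measurable F -> mu2 F =
    \int[P]_x \int[nu]_y ((g (W x))%:E * (\1_F (W x, phi (W x, y)))%:E).
  move=> mF; rewrite /mu2 /= /pushforward /with_density integral_mkcond.
  have m1 : measurable_fun [set: T * R] (fun z : T * R =>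
      (g (W z.1))%:E * (\1_F (psi z))%:E).
    apply: mfun_emul => //; apply: mfun_EFin; apply: measurableT_comp => //.
  rewrite (eq_integral (fun z => (g (W z.1))%:E * (\1_F (psi z))%:E)); last first.
    by move=> z _; rewrite epatch_indic.
  rewrite (fubini_tonelli1 _ m1)//.
  by move=> z; rewrite mule_ge0 ?lee_fin.
suff e F : measurable F -> mu1 F = mu2 F.
  by move=> F mF; rewrite -mu2E// -e.
apply: eq_measure_rectangles; last first.
  rewrite /mu1/= /pushforward /mrestr preimage_setT setTI.
  by rewrite (le_lt_trans (probability_le1 _ _))// ltry.
move=> E B mE mB; rewrite mu2E; last exact: measurableX.
have mB' x : measurable [set y | B (phi (W x, y))].
  rewrite -[X in measurable X]setTI.
  have mj : measurable_fun [set: R] (fun y => phi (W x, y)) by mfun.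
  exact: mj.
rewrite /mu1/= /pushforward /mrestr.
transitivity (P (W @^-1` E `&` Y @^-1` B `&` D)); first by [].
rewrite H// integral_mkcond; apply: eq_integral => x _; rewrite patchE.
case: ifPn => [/set_mem xE|xE].
  rewrite (eq_integral (fun y => (g (W x))%:E *
    (\1_[set y | B (phi (W x, y))] y)%:E)); last first.
    move=> y _; congr (_ * _%:E); rewrite !indicE.
    have -> // : ((W x, phi (W x, y)) \in E `*` B) =
        (y \in [set y | B (phi (W x, y))]).
    by apply/idP/idP => /set_mem h; apply/mem_set => //=; case: h.
  by rewrite ge0_integralZl ?lee_fin// ?integral_indic ?setIT//; exact: mfun_EFin.
rewrite integral0_eq// => y _; rewrite indicE memNset ?mule0//= => -[/= h _].
by move/negP: xE; apply; exact/mem_set.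
Qed.

Lemma cond_rect_integral (f : X * R -> \bar R) : cond_rect setT (fun=> 1%R) ->
  measurable_fun [set: X * R] f -> (forall z, 0 <= f z) ->
  \int[P]_x f (W x, Y x) = \int[P]_x \int[nu]_y f (W x, phi (W x, y)).
Proof.
move=> H mf f0.
have e F : measurable F -> pushm P mWY F = pushm (P \x nu) mpsi F.
  move=> mF; rewrite /= /pushforward.
  have := cond_rect_measure measurableT (measurable_cst _) (fun=> ler01) H mF.
  rewrite setIT => ->.
  rewrite -[psi @^-1` F]setIT -integral_indic//; last exact: measurable_pre.
  have m1 : measurable_fun [set: T * R] (fun z : T * R => (\1_(psi @^-1` F) z)%:E : \bar R).
    by apply: mfun_EFin; apply: measurable_indic; exact: measurable_pre.
  rewrite (fubini_tonelli1 _ m1)//.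
  by apply: eq_integral => x _; apply: eq_integral => y _; rewrite mul1e.
transitivity (\int[pushm P mWY]_z f z).
  by rewrite ge0_integral_pushforward.
transitivity (\int[pushm (P \x nu) mpsi]_z f z).
  by apply: eq_measure_integral => F mF _; exact: e.
rewrite ge0_integral_pushforward//=.
have m1 : measurable_fun [set: T * R] (f \o psi) by exact: measurableT_comp.
by rewrite (fubini_tonelli1 _ m1 (fun z => f0 _)).
Qed.

(** Conditional independence survives the adjunction of [Y]: given the pair [(W, Y)], the
    conditional probability of [D] is still [g W]. This lets observations be adjoined one after the
    other. *)
Lemma cond_rect_next (D : set T) (g : X -> R) : measurable D ->
  measurable_fun [set: X] g -> (forall w, 0 <= g w)%R ->
  cond_rect setT (fun=> 1%R) -> cond_rect D g ->
  forall F, measurable F ->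
    P (WY @^-1` F `&` D) = \int[P]_(x in WY @^-1` F) (g (W x))%:E.
Proof.
move=> mD mg g0 H1 H F mF; rewrite (cond_rect_measure mD mg g0 H mF).
have mf : measurable_fun [set: X * R] (fun z => (g z.1)%:E * (\1_F z)%:E).
  by apply: mfun_emul; [mfun|apply: mfun_EFin; exact: measurable_indic].
have f0 (z : X * R) : 0 <= (g z.1)%:E * (\1_F z)%:E.
  by rewrite mule_ge0 ?lee_fin.
rewrite -[LHS](cond_rect_integral H1 mf f0) [RHS]integral_mkcond.
by apply: eq_integral => x _; rewrite epatch_indic.
Qed.

End conditional_product.

Lemma measurable_fine_section d (X : measurableType d) (R : realType)
    (nu : subprobability R R) (phi : X * R -> R) (B : set R) :
  measurable_fun [set: X * R] phi -> measurable B ->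
  measurable_fun [set: X] (fun w => fine (nu [set y | B (phi (w, y))])).
Proof.
move=> mphi mB; apply: measurableT_comp => //.
have mF : measurable [set z | B (phi z)].
  by rewrite -[X in measurable X]setTI; exact: mphi.
have := measurable_fun_xsection nu mF; congr (measurable_fun _ _).
apply/funext => w /=; congr (nu _); apply/seteqP; split => y /=.
  by move/xsectionP.
by move=> h; apply/xsectionP.
Qed.

(** [sqI] unfolds at the head of the list, whereas the coordinates of [X1] are adjoined in
    increasing order, that is, at the end. *)
Lemma sqI_rcons {R : realType} (s : seq R) (a l : R) (g : R -> \bar R) :
  sqI (rcons s a) l g = sqI s l (fun z =>
    \int[onR (@normal_prob R 0 1)]_y g (z + (l * a + y) ^+ 2)%R)%E.
Proof.
elim: s g => [|b s IH] g /=.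
  by apply: eq_integral => y _; rewrite addr0 add0r.
apply: eq_integral => y _; rewrite IH; congr (sqI s l _); apply/funext => z.
by apply: eq_integral => y' _; rewrite addrA.
Qed.

Lemma mfun_sqrt d (T : measurableType d) (R : realType) (f : T -> R) :
  measurable_fun [set: T] f -> measurable_fun [set: T] (fun x => Num.sqrt (f x)).
Proof.
move=> mf; have ms : measurable_fun [set: R] (@Num.sqrt R).
  by apply: continuous_measurable_fun; exact: sqrt_continuous.
exact: (measurableT_comp ms).
Qed.

(** * The law of the observations as a mixture over [tau] *)

Section mixture.
Context {R : realType} {p q m1 m2 : nat} (Pi : probability R R).
Hypothesis Pi_pos : Pi [set t | 0 < t] = 1%E.
Context d (T : measurableType d) (P : probability T R) (w : param R p q).
Hypothesis w_ord : ordered_param w.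
Variables (tau : {mfun T >-> R}) (X1 : {mfun T >-> p.-tuple R})
  (S1 : {mfun T >-> R}) (X2 : {mfun T >-> q.-tuple R}) (S2 : {mfun T >-> R}).
Hypothesis model : scale_mixture_model m1 m2 Pi P w tau X1 S1 X2 S2.

Local Notation N01 := (onR (@normal_prob R 0 1)).
Local Notation chi2_1 := (onR (@chi2_law R m1)).
Local Notation chi2_2 := (onR (@chi2_law R m2)).
Let th i := tnth (theta1 w) i.
Let s1 := sigma1 w.
Let s2 := sigma2 w.
Let s1_gt0 : 0 < s1. Proof. by case: w_ord. Qed.
Let s2_gt0 : 0 < s2. Proof. by case: w_ord. Qed.

Let normal_rectT n (theta : n.-tuple R) v : normal_rect theta v (fun=> setT) = 1%E.
Proof.
by rewrite /normal_rect big1// => i _; rewrite probability_setT.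
Qed.

(** With all sets full, the model equates [1] with the product of the two total masses, each of
    which is [0] or [1]. *)
Let mass : chi2_law m1 [set: R] = 1%E /\ chi2_law m2 [set: R] = 1%E.
Proof.
have := model measurableT (fun=> measurableT) measurableT (fun=> measurableT) measurableT.
rewrite (_ : [set x | _] = setT); last by apply/seteqP; split.
rewrite probability_setT (eq_integral (fun=> (chi2_law m1 [set: R] *
  chi2_law m2 [set: R])%E)); last by move=> t _; rewrite !normal_rectT mul1e mule1.
rewrite integral_cst// [X in (_ * X)%E](_ : _ = 1%E) ?mule1; last first.
  exact: probability_setT.
have [->|->] := @chi2_probT R m1; have [->|->] := @chi2_probT R m2 => //;
  by rewrite ?mul0e ?mule0 => /eqP; rewrite onee_eq0.
Qed.

Lemma chi2_mass1 : chi2_law m1 [set: R] = 1%E. Proof. by case: mass. Qed.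
Lemma chi2_mass2 : chi2_law m2 [set: R] = 1%E. Proof. by case: mass. Qed.

Let chi2T v m : chi2_law m [set: R] = 1%E -> scaled_chi2_prob v m [set: R] = 1%E.
Proof. by []. Qed.

Lemma tau_law (B : set R) : measurable B -> P (tau @^-1` B) = Pi B.
Proof.
move=> mB.
have := model mB (fun=> measurableT) measurableT (fun=> measurableT) measurableT.
rewrite (_ : [set x | _] = tau @^-1` B); last first.
  by apply/seteqP; split => x //= [].
move=> ->; rewrite (eq_integral (fun=> 1%E)); last first.
  by move=> t _; rewrite !normal_rectT !chi2T ?mule1 ?chi2_mass1 ?chi2_mass2.
by rewrite integral_cst// mul1e.
Qed.

Let pos := [set t : R | 0 < t].
Let mpos : measurable pos.
Proof. by apply: (measurable_bool_set (b := fun t : R => 0 < t)); mfun. Qed.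

Let Pi_npos : Pi (~` pos) = 0%E.
Proof.
have e : Pi pos = 1%E by exact: Pi_pos.
by rewrite probability_setC// e subee.
Qed.

Lemma integral_tau (f : R -> \bar R) (B : set R) : measurable B ->
  measurable_fun [set: R] f -> (forall t, 0 <= f t)%E ->
  (\int[P]_(x in tau @^-1` B) f (tau x) = \int[Pi]_(t in B) f t)%E.
Proof.
move=> mB mf f0; have mt : measurable_fun [set: T] tau by [].
rewrite -(@ge0_integral_pushforward _ _ _ _ R _ mt P B f)//; last first.
  exact: measurable_funTS.
by apply: eq_measure_integral => A mA _; exact: tau_law.
Qed.

Let sd t := Num.sqrt (s1 ^+ 2 / t).
Let msd : measurable_fun [set: R] sd.
Proof. by apply: mfun_sqrt; mfun. Qed.

(** [qS], [qX] and [qA] are conditional probabilities given [tau = t]. The index [k] counts the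
    coordinates of [X1] already adjoined to the conditioning variable, so [qA] and [DX] concern the
    remaining ones. *)
Let qS m (s : R) (C : set R) t := fine (onR (@chi2_law R m) [set u | C (s ^+ 2 / t * u)]).
Let qX i (B : set R) t := fine (N01 [set y | B (sd t * y + th i)]).
Let qA (k : nat) (A : 'I_p -> set R) t := \prod_(i < p | (k <= i)%N) qX i (A i) t.
Let DX (k : nat) (A : 'I_p -> set R) :=
  [set x | forall i : 'I_p, (k <= i)%N -> A i (tnth (X1 x) i)].

Let mphiS (s : R) : measurable_fun [set: R * R] (fun z => s ^+ 2 / z.1 * z.2).
Proof. by mfun. Qed.
Let mphiX i : measurable_fun [set: R * R] (fun z => sd z.1 * z.2 + th i).
Proof. by mfun. Qed.

Let mqS m s C : measurable C -> measurable_fun [set: R] (qS m s C).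
Proof. exact: (measurable_fine_section (onR (@chi2_law R m)) (mphiS s)). Qed.
Let mqX i B : measurable B -> measurable_fun [set: R] (qX i B).
Proof. exact: (measurable_fine_section N01 (mphiX i)). Qed.
Let mqA k A : (forall i, measurable (A i)) -> measurable_fun [set: R] (qA k A).
Proof.
move=> mA; rewrite (_ : qA k A = fun t =>
    \prod_(i < p) (if (k <= i)%N then qX i (A i) t else 1)); last first.
  by apply/funext => t; rewrite /qA big_mkcond.
by apply: measurable_prod => i _; case: (k <= i)%N; [exact: mqX|exact: measurable_cst].
Qed.
Let qS0 m s C t : 0 <= qS m s C t. Proof. exact: fine_ge0. Qed.
Let qX0 i B t : 0 <= qX i B t. Proof. exact: fine_ge0. Qed.
Let qA0 k A t : 0 <= qA k A t. Proof. exact: prodr_ge0. Qed.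

Let subprob_fineK (nu : subprobability R R) (A : set R) : measurable A ->
  (fine (nu A))%:E = nu A.
Proof.
by move=> mA; rewrite fineK// fin_num_measure.
Qed.

Let mS s t (C : set R) : measurable C -> measurable [set u : R | C (s ^+ 2 / t * u)].
Proof.
move=> mC; rewrite -[X in measurable X]setTI.
have mj : measurable_fun [set: R] (fun u => s ^+ 2 / t * u) by mfun.
exact: mj.
Qed.
Let mX i t (C : set R) : measurable C -> measurable [set y : R | C (sd t * y + th i)].
Proof.
move=> mC; rewrite -[X in measurable X]setTI.
have mj : measurable_fun [set: R] (fun u => sd t * u + th i) by mfun.
exact: mj.
Qed.

Let qSE m s C t : measurable C ->
  (qS m s C t)%:E = onR (@chi2_law R m) [set u | C (s ^+ 2 / t * u)].
Proof. by move=> mC; apply: subprob_fineK; exact: mS. Qed.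
Let qXE i B t : measurable B -> (qX i B t)%:E = N01 [set y | B (sd t * y + th i)].
Proof. by move=> mB; apply: subprob_fineK; exact: mX. Qed.

Let qST m s t : chi2_law m [set: R] = 1%E -> qS m s setT t = 1.
Proof.
by move=> mT; rewrite /qS (_ : onR _ _ = 1%E).
Qed.
Let qXT i t : qX i setT t = 1.
Proof.
by rewrite /qX (_ : onR _ _ = 1%E)//; exact: onR_normalT.
Qed.
Let qAT k t : qA k (fun=> setT) t = 1.
Proof. by rewrite /qA big1. Qed.

Let mX1 i : measurable_fun [set: T] (fun x => tnth (X1 x) i).
Proof. by apply: (measurableT_comp (measurable_tnth i)). Qed.

Let mDX k A : (forall i, measurable (A i)) -> measurable (DX k A).
Proof.
move=> mA; rewrite (_ : DX k A = \bigcap_(i in [set i : 'I_p | (k <= i)%N])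
    ((fun x => tnth (X1 x) i) @^-1` (A i))); last first.
  by apply/seteqP; split => x /= h i; exact: h.
apply: fin_bigcap_measurable => // i _.
by rewrite -[X in measurable X]setTI; exact: mX1.
Qed.

Let mpre (Y : {mfun T >-> R}) (C : set R) : measurable C -> measurable (Y @^-1` C).
Proof.
move=> mC; rewrite -[X in measurable X]setTI.
exact: (measurable_funPT Y).
Qed.

Let base B C1 C2 A : measurable B -> measurable C1 -> measurable C2 ->
  (forall i, measurable (A i)) ->
  P (tau @^-1` B `&` S1 @^-1` C1 `&` (S2 @^-1` C2 `&` DX 0 A)) =
  (\int[P]_(x in tau @^-1` B)
    (qS m2 s2 C2 (tau x) * qA 0 A (tau x) * qS m1 s1 C1 (tau x))%:E)%E.
Proof.
move=> mB mC1 mC2 mA.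
pose g t := (qS m2 s2 C2 t * qA 0 A t * qS m1 s1 C1 t)%:E.
have mg : measurable_fun [set: R] g.
  apply: mfun_EFin; apply: mfunM; last exact: mqS.
  by apply: mfunM; [exact: mqS|exact: mqA].
have g0 t : (0 <= g t)%E by rewrite lee_fin !mulr_ge0.
rewrite (integral_tau mB mg g0).
have nP : P (tau @^-1` (~` pos)) = 0%E.
  by rewrite tau_law//; exact: measurableC.
have mev : measurable (tau @^-1` B `&` S1 @^-1` C1 `&` (S2 @^-1` C2 `&` DX 0 A)).
  by apply: measurableI; apply: measurableI; try exact: mpre; exact: mDX.
(* Standardization needs a positive variance, so both sides are restricted to [tau > 0], which has
   full probability. *)
have -> : (\int[Pi]_(t in B) g t = \int[Pi]_(t in B `&` pos) g t)%E.
  rewrite (ge0_negligible_integral (measurableC mpos))//; last first.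
    exact: measurable_funTS.
  by rewrite setDE setCK.
rewrite -(setIT (_ `&` _ `&` (S2 @^-1` C2 `&` DX 0 A))) -(setUv (tau @^-1` pos)) setIUr.
rewrite measureU; first last.
- by apply/seteqP; split => x // [[_ a] [_ b]]; exact: b a.
- by apply: measurableI => //; rewrite preimage_setC; apply: mpre; exact: measurableC.
- by apply: measurableI => //; exact: mpre.
rewrite [X in (_ + X)%E](_ : _ = 0%E) ?adde0; last first.
  apply: (@subset_measure0 _ _ _ P _ (tau @^-1` (~` pos))) => //.
  - by apply: measurableI => //; rewrite preimage_setC; apply: mpre; exact: measurableC.
  - by apply: mpre; exact: measurableC.
have mBp : measurable (B `&` pos) by exact: measurableI.
have := model mBp mA mC1 (fun=> measurableT) mC2.
rewrite (_ : [set x | _] = (tau @^-1` B `&` S1 @^-1` C1 `&`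
    (S2 @^-1` C2 `&` DX 0 A)) `&` tau @^-1` pos); last first.
  apply/seteqP; split => x /=.
    by move=> [[? ?] ? ? _ ?]; split => //; split => //; split.
  by move=> [[[? ?] [? h]] ?]; split => // i; exact: h.
move=> h; apply: (etrans h); apply: eq_integral => t /set_mem[_ /= t0].
have e1 : (qS m1 s1 C1 t)%:E = scaled_chi2_prob (s1 ^+ 2 / t) m1 C1.
  exact: qSE.
have e2 : (qS m2 s2 C2 t)%:E = scaled_chi2_prob (s2 ^+ 2 / t) m2 C2.
  exact: qSE.
have e3 : (qA 0 A t)%:E = normal_rect (theta1 w) (s1 ^+ 2 / t) A.
  rewrite /qA /normal_rect -prodEFin; apply: eq_bigr => i _.
  rewrite qXE// normal_prob_standard// sqrtr_gt0 divr_gt0//.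
  exact: exprn_gt0.
transitivity ((qA 0 A t)%:E * (qS m1 s1 C1 t)%:E * 1 * (qS m2 s2 C2 t)%:E)%E.
  by congr (_ * _ * _ * _)%E;
    [exact: esym e3|exact: esym e1|exact: normal_rectT|exact: esym e2].
have assoc (a b c : R) : (a%:E * b%:E * 1 * c%:E = (c * a * b)%:E)%E.
  by rewrite mule1 -!EFinM; congr EFin; rewrite mulrC mulrA.
exact: assoc.
Qed.

Let rect1 C2 A : measurable C2 -> (forall i, measurable (A i)) ->
  cond_rect P chi2_1 tau S1 (fun z => s1 ^+ 2 / z.1 * z.2)
    (S2 @^-1` C2 `&` DX 0 A) (fun t => qS m2 s2 C2 t * qA 0 A t).
Proof.
move=> mC2 mA B C1 mB mC1; rewrite base//.
by apply: eq_integral => x _; rewrite EFinM qSE.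
Qed.

Let rect1T : cond_rect P chi2_1 tau S1 (fun z => s1 ^+ 2 / z.1 * z.2)
    setT (fun=> 1).
Proof.
have := rect1 measurableT (fun=> measurableT).
rewrite (_ : _ `&` DX 0 (fun=> setT) = setT); last by apply/seteqP; split.
have -> // : (fun t => qS m2 s2 setT t * qA 0 (fun=> setT) t) = fun=> 1.
by apply: funext => t; rewrite qST ?chi2_mass2// qAT mulr1.
Qed.

Let W1 x := (tau x, S1 x).
Let mW1 : measurable_fun [set: T] W1. Proof. exact: mfun_pair. Qed.

Let rect2 A : (forall i, measurable (A i)) ->
  cond_rect P chi2_2 W1 S2 (fun z => s2 ^+ 2 / z.1.1 * z.2)
    (DX 0 A) (fun v => qA 0 A v.1).
Proof.
move=> mA E C2 mE mC2.
have mD : measurable (S2 @^-1` C2 `&` DX 0 A).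
  by apply: measurableI; [exact: mpre|exact: mDX].
have mg : measurable_fun [set: R] (fun t => qS m2 s2 C2 t * qA 0 A t).
  by apply: mfunM; [exact: mqS|exact: mqA].
have := cond_rect_next (nu := chi2_1) (W := tau) (Y := S1)
  (measurable_funPT tau) (measurable_funPT S1) (mphiS s1) mD mg
  (fun t => mulr_ge0 (qS0 _ _ _ _) (qA0 _ _ _)) rect1T (rect1 mC2 mA) mE.
rewrite setIA => ->; apply: eq_integral => x _.
by rewrite mulrC EFinM qSE.
Qed.

Let rect2T : cond_rect P chi2_2 W1 S2 (fun z => s2 ^+ 2 / z.1.1 * z.2)
    setT (fun=> 1).
Proof.
have := rect2 (fun=> measurableT).
rewrite (_ : DX 0 (fun=> setT) = setT); last by apply/seteqP; split.
have -> // : (fun v : R * R => qA 0 (fun=> setT) v.1) = fun=> 1.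
by apply: funext => t; rewrite qAT.
Qed.

(** Only the running sum of squares is retained, not the coordinates, so the type of the
    conditioning variable does not depend on [k]. *)
Let Nk (k : nat) x := \sum_(i < p | (i < k)%N) tnth (X1 x) i ^+ 2.
Let mNk k : measurable_fun [set: T] (Nk k).
Proof.
rewrite (_ : Nk k = fun x =>
    \sum_(i < p) (if (i < k)%N then tnth (X1 x) i ^+ 2 else 0)); last first.
  by apply/funext => t; rewrite /Nk big_mkcond.
apply: measurable_sum => i; case: (i < k)%N; last exact: measurable_cst.
exact/mfunX/mX1.
Qed.

Let W2 x := (W1 x, S2 x).
Let mW2 : measurable_fun [set: T] W2. Proof. exact: mfun_pair. Qed.
Let W k x := (W2 x, Nk k x).
Let mW k : measurable_fun [set: T] (W k). Proof. by apply: mfun_pair; [exact: mW2|exact: mNk]. Qed.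

Let mphi2 : measurable_fun [set: (R * R) * R] (fun z => s2 ^+ 2 / z.1.1 * z.2).
Proof. by mfun. Qed.

Let mphiX4 i : measurable_fun [set: (R * R * R * R) * R]
  (fun z => sd z.1.1.1.1 * z.2 + th i).
Proof. by mfun. Qed.

Let law2 A F : (forall i, measurable (A i)) -> measurable F ->
  P (W2 @^-1` F `&` DX 0 A) = (\int[P]_(x in W2 @^-1` F) (qA 0 A (tau x))%:E)%E.
Proof.
move=> mA mF.
have mg : measurable_fun [set: R * R] (fun v => qA 0 A v.1).
  by apply: (measurableT_comp (mqA 0 mA)); mfun.
exact: (cond_rect_next (nu := chi2_2) (W := W1) (Y := S2) mW1
  (measurable_funPT S2) mphi2 (mDX 0 mA) mg (fun v => qA0 _ _ _) rect2T
  (rect2 mA) mF).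
Qed.

Let law_rect (k : 'I_p) A :
  (forall A F, (forall i, measurable (A i)) -> measurable F ->
    P (W k @^-1` F `&` DX k A) = (\int[P]_(x in W k @^-1` F) (qA k A (tau x))%:E)%E) ->
  (forall i, measurable (A i)) ->
  cond_rect P N01 (W k) (fun x => tnth (X1 x) k)
    (fun z => sd z.1.1.1.1 * z.2 + th k)
    (DX k.+1 A) (fun v => qA k.+1 A v.1.1.1).
Proof.
(* The event on coordinate [k] is put back as the [k]-th side of the rectangle, to which [H]
   applies; the product [qA k] then releases its factor [qX k]. *)
move=> H mA E B mE mB; pose A' i := if i == k then B else A i.
have mA' i : measurable (A' i) by rewrite /A'; case: ifP.
transitivity (P (W k @^-1` E `&` DX k A')).
  rewrite -setIA; congr (P (_ `&` _)); apply/seteqP; split => x /=.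
    move=> [hB hD] i; rewrite leq_eqVlt => /orP[/eqP ki|ki].
      by rewrite /A' (_ : i = k) ?eqxx//; exact/val_inj.
    rewrite /A'; case: eqP => [ik|_]; last exact: hD.
    by move: ki; rewrite ik ltnn.
  move=> h; split.
    by have := h k (leqnn _); rewrite /A' eqxx.
  move=> i ki; have := h i (ltnW ki); rewrite /A'; case: eqP => // ik.
  by move: ki; rewrite ik ltnn.
rewrite H//; apply: eq_integral => x _.
rewrite /= -(qXE k (tau x) mB) -EFinM; congr EFin.
rewrite /qA (bigD1 k)//= /A' eqxx mulrC; congr (_ * _).
apply: eq_big => [i|i /andP[_ /negbTE ->]//].
by rewrite ltn_neqAle eq_sym andbC.
Qed.

Let law k A F : (k <= p)%N -> (forall i, measurable (A i)) -> measurable F ->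
  P (W k @^-1` F `&` DX k A) = (\int[P]_(x in W k @^-1` F) (qA k A (tau x))%:E)%E.
Proof.
elim: k A F => [|k IH] A F kp mA mF.
  have N0 x : Nk 0 x = 0 by rewrite /Nk big_pred0.
  have mF' : measurable [set v | F (v, 0 : R)].
    rewrite -[X in measurable X]setTI.
    have mj : measurable_fun [set: R * R * R] (fun v => (v, 0 : R)) by mfun.
    exact: mj.
  rewrite (_ : W 0 @^-1` F = W2 @^-1` [set v | F (v, 0 : R)]); first exact: law2.
  by apply/seteqP; split => x; rewrite /preimage /W /= N0.
pose k' := Ordinal kp.
have H A' F' : (forall i, measurable (A' i)) -> measurable F' ->
  P (W k' @^-1` F' `&` DX k' A') =
  (\int[P]_(x in W k' @^-1` F') (qA k' A' (tau x))%:E)%E.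
  by move=> mA' mF'; apply: IH => //; exact: ltnW.
have RT := law_rect H (fun=> measurableT).
rewrite (_ : DX _ (fun=> setT) = setT) in RT; last by apply/seteqP; split.
have e1 : (fun v : R * R * R * R => qA k'.+1 (fun=> setT) v.1.1.1) = fun=> 1.
  by apply: funext => v; rewrite qAT.
rewrite e1 in RT.
have mg : measurable_fun [set: R * R * R * R] (fun v => qA k.+1 A v.1.1.1).
  by apply: (measurableT_comp (mqA k.+1 mA)); mfun.
have NS x : Nk k.+1 x = Nk k x + tnth (X1 x) k' ^+ 2.
  rewrite /Nk (bigD1 k')//= addrC; congr (_ + _).
  by apply: eq_bigl => i; rewrite ltnS andbC -ltn_neqAle.
(* Merges the new coordinate into the running sum of squares. *)
pose j (v : (R * R * R * R) * R) := (v.1.1, v.1.2 + v.2 ^+ 2).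
have mj : measurable_fun setT j by apply: mfun_pair; mfun.
have mjF : measurable (j @^-1` F).
  by rewrite -[X in measurable X]setTI; exact: mj.
have := cond_rect_next (mW k') (mX1 k') (mphiX4 k') (mDX k.+1 mA) mg
  (fun v => qA0 _ _ _) RT (law_rect H mA) mjF.
rewrite (_ : (fun x => (W k' x, tnth (X1 x) k')) @^-1` (j @^-1` F) = W k.+1 @^-1` F)//.
by apply/seteqP; split => x; rewrite /preimage /W /j /= NS.
Qed.

(** In units of [s1 / Num.sqrt t], the mean of the [i]-th coordinate is [Num.sqrt t] times the
    [i]-th entry. *)
Let s := [seq a / s1 | a <- theta1 w].

(** The last adjoined coordinate is integrated out under its normal law and becomes the last entry
    of [take k.+1 s]. Requiring [f] to vanish for [tau <= 0] makes the standardization legitimate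
    wherever it matters. *)
Let integral_W k (f : R * R * R * R -> \bar R) : (k <= p)%N ->
  measurable_fun setT f -> (forall v, 0 <= f v)%E ->
  (forall v, v.1.1.1 <= 0 -> f v = 0%E) ->
  (\int[P]_x f (W k x) = \int[P]_x sqI (take k s) (Num.sqrt (tau x))
     (fun z => f (W2 x, s1 ^+ 2 / tau x * z)%R))%E.
Proof.
elim: k f => [|k IH] f kp mf f0 fneg.
  rewrite take0; apply: eq_integral => x _ /=; rewrite mulr0 /W /Nk.
  by rewrite big_pred0.
pose k' := Ordinal kp.
have H A' F' : (forall i, measurable (A' i)) -> measurable F' ->
  P (W k' @^-1` F' `&` DX k' A') =
  (\int[P]_(x in W k' @^-1` F') (qA k' A' (tau x))%:E)%E.
  by move=> mA' mF'; apply: law => //; exact: ltnW.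
have RT := law_rect H (fun=> measurableT).
rewrite (_ : DX _ (fun=> setT) = setT) in RT; last by apply/seteqP; split.
have e1 : (fun v : R * R * R * R => qA k'.+1 (fun=> setT) v.1.1.1) = fun=> 1.
  by apply: funext => v; rewrite qAT.
rewrite e1 in RT.
have NS x : Nk k.+1 x = Nk k x + tnth (X1 x) k' ^+ 2.
  rewrite /Nk (bigD1 k')//= addrC; congr (_ + _).
  by apply: eq_bigl => i; rewrite ltnS andbC -ltn_neqAle.
pose j (v : (R * R * R * R) * R) := (v.1.1, v.1.2 + v.2 ^+ 2).
have mj : measurable_fun setT j by apply: mfun_pair; mfun.
have mfj : measurable_fun setT (f \o j) by exact: measurableT_comp.
transitivity (\int[P]_x (f \o j) (W k' x, tnth (X1 x) k'))%E.
  by apply: eq_integral => x _; rewrite /= /j /W /= NS.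
rewrite (cond_rect_integral (mW k') (mX1 k') (mphiX4 k') RT mfj (fun v => f0 _)).
pose f' (v : R * R * R * R) :=
  (\int[N01]_y f (v.1, v.2 + (sd v.1.1.1 * y + th k') ^+ 2)%R)%E.
have mf' : measurable_fun setT f'.
  have mm : measurable_fun [set: (R * R * R * R) * R] (fun z =>
      f (z.1.1, z.1.2 + (sd z.1.1.1.1 * z.2 + th k') ^+ 2)).
    by apply: (measurableT_comp mf); mfun.
  exact: (@measurable_fun_fubini_tonelli_F _ _ _ _ R N01 _ mm (fun z => f0 _)).
have f'0 v : (0 <= f' v)%E by apply: integral_ge0.
have f'neg v : v.1.1.1 <= 0 -> f' v = 0%E.
  by move=> v0; rewrite /f' integral0_eq// => y _; rewrite fneg.
transitivity (\int[P]_x f' (W k x))%E; first by [].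
rewrite IH//; last exact: ltnW.
apply: eq_integral => x _.
have sk : (k < size s)%N by rewrite size_map size_tuple.
rewrite (take_nth 0 sk) sqI_rcons; congr (sqI _ _ _); apply/funext => z.
apply: eq_integral => y _ /=.
have [t0|t0] := leP (tau x) 0; first by rewrite !fneg.
congr (f (_, _)); rewrite mulrDr; congr (_ + _).
have -> : nth 0 s k = th k' / s1.
  rewrite (nth_map 0) ?size_tuple//; congr (_ / _).
  by rewrite /th (tnth_nth 0).
have st0 : Num.sqrt (tau x) != 0 by rewrite gt_eqF// sqrtr_gt0.
have sdE : sd (tau x) = s1 / Num.sqrt (tau x).
  rewrite /sd sqrtrM ?sqr_ge0// sqrtr_sqr gtr0_norm//; congr (_ * _).
  by rewrite sqrtrV// ltW.
have s10 : s1 != 0 by rewrite gt_eqF.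
rewrite sdE -{2}(sqr_sqrtr (ltW t0)).
by field; rewrite s10 st0.
Qed.

(** [X1] is integrated out, then [S2], then [S1], and finally [tau] is replaced by its law.
    Measuring [S2] in units of [s1 ^+ 2 / t] produces the ratio [(s2 / s1) ^+ 2]. *)
Lemma mixture_integral (f : R * R * R * R -> \bar R) :
  measurable_fun setT f -> (forall v, 0 <= f v)%E ->
  (forall v, v.1.1.1 <= 0 -> f v = 0%E) ->
  (\int[P]_x f (tau x, S1 x, S2 x, sqnorm (X1 x)) =
   \int[Pi]_t condE m1 m2 s ((s2 / s1) ^+ 2) (Num.sqrt t)
     (fun v => f (t, s1 ^+ 2 / t * v.1.1, s1 ^+ 2 / t * v.1.2,
                  s1 ^+ 2 / t * v.2)%R))%E.
Proof.
move=> mf f0 fneg.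
transitivity (\int[P]_x f (W p x))%E.
  apply: eq_integral => x _; congr (f (_, _)); rewrite /sqnorm /Nk.
  by apply: eq_bigl => i; rewrite ltn_ord.
rewrite integral_W// take_oversize ?size_map ?size_tuple//.
pose f3 (v : (R * R * R) * R) := f (v.1, s1 ^+ 2 / v.1.1.1 * v.2).
have mf3 : measurable_fun setT f3 by apply: (measurableT_comp mf); mfun.
have msq : measurable_fun [set: R * R * R] (fun v => Num.sqrt v.1.1).
  by apply: mfun_sqrt; mfun.
have [mF F0] := measurable_sqI s msq mf3 (fun v => f0 _).
rewrite -[LHS]/(\int[P]_x (fun v : R * R * R => sqI s (Num.sqrt v.1.1)
  (fun z => f3 (v, z))) (W1 x, S2 x))%E.
rewrite (cond_rect_integral mW1 (measurable_funPT S2) mphi2 rect2T mF F0).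
pose f2 (v : R * R) := (\int[chi2_2]_v2 sqI s (Num.sqrt v.1)
  (fun z => f3 (v, s2 ^+ 2 / v.1 * v2, z)%R))%E.
have mf2 : measurable_fun setT f2.
  have mm : measurable_fun [set: (R * R) * R] (fun z => sqI s (Num.sqrt z.1.1)
      (fun x => f3 (z.1, s2 ^+ 2 / z.1.1 * z.2, x))).
    have mk : measurable_fun [set: (R * R) * R] (fun z : (R * R) * R =>
      (z.1, s2 ^+ 2 / z.1.1 * z.2)) by mfun.
    exact: (measurableT_comp mF mk).
  by apply: (@measurable_fun_fubini_tonelli_F _ _ _ _ R chi2_2 _ mm) => z; apply: sqI_ge0 => ?; exact: f0.
have f20 v : (0 <= f2 v)%E.
  by apply: integral_ge0 => y _; apply: sqI_ge0 => ?; exact: f0.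
rewrite -[LHS]/(\int[P]_x f2 (tau x, S1 x))%E.
rewrite (cond_rect_integral (measurable_funPT tau) (measurable_funPT S1)
  (mphiS s1) rect1T mf2 f20).
pose f1 (t : R) := (\int[chi2_1]_u f2 (t, s1 ^+ 2 / t * u)%R)%E.
have mf1 : measurable_fun setT f1.
  have mm : measurable_fun [set: R * R] (fun z => f2 (z.1, s1 ^+ 2 / z.1 * z.2)).
    by apply: (measurableT_comp mf2); mfun.
  by apply: (@measurable_fun_fubini_tonelli_F _ _ _ _ R chi2_1 _ mm) => z.
have f10 t : (0 <= f1 t)%E by apply: integral_ge0.
rewrite -[LHS]/(\int[P]_x f1 (tau x))%E.
have := integral_tau measurableT mf1 f10; rewrite preimage_setT => ->.
apply: eq_integral => t _; apply: eq_integral => u _; apply: eq_integral => v _.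
congr (sqI _ _ _); apply/funext => z; rewrite /f3 /=.
congr (f (_, _, _, _)).
have [->|t0] := eqVneq t 0; first by rewrite invr0 !mulr0 !mul0r.
by field; rewrite t0 gt_eqF.
Qed.

(** Given [tau = t > 0], the chi-square densities give no mass to nonpositive values. *)
Lemma mixture_ae_pos :
  {ae P, forall x, [/\ 0 < tau x, 0 < S1 x & 0 < S2 x]}.
Proof.
have npS m (sg : R) : 0 < sg -> (forall t, 0 < t -> qS m sg (~` pos) t = 0).
  move=> sg0 t t0; rewrite /qS (_ : onR _ _ = 0%E)//.
  rewrite /onR /chi2_law /chi2_prob; apply: integral0_eq => y /= y0.
  rewrite /chi2_pdf ifF//; apply/negP => yp; apply: y0.
  by rewrite /pos /= mulr_gt0// divr_gt0// exprn_gt0.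
have mnp : measurable (~` pos) by exact: measurableC.
have z1 : P (tau @^-1` (~` pos)) = 0%E by rewrite tau_law.
have zS C1 C2 : measurable C1 -> measurable C2 ->
    (forall t, 0 < t -> qS m2 s2 C2 t * qS m1 s1 C1 t = 0) ->
    P (S1 @^-1` C1 `&` S2 @^-1` C2) = 0%E.
  move=> mC1 mC2 h.
  have := base measurableT mC1 mC2 (fun=> measurableT).
  rewrite preimage_setT setTI (_ : DX 0 _ = setT) ?setIT; last by apply/seteqP; split.
  move=> ->.
  rewrite (ge0_negligible_integral (mpre tau mnp))//.
  - apply: integral0_eq => x [_ /= /contrapT t0]; rewrite qAT mulr1 h//.
  - apply: mfun_EFin; apply: mfunM; last first.
      by apply: (measurableT_comp (mqS m1 s1 mC1)).
    apply: mfunM; first by apply: (measurableT_comp (mqS m2 s2 mC2)).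
    by apply: (measurableT_comp (mqA 0 (fun=> measurableT))).
  - by move=> x _; rewrite lee_fin !mulr_ge0.
have z2 : P (S1 @^-1` (~` pos)) = 0%E.
  rewrite -[X in P X]setIT -[setT](preimage_setT S2); apply: zS => // t t0.
  by rewrite npS ?mulr0.
have z3 : P (S2 @^-1` (~` pos)) = 0%E.
  rewrite -[X in P X]setTI -[setT](preimage_setT S1); apply: zS => // t t0.
  by rewrite npS ?mul0r.
have ae_pos (Y : {mfun T >-> R}) : P (Y @^-1` (~` pos)) = 0%E ->
    {ae P, forall x, 0 < Y x}.
  by move=> Y0; exists (Y @^-1` (~` pos)); split => //; exact: mpre.
apply: filterS3 (ae_pos _ z1) (ae_pos _ z2) (ae_pos _ z3) => x a b c.
by split.
Qed.

End mixture.

(** * The difference between the old and the new factor *)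

Section gap.
Context {R : realType}.
Variables (al be f0 N : R).
Hypotheses (N_gt0 : 0 < N) (f0_gt0 : 0 < f0) (Nf0 : N * f0 = 1 + al).

(* The region of the corollary, in terms of (S1, S2, |X1|^2). *)
Definition region (v : R * R * R) : bool :=
  (0 < v.1.1) && ((0 < v.1.2) && ((0 <= v.2) &&
  ((v.1.2 + v.2 <= al * v.1.1) && (v.1.2 <= be * v.1.1)))).

(* The improved estimator multiplies the old factor f0 of S1 by
   (f0 - gap) / f0. *)
Definition gap (v : R * R * R) : R :=
  if region v then f0 - (v.1.1 + v.1.2 + v.2) / (N * v.1.1) else 0.

Lemma measurable_gap : measurable_fun [set: R * R * R] gap.
Proof. by rewrite /gap /region; apply: mfun_if; mfun. Qed.

(** The relation [N * f0 = 1 + al] says that the new factor reaches [f0] exactly on the boundary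
    [v + z = al * u]; hence the sign of [gap]. *)
Lemma gapE v : region v ->
  gap v = (al * v.1.1 - (v.1.2 + v.2)) / (N * v.1.1).
Proof.
move=> rv; rewrite /gap rv; move: rv => /andP[u0 _].
have Nu : N * v.1.1 != 0 by rewrite gt_eqF// mulr_gt0.
have -> : f0 = (1 + al) / N by rewrite -Nf0 mulrAC divff ?mul1r ?gt_eqF.
by field; rewrite !gt_eqF.
Qed.

Lemma gap_ge0 v : 0 <= gap v.
Proof.
have [rv|rv] := boolP (region v); last by rewrite /gap (negbTE rv).
rewrite gapE//; move: rv => /and5P[u0 v0 z0 h _].
by rewrite divr_ge0 ?subr_ge0// mulr_ge0// ltW.
Qed.

(** On the region the new factor is [(1 + Z1 + Z2) / N], hence at least [N^-1]. This keeps
    [gap / (f0 - gap)] bounded. *)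
Lemma gap_ub v : N^-1 <= f0 - gap v \/ gap v = 0.
Proof.
have [rv|rv] := boolP (region v); last by right; rewrite /gap (negbTE rv).
left; rewrite /gap rv opprB addrC subrK; move: rv => /and5P[u0 v0 z0 _ _].
rewrite invfM mulrCA -[leLHS]mulr1 ler_pM2l ?invr_gt0//.
by rewrite ler_pdivlMr// mul1r -addrA lerDl addr_ge0// ltW.
Qed.

Lemma f0_gap_gt0 v : 0 < f0 - gap v.
Proof.
case: (gap_ub v) => [|->]; last by rewrite subr0.
by apply: lt_le_trans; rewrite invr_gt0.
Qed.

Lemma gap_le v : gap v <= f0. Proof. by rewrite -subr_ge0 ltW// f0_gap_gt0. Qed.

Lemma region_u v : region v -> 0 < v.1.1. Proof. by move=> /andP[]. Qed.

Lemma gap_u v : gap v != 0 -> 0 < v.1.1.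
Proof.
by rewrite /gap; case: ifP => [/region_u//|_]; rewrite eqxx.
Qed.

Lemma region_scale (b : R) v : 0 < b ->
  region (b ^+ 2 * v.1.1, b ^+ 2 * v.1.2, b ^+ 2 * v.2) = region v.
Proof.
move=> b0; have b2 : 0 < b ^+ 2 by rewrite exprn_gt0.
rewrite /region /= !pmulr_rgt0// pmulr_rge0// -mulrDr !(mulrCA _ (b ^+ 2)).
by rewrite !ler_pM2l.
Qed.

Lemma gap_scale (b : R) v : 0 < b ->
  gap (b ^+ 2 * v.1.1, b ^+ 2 * v.1.2, b ^+ 2 * v.2) = gap v.
Proof.
move=> b0; rewrite /gap region_scale//; case: ifP => // /region_u u0 /=.
by congr (_ - _); field; rewrite !gt_eqF.
Qed.

(** The region is closed under decreasing the last coordinate, and [gap] is affine and decreasing in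
    it there. This monotonicity feeds Chebyshev's inequality. *)
Lemma gap_noninc u v x y : 0 <= x -> x <= y -> gap (u, v, y) <= gap (u, v, x).
Proof.
move=> x0 xy; have [ry|ry] := boolP (region (u, v, y)); last first.
  by rewrite {1}/gap (negbTE ry) gap_ge0.
move: (ry) => /and5P[/= u0 v0 y0 h1 h2].
have rx : region (u, v, x).
  by apply/and5P; split => //=; apply: le_trans h1; rewrite lerD2l.
rewrite !gapE//= ler_pM2r ?invr_gt0 ?mulr_gt0//; lra.
Qed.

(** A box inside the region: there [v + z < al / 2 < al * u] and [v < be < be * u]. *)
Lemma gap_gt0 u v z : 0 < al -> 0 < be -> 1 < u < 2 ->
  0 < v < Num.min (al / 4) be -> 0 <= z < al / 4 -> 0 < gap (u, v, z).
Proof.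
move=> al0 be0 /andP[u1 u2] /andP[v0]; rewrite lt_min => /andP[v1 v2] /andP[z0 z1].
have u0 : 0 < u by exact: lt_trans u1.
have alu : al < al * u by rewrite ltr_pMr.
have beu : be < be * u by rewrite ltr_pMr.
have ru : region (u, v, z) by apply/and5P; split => //=; lra.
by rewrite gapE//= divr_gt0 ?mulr_gt0//; lra.
Qed.

End gap.

(** * Conditional gains and costs of the improved factor *)

Section conditional_bounds.
Context {R : realType}.
Variables (m1 m2 : nat) (s : seq R) (r : R).
Hypothesis r_ge1 : 1 <= r.
Local Notation condE := (condE m1 m2 s r).
Local Notation n := (m1 + m2 + size s)%N.
Variables (al be f0 N : R).
Hypotheses (N_gt0 : 0 < N) (f0_gt0 : 0 < f0) (Nf0 : N * f0 = 1 + al).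
Local Notation gap := (gap al be f0 N).

Let mgap : measurable_fun [set: R * R * R] gap.
Proof. exact: measurable_gap. Qed.

Let g0 v : 0 <= gap v. Proof. exact: gap_ge0. Qed.

Lemma ugap_ge0 v : 0 <= v.1.1 * gap v.
Proof.
have [->|/gap_u u0] := eqVneq (gap v) 0; first by rewrite mulr0.
by rewrite mulr_ge0// ltW.
Qed.

Let mu1 : measurable_fun [set: R * R * R] (fun v : R * R * R => v.1.1).
Proof. by mfun. Qed.

Lemma measurable_ugap : measurable_fun [set: R * R * R] (fun v => v.1.1 * gap v).
Proof. exact: mfunM. Qed.

Definition ugap (v : R * R * R) : \bar R := (v.1.1 * gap v)%:E.

Lemma condE_fst_le l (b : R -> R) : measurable_fun [set: R] b ->
  (forall u, 0 <= b u) ->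
  (condE l (fun v => (b v.1.1)%:E) <= \int[onR (@chi2_law R m1)]_u (b u)%:E)%E.
Proof.
move=> mb b0.
have mh : measurable_fun [set: R * R * R] (fun v : R * R * R => (b v.1.1)%:E).
  by apply: mfun_EFin; apply: (measurableT_comp mb).
have h0 (v : R * R * R) : (0 <= (b v.1.1)%:E)%E by rewrite lee_fin.
apply: ge0_le_integralT.
- exact: (measurable_condE_u m1 m2 s r l mh h0).
- exact: mfun_EFin.
- by move=> u; apply: integral_ge0 => v _; exact: sqI_ge0.
move=> u; rewrite (eq_integral (fun=> (b u)%:E)); last first.
  by move=> v _; rewrite /= sqI_cst.
rewrite integral_cst// -[leRHS]mule1 lee_wpmul2l ?lee_fin//.
exact: (@sprobability_setT _ _ _ (onR (@chi2_law R m2))).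
Qed.

Lemma condE_ugap_noninc t t' : 0 < t -> t <= t' ->
  (condE (Num.sqrt t') ugap <= condE (Num.sqrt t) ugap)%E.
Proof.
move=> t0 tt'; apply: condE_noninc.
- exact: mfun_EFin measurable_ugap.
- by move=> v; rewrite lee_fin ugap_ge0.
- move=> u v x y x0 xy; rewrite lee_fin /=.
  have [gy|gy] := eqVneq (gap (u, v, y)) 0.
    by rewrite gy mulr0; exact: (ugap_ge0 (u, v, x)).
  by rewrite ler_wpM2l ?gap_noninc//; have /ltW := gap_u gy.
- exact: sqrtr_ge0.
- by rewrite ler_wsqrtr.
Qed.

Lemma condE_ugap_le l :
  (condE l ugap <= f0%:E * \int[onR (@chi2_law R m1)]_u (`|u|)%:E)%E.
Proof.
have ma : measurable_fun [set: R] (fun u : R => `|u|) by exact: measurableT_comp.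
rewrite -ge0_integralTZ//; last 2 first.
- exact: mfun_EFin.
- exact: ltW.
apply: (@le_trans _ _ (condE l (fun v => (f0 * `|v.1.1|)%:E))); last first.
  apply: (@condE_fst_le l (fun u => f0 * `|u|)).
  - by apply: mfunM => //; exact: measurable_cst.
  - by move=> u; rewrite mulr_ge0// ltW.
apply: condE_le => //.
- exact: mfun_EFin measurable_ugap.
- apply: mfun_EFin; apply: mfunM; first exact: measurable_cst.
  exact: (measurableT_comp ma).
- by move=> v; rewrite lee_fin ugap_ge0.
- by move=> v; rewrite lee_fin mulr_ge0// ltW.
move=> u v z u0 v0 z0; rewrite lee_fin /= (gtr0_norm u0) mulrC.
by rewrite ler_wpM2r ?(ltW u0)// gap_le.
Qed.

Lemma chi2_abs_lty : (\int[onR (@chi2_law R m1)]_u (`|u|)%:E < +oo)%E.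
Proof.
have ma : measurable_fun [set: R] (fun u : R => `|u|) by exact: measurableT_comp.
apply: (@chi2_lty _ m1 _ 4 ma) => //.
move=> x x0; rewrite gtr0_norm//; have := expR_ge1Dx (x / 4); lra.
Qed.

Lemma chi2_sqr_lty : (\int[onR (@chi2_law R m1)]_u (u ^+ 2)%:E < +oo)%E.
Proof.
have ma : measurable_fun [set: R] (fun u : R => u ^+ 2) by mfun.
apply: (@chi2_lty _ m1 _ 64 ma (fun x => sqr_ge0 x)) => //.
move=> x x0; have e : expR (x / 4) = expR (x / 8) ^+ 2.
  by rewrite -expRM_natl; congr expR; field.
rewrite e; have h := expR_ge1Dx (x / 8).
have : (x / 8) ^+ 2 <= expR (x / 8) ^+ 2.
  rewrite lerXn2r ?nnegrE ?expR_ge0 ?divr_ge0 ?(ltW x0)//; lra.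
by rewrite expr_div_n; lra.
Qed.

Lemma condE_ugap_lty l : (condE l ugap < +oo)%E.
Proof.
apply: (le_lt_trans (condE_ugap_le l)).
by rewrite lte_mul_pinfty ?lee_fin ?(ltW f0_gt0)//; exact: chi2_abs_lty.
Qed.

(** Since [gap * (2 * f0 - gap) = f0 ^+ 2 - (f0 - gap) ^+ 2], this is the decrease of the quadratic
    term of the squared error loss. *)
Definition gapQ (v : R * R * R) : \bar R :=
  (v.1.1 ^+ 2 * (gap v * (f0 *+ 2 - gap v)))%:E.

Definition gap2 (v : R * R * R) : \bar R := (v.1.1 ^+ 2 * gap v ^+ 2)%:E.

Lemma measurable_gapQ : measurable_fun [set: R * R * R] gapQ.
Proof.
apply: mfun_EFin; apply: mfunM; first by mfun.
apply: mfunM => //; apply: mfunD; first exact: measurable_cst.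
exact: mfunN.
Qed.

Lemma gapQ_ge0 v : (0 <= gapQ v)%E.
Proof.
rewrite lee_fin mulr_ge0 ?sqr_ge0// mulr_ge0// mulr2n -addrA addr_ge0//.
  exact: ltW.
by rewrite subr_ge0 gap_le.
Qed.

Lemma measurable_gap2 : measurable_fun [set: R * R * R] gap2.
Proof. by apply: mfun_EFin; apply: mfunM; [mfun|exact: mfunX]. Qed.

Lemma gap2_ge0 v : (0 <= gap2 v)%E.
Proof. by rewrite lee_fin mulr_ge0 ?sqr_ge0. Qed.

(** On the region [u + v + z = N * u * (f0 - gap)], so the Euler inequality for [u * gap], of degree
    one, reads [E[u ^+ 2 * gap * (f0 - gap)] >= E[u * gap]]. The rest of [gapQ] is the square
    [gap2], kept as the source of strictness. *)
Lemma condE_gapQ l : N = (n + 2)%:R ->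
  (2%:E * condE l ugap + condE l gap2 <= condE l gapQ)%E.
Proof.
move=> NE.
pose h' (v : R * R * R) : \bar R := (v.1.1 * gap v * (v.1.1 + v.1.2 + v.2))%:E.
have h'e v : h' v = ((N * v.1.1 ^+ 2) * (gap v * (f0 - gap v)))%:E.
  rewrite /h'; have [rv|rv] := boolP (region al be v); last first.
    by rewrite /gap (negbTE rv) !(mulr0, mul0r).
  congr EFin; have u0 := region_u rv.
  have -> : f0 - gap v = (v.1.1 + v.1.2 + v.2) / (N * v.1.1).
    by rewrite /gap rv opprB addrC subrK.
  by field; rewrite !gt_eqF.
have h'0 v : (0 <= h' v)%E.
  rewrite h'e lee_fin; apply: mulr_ge0; first by rewrite mulr_ge0 ?sqr_ge0 ?(ltW N_gt0).
  by apply: mulr_ge0 => //; apply: ltW; exact: f0_gap_gt0.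
have mh' : measurable_fun [set: R * R * R] h'.
  by apply: mfun_EFin; apply: mfunM; [exact: measurable_ugap|mfun].
have mug : measurable_fun [set: R * R * R] ugap by exact: mfun_EFin measurable_ugap.
have ug0 v : (0 <= ugap v)%E by rewrite lee_fin ugap_ge0.
have key : (N%:E * condE l ugap <= condE l h')%E.
  rewrite NE (_ : (n + 2)%N = (n + 2 * 1)%N)//.
  apply: (condE_euler r_ge1 mug mh' ug0 h'0); last exact: condE_ugap_lty.
  - move=> b v b0; rewrite /ugap gap_scale// -EFinM; congr EFin.
    by rewrite muln1 mulrA.
  - by move=> u v z _ _ _; rewrite -EFinM.
have N20 : 0 <= 2 / N by rewrite divr_ge0// ltW.
have -> : gapQ = (fun v => (2 / N)%:E * h' v + gap2 v)%E.
  apply/funext => v; rewrite h'e /gap2 /gapQ -EFinM -EFinD; congr EFin.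
  by field; rewrite gt_eqF.
have mk : measurable_fun [set: R * R * R] (fun v => (2 / N)%:E * h' v)%E.
  exact: mfun_emul (measurable_cst _) mh'.
have k0 v : (0 <= (2 / N)%:E * h' v)%E by apply: mule_ge0; rewrite ?lee_fin//; exact: h'0.
rewrite (condED m1 m2 s r l mk measurable_gap2 k0 gap2_ge0).
rewrite (condEZ m1 m2 s r l N20 mh' h'0) leeD2r//.
apply: (@le_trans _ _ ((2 / N)%:E * (N%:E * condE l ugap))%E).
  by rewrite muleA -EFinM divfK// gt_eqF.
by rewrite lee_wpmul2l ?lee_fin.
Qed.

(** The relative gap, scale invariant; it is the linear upper bound of the logarithmic term [gapln],
    because [f0 / (f0 - gap) = 1 + gap / (f0 - gap)]. *)
Definition gapE0 (v : R * R * R) : \bar R := (gap v / (f0 - gap v))%:E.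

Definition gapln (v : R * R * R) : \bar R := (ln f0 - ln (f0 - gap v))%:E.

Lemma measurable_gapE0 : measurable_fun [set: R * R * R] gapE0.
Proof.
apply: mfun_EFin; apply: mfunM => //; apply: mfun_inv.
by apply: mfunD; [exact: measurable_cst|exact: mfunN].
Qed.

Lemma measurable_gapln : measurable_fun [set: R * R * R] gapln.
Proof.
apply: mfun_EFin; apply: mfunD; first exact: measurable_cst.
apply: mfunN; apply: mfun_ln.
by apply: mfunD; [exact: measurable_cst|exact: mfunN].
Qed.

Lemma gapE0_ge0 v : (0 <= gapE0 v)%E.
Proof. by rewrite lee_fin divr_ge0// ltW// f0_gap_gt0. Qed.

Lemma gapln_ge0 v : (0 <= gapln v)%E.
Proof.
rewrite lee_fin subr_ge0 ler_ln ?posrE// ?f0_gap_gt0//.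
by rewrite gerBl.
Qed.

Lemma gapln_le v : (gapln v <= gapE0 v)%E.
Proof.
have fg := @f0_gap_gt0 _ al be _ _ N_gt0 f0_gt0 v; rewrite lee_fin.
have x0 : 0 <= gap v / (f0 - gap v) by rewrite divr_ge0// ltW.
have e : ln f0 = ln (f0 - gap v) + ln (1 + gap v / (f0 - gap v)).
  rewrite -lnM ?posrE// ?ltr_wpDr//; congr ln.
  by field; rewrite gt_eqF.
rewrite e addrC addKr; apply: le_ln1Dx; exact: lt_le_trans x0.
Qed.

Lemma gapE0_ub v : (gapE0 v <= (f0 * N)%:E)%E.
Proof.
have fg := @f0_gap_gt0 _ al be _ _ N_gt0 f0_gt0 v.
rewrite lee_fin; case: (@gap_ub _ al be f0 N N_gt0 v) => [h|->].
  apply: ler_pM => //; first by rewrite invr_ge0 ltW.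
    exact: gap_le.
  by rewrite -[leRHS]invrK lef_pV2 ?posrE ?invr_gt0.
by rewrite mul0r mulr_ge0// ltW.
Qed.

Lemma condE_gapE0_lty l : (condE l gapE0 < +oo)%E.
Proof.
have c0 : 0 <= f0 * N by rewrite mulr_ge0// ltW.
apply: (@le_lt_trans _ _ (condE l (fun v => (f0 * N)%:E))).
  apply: (condE_le m1 m2 s r_ge1 l measurable_gapE0 (measurable_cst _) gapE0_ge0).
    by move=> v; rewrite lee_fin.
  by move=> u v z _ _ _; exact: gapE0_ub.
apply: (le_lt_trans (@condE_fst_le l (fun=> f0 * N) (measurable_cst _) (fun=> c0))).
rewrite integral_cst//; apply: (@le_lt_trans _ _ ((f0 * N)%:E * 1)%E).
  rewrite lee_wpmul2l ?lee_fin//.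
  exact: (@sprobability_setT _ _ _ (onR (@chi2_law R m1))).
by rewrite mule1 ltry.
Qed.

(** The Euler inequality in degree zero gives [N * E[u * gap] >= n * E[gapE0]], and [n = N + 4]
    leaves the surplus [4 / N]. *)
Lemma condE_gapE0 l : N = n%:R - 4 ->
  (condE l gapE0 + (4 / N)%:E * condE l gapE0 <= condE l ugap)%E.
Proof.
move=> NE.
have mug : measurable_fun [set: R * R * R] ugap by exact: mfun_EFin measurable_ugap.
have ug0 v : (0 <= ugap v)%E by rewrite lee_fin ugap_ge0.
have mk : measurable_fun [set: R * R * R] (fun v => N%:E * ugap v)%E.
  exact: mfun_emul (measurable_cst _) mug.
have k0 v : (0 <= N%:E * ugap v)%E by apply: mule_ge0 => //; rewrite lee_fin ltW.
have key : (n%:R%:E * condE l gapE0 <= condE l (fun v => N%:E * ugap v))%E.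
  have e0 : n = (n + 2 * 0)%N by rewrite muln0 addn0.
  rewrite e0.
  apply: (condE_euler r_ge1 measurable_gapE0 mk gapE0_ge0 k0).
  - by move=> b v b0; rewrite /gapE0 gap_scale// muln0 expr0 mul1e.
  - move=> u v z u0 v0 z0; rewrite /gapE0 /ugap -!EFinM lee_fin /=.
    have [rv|rv] := boolP (region al be (u, v, z)); last first.
      by rewrite /gap (negbTE rv) !(mul0r, mulr0).
    have -> : f0 - gap (u, v, z) = (u + v + z) / (N * u).
      by rewrite /gap rv opprB addrC subrK.
    rewrite le_eqVlt; apply/orP; left; apply/eqP.
    by field; rewrite !gt_eqF// ltr_wpDr// addr_gt0.
  - exact: condE_gapE0_lty.
rewrite (condEZ m1 m2 s r l (ltW N_gt0) mug ug0) in key.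
have X0 := condE_ge0 m1 m2 s r l gapE0_ge0.
have Xf : condE l gapE0 \is a fin_num by rewrite (ge0_fin_numE X0) condE_gapE0_lty.
have Y0 := condE_ge0 m1 m2 s r l ug0.
have Yf : condE l ugap \is a fin_num by rewrite (ge0_fin_numE Y0) condE_ugap_lty.
move: key; rewrite -(fineK Xf) -(fineK Yf) -!EFinM -EFinD !lee_fin.
move: (fine _) (fine _) => x y h.
rewrite -(ler_pM2l N_gt0) mulrDr mulrA (mulrCA N) divff ?gt_eqF//.
by rewrite mulr1; apply: le_trans h; rewrite NE; lra.
Qed.

Hypotheses (al_gt0 : 0 < al) (be_gt0 : 0 < be).
Hypotheses (m1T : chi2_law m1 [set: R] = 1%E) (m2T : chi2_law m2 [set: R] = 1%E).

Let condE_pos l (h : R * R * R -> \bar R) : measurable_fun [set: R * R * R] h ->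
  (forall v, 0 <= h v)%E -> (forall v, 0 < v.1.1 -> 0 < gap v -> (0 < h v)%E) ->
  (0 < condE l h)%E.
Proof.
move=> mh h0 hp.
apply: (@condE_gt0 _ _ _ _ _ r_ge1 l h 1 2 (Num.min (al / 4) be) (al / 4)) => //.
- lra.
- by rewrite lt_min be_gt0 divr_gt0.
- by rewrite divr_gt0.
move=> u v z hu hv hz; apply: hp; last exact: gap_gt0.
by move: hu => /andP[u1 _]; exact: lt_trans u1.
Qed.

Lemma condE_gap2_gt0 l : (0 < condE l gap2)%E.
Proof.
apply: condE_pos; [exact: measurable_gap2|exact: gap2_ge0|move=> v u0 gv].
by rewrite lte_fin mulr_gt0 ?exprn_gt0.
Qed.

Lemma condE_gapE0_gt0 l : (0 < condE l gapE0)%E.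
Proof.
apply: condE_pos; [exact: measurable_gapE0|exact: gapE0_ge0|move=> v u0 gv].
by rewrite lte_fin divr_gt0// f0_gap_gt0.
Qed.

End conditional_bounds.

(** The identity [L0 - L1 = A - B] is stated with sums, so that infinite integrals are allowed. The
    strict conclusion requires a finite integral of [L0]; otherwise both sides could be infinite. *)
Lemma integral_compare d (T : measurableType d) (R : realType)
    (mu : {measure set T -> \bar R}) (L0 L1 A B : T -> \bar R) :
  measurable_fun setT L0 -> measurable_fun setT L1 ->
  measurable_fun setT A -> measurable_fun setT B ->
  (forall x, 0 <= L0 x)%E -> (forall x, 0 <= L1 x)%E ->
  (forall x, 0 <= A x)%E -> (forall x, 0 <= B x)%E ->
  (forall x, L1 x + A x = L0 x + B x)%E ->
  (\int[mu]_x B x <= \int[mu]_x A x)%E -> (\int[mu]_x B x < +oo)%E ->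
  (\int[mu]_x L1 x <= \int[mu]_x L0 x)%E /\
  ((\int[mu]_x B x < \int[mu]_x A x)%E -> (\int[mu]_x L0 x < +oo)%E ->
   (\int[mu]_x L1 x < \int[mu]_x L0 x)%E).
Proof.
move=> mL0 mL1 mA mB L00 L10 A0 B0 LAB.
have : (\int[mu]_x L1 x + \int[mu]_x A x = \int[mu]_x L0 x + \int[mu]_x B x)%E.
  rewrite (ge0_integralTD mu mL1 mA L10 A0) (ge0_integralTD mu mL0 mB L00 B0).
  by apply: eq_integral => x _; exact: LAB.
have i0 : (0 <= \int[mu]_x L0 x)%E by apply: integral_ge0.
have i1 : (0 <= \int[mu]_x L1 x)%E by apply: integral_ge0.
have iA : (0 <= \int[mu]_x A x)%E by apply: integral_ge0.
have iB : (0 <= \int[mu]_x B x)%E by apply: integral_ge0.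
move: (\int[mu]_x L0 x)%E (\int[mu]_x L1 x)%E (\int[mu]_x A x)%E
  (\int[mu]_x B x)%E i0 i1 iA iB.
move=> [l0| |] [l1| |] [a| |] [b| |] //= _ _ _ _ E; rewrite ?leey ?lte_fin ?lee_fin//;
  move: E => //= -[E] ba _; split => //; lra.
Qed.

Lemma region_ratio {R : realType} (al be k a b n : R) :
  0 < k -> 0 < a -> 0 < b -> 0 <= n ->
  region al be (k * a, k * b, k * n) =
  (0 <= n / a <= al - b / a) && (0 <= b / a <= be).
Proof.
move=> k0 a0 b0 n0; rewrite /region /= !mulr_gt0// mulr_ge0 ?(ltW k0)//=.
rewrite !divr_ge0 ?(ltW a0) ?(ltW b0)//= -mulrDr !(mulrCA _ k) !ler_pM2l//.
rewrite lerBrDr -mulrDl ler_pdivrMr// ler_pdivrMr// (addrC n).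
by [].
Qed.

Lemma gap_ratio {R : realType} (al be f0 N k a b n : R) :
  0 < k -> 0 < a -> 0 < N -> region al be (k * a, k * b, k * n) ->
  f0 - gap al be f0 N (k * a, k * b, k * n) = (1 + b / a + n / a) / N.
Proof.
move=> k0 a0 N0 rv; rewrite /gap rv opprB addrC subrK /=.
by field; rewrite !gt_eqF.
Qed.

Lemma measurable_sqnorm {R : realType} (p : nat) :
  measurable_fun [set: p.-tuple R] (@sqnorm R p).
Proof.
by apply: measurable_sum => i; apply: mfunX; exact: measurable_tnth.
Qed.

Lemma sqnorm_ge0 {R : realType} (p : nat) (x : p.-tuple R) : 0 <= sqnorm x.
Proof. by apply: sumr_ge0 => i _; exact: sqr_ge0. Qed.

(** * Inverse moments of the mixing law *)

Section inverse_moments.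
Context {R : realType} (Pi : probability R R).
Hypothesis Pi_pos : Pi [set t | 0 < t] = 1%E.

(** Truncation makes the weight nonnegative everywhere and zero for [t <= 0], as [mixture_integral]
    and [chebyshev_inv] require; it changes nothing almost surely for [Pi]. *)
Definition ipow (k : nat) (t : R) : R := if 0 < t then t ^- k else 0.

Lemma measurable_ipow k : measurable_fun [set: R] (ipow k).
Proof. by apply: measurable_fun_gt0; mfun. Qed.

Lemma ipow_ge0 k t : 0 <= ipow k t.
Proof. by rewrite /ipow; case: ifP => // t0; rewrite invr_ge0 exprn_ge0// ltW. Qed.

Lemma ipow_gt0 k t : 0 < t -> 0 < ipow k t.
Proof. by move=> t0; rewrite /ipow t0 invr_gt0 exprn_gt0. Qed.

Lemma ipow_npos k t : t <= 0 -> ipow k t = 0.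
Proof. by rewrite /ipow ltNge => ->. Qed.

Lemma ipowS k t : ipow k t / t = ipow k.+1 t.
Proof.
by rewrite /ipow; case: ifP => _; rewrite ?mul0r// exprS invfM mulrC.
Qed.

Lemma integral_ipow k : Pi.-integrable setT (fun t => (t ^- k)%:E) ->
  (\int[Pi]_t (ipow k t)%:E = (inv_moment Pi k)%:E)%E.
Proof.
move=> ik; rewrite /inv_moment /Rintegral fineK; last exact: integrable_fin_num.
have mi : measurable_fun [set: R] (fun t => (ipow k t)%:E).
  by apply: mfun_EFin; exact: measurable_ipow.
apply: ae_eq_integral; first exact: measurableT.
- exact: mi.
- exact: measurable_int ik.
- have mpos : measurable [set t : R | 0 < t].
    by apply: (measurable_bool_set (b := fun t : R => 0 < t)); mfun.
  exists (~` [set t | 0 < t]); split.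
  + exact: measurableC.
  + have e : Pi (~` [set t | 0 < t]) = 0%E by rewrite probability_setC// Pi_pos subee.
    exact: e.
  + by move=> t /= h t0; apply: h => _; rewrite /ipow t0.
Qed.

Lemma integral_pos_gt0 (f : R -> \bar R) : measurable_fun setT f ->
  (forall t, 0 <= f t)%E -> (forall t, 0 < t -> (0 < f t)%E) ->
  (0 < \int[Pi]_t f t)%E.
Proof.
move=> mf f0 fp; apply: (@integral_gt0 _ _ _ Pi [set t | 0 < t]) => //.
  by apply: (measurable_bool_set (b := fun t : R => 0 < t)); mfun.
have e : (0 < Pi [set t | (0 < t)%R])%E by rewrite Pi_pos.
exact: e.
Qed.

Lemma inv_moment_gt0 k : Pi.-integrable setT (fun t => (t ^- k)%:E) ->
  0 < inv_moment Pi k.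
Proof.
move=> ik; rewrite -lte_fin -integral_ipow//; apply: integral_pos_gt0.
- by apply: mfun_EFin; exact: measurable_ipow.
- by move=> t; rewrite lee_fin ipow_ge0.
- by move=> t t0; rewrite lte_fin ipow_gt0.
Qed.

Lemma integral_ipow0 : (\int[Pi]_t (ipow 0 t)%:E = 1)%E.
Proof.
have i0 : Pi.-integrable setT (fun t => (t ^- 0)%:E).
  apply: (eq_integrable measurableT (fun=> 1%E)).
    by move=> t _; rewrite expr0 invr1.
  by apply: finite_measure_integrable_cst.
rewrite integral_ipow// /inv_moment; congr EFin.
rewrite /Rintegral (eq_integral (fun=> 1%E)) ?integral_cst//=.
  by rewrite mul1e probability_setT.
by move=> t _; rewrite expr0 invr1.
Qed.

Lemma integrable_inv1 : Pi.-integrable setT (fun t => (t ^- 2)%:E) ->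
  Pi.-integrable setT (fun t => (t ^- 1)%:E).
Proof.
move=> i2; apply: (@le_integrable _ _ _ Pi setT measurableT _
  (fun t => 1 + (t ^- 2)%:E)%E) => //.
- by mfun.
- move=> t _; rewrite -EFinD lee_fin expr1 [leRHS]ger0_norm; last first.
    by rewrite addr_ge0// invr_ge0 sqr_ge0.
  have -> : t ^- 2 = `|t^-1| ^+ 2 by rewrite real_normK ?num_real// exprVn.
  have := sqr_ge0 (`|t^-1| - 1); move: (`|t^-1|) => y; nra.
- by apply: integrableD => //; apply: finite_measure_integrable_cst.
Qed.

End inverse_moments.

Lemma lte_gap_combine {R : realType} (c : R) (X Y Z : \bar R) : 0 < c ->
  X \is a fin_num -> (0 < Z)%E -> (X <= c%:E * Y)%E ->
  ((2 * c)%:E * X < (2 * c ^+ 2)%:E * Y + (c ^+ 2)%:E * Z)%E.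
Proof.
move=> c0 Xf Z0 XY.
apply: (@lt_le_trans _ _ ((2 * c)%:E * X + (c ^+ 2)%:E * Z)%E).
  by rewrite lteDl ?fin_numM// mule_gt0// lte_fin exprn_gt0.
rewrite leeD2r// (_ : 2 * c ^+ 2 = 2 * c * c); last by ring.
by rewrite [in leRHS]EFinM -muleA lee_wpmul2l// lee_fin mulr_ge0// ltW.
Qed.

(** * Comparison of the two risks at a fixed parameter *)

Section mixture_risk.
Context {R : realType} {p q m1 m2 : nat} (Pi : probability R R).
Hypothesis Pi_pos : Pi [set t | 0 < t] = 1%E.
Context d (T : measurableType d) (P : probability T R) (w : param R p q).
Hypothesis w_ord : ordered_param w.
Variables (tau : {mfun T >-> R}) (X1 : {mfun T >-> p.-tuple R})
  (S1 : {mfun T >-> R}) (X2 : {mfun T >-> q.-tuple R}) (S2 : {mfun T >-> R}).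
Hypothesis model : scale_mixture_model m1 m2 Pi P w tau X1 S1 X2 S2.

Let s1 := sigma1 w.
Let s2 := sigma2 w.
Let s := [seq a / s1 | a <- theta1 w].
Let r := (s2 / s1) ^+ 2.
Let s1_gt0 : 0 < s1. Proof. by case: w_ord. Qed.
Let s12_gt0 : 0 < s1 ^+ 2. Proof. by rewrite exprn_gt0. Qed.
Let size_s : size s = p. Proof. by rewrite size_map size_tuple. Qed.
Let r_ge1 : 1 <= r.
Proof.
by rewrite exprn_ege1// ler_pdivlMr// mul1r; case: w_ord.
Qed.
Local Notation E := (condE m1 m2 s r).
Let m1T : chi2_law m1 [set: R] = 1%E. Proof. exact: chi2_mass1 model. Qed.
Let m2T : chi2_law m2 [set: R] = 1%E. Proof. exact: chi2_mass2 model. Qed.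

(* the observation in units of sigma1^2 / tau *)
Let std x := (tau x / s1 ^+ 2 * S1 x, tau x / s1 ^+ 2 * S2 x,
  tau x / s1 ^+ 2 * sqnorm (X1 x)).

Let mtau : measurable_fun [set: T] tau. Proof. exact: measurable_funPT. Qed.
Let mS1 : measurable_fun [set: T] S1. Proof. exact: measurable_funPT. Qed.
Let mS2 : measurable_fun [set: T] S2. Proof. exact: measurable_funPT. Qed.
Let mN : measurable_fun [set: T] (fun x => sqnorm (X1 x)).
Proof.
by apply: (measurableT_comp (@measurable_sqnorm R p)); exact: measurable_funPT.
Qed.

Let mstd : measurable_fun [set: T] std.
Proof.
have mk : measurable_fun [set: T] (fun x => tau x / s1 ^+ 2).
  by apply: mfunM => //; exact: measurable_cst.
by apply: mfun_pair; [apply: mfun_pair|]; exact: mfunM.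
Qed.

Let mprod (aw : R -> R) (h : R * R * R -> \bar R) :
  measurable_fun setT aw -> measurable_fun setT h ->
  measurable_fun [set: T] (fun x => (aw (tau x))%:E * h (std x))%E.
Proof.
move=> maw mh; apply: mfun_emul; last exact: (measurableT_comp mh).
by apply: mfun_EFin; exact: (measurableT_comp maw).
Qed.

Let mcond (h : R * R * R -> \bar R) : measurable_fun setT h ->
  (forall v, 0 <= h v)%E -> measurable_fun [set: R] (fun t => E (Num.sqrt t) h).
Proof.
move=> mh h0.
have mh' : measurable_fun [set: R * R * R * R] (fun v => h (v.1.1.2, v.1.2, v.2)).
  by apply: (measurableT_comp mh); mfun.
have msq : measurable_fun [set: R] (fun t => Num.sqrt t) by apply: mfun_sqrt; mfun.
have [_ _ H] := measurable_condE m1 m2 s r msq mh' (fun v => h0 _).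
rewrite (_ : (fun t => _) = fun x => E (Num.sqrt x) (fun v => h (v.1.1, v.1.2, v.2)))//.
Qed.

Let mcond_prod (aw : R -> R) (h : R * R * R -> \bar R) : measurable_fun setT aw ->
  measurable_fun setT h -> (forall v, 0 <= h v)%E ->
  measurable_fun [set: R] (fun t => (aw t)%:E * E (Num.sqrt t) h)%E.
Proof.
by move=> maw mh h0; apply: mfun_emul; [exact: mfun_EFin|exact: mcond].
Qed.

(** For a weight in [tau] times a function of the standardized observation, the unit [s1 ^+ 2 / t]
    cancels, so [t] enters the conditional expectation only through the centers of the normals. *)
Let E_prod (aw : R -> R) (h : R * R * R -> \bar R) :
  measurable_fun setT aw -> (forall t, 0 <= aw t) -> (forall t, t <= 0 -> aw t = 0) ->
  measurable_fun setT h -> (forall v, 0 <= h v)%E ->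
  (\int[P]_x ((aw (tau x))%:E * h (std x)) =
   \int[Pi]_t ((aw t)%:E * E (Num.sqrt t) h))%E.
Proof.
move=> maw aw0 awn mh h0.
pose f (v : R * R * R * R) := ((aw v.1.1.1)%:E * h (v.1.1.1 / s1 ^+ 2 * v.1.1.2,
  v.1.1.1 / s1 ^+ 2 * v.1.2, v.1.1.1 / s1 ^+ 2 * v.2)%R)%E.
have mf : measurable_fun setT f.
  apply: mfun_emul; last by apply: (measurableT_comp mh); mfun.
  by apply: mfun_EFin; apply: (measurableT_comp maw); mfun.
have f0 v : (0 <= f v)%E by rewrite mule_ge0 ?lee_fin.
have fneg v : v.1.1.1 <= 0 -> f v = 0%E by move=> v0; rewrite /f awn// mul0e.
have := mixture_integral Pi_pos w_ord model mf f0 fneg.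
move=> h1; apply: (etrans h1); apply: eq_integral => t _.
have mh2 : measurable_fun [set: R * R * R] (fun v => h
    (t / s1 ^+ 2 * (s1 ^+ 2 / t * v.1.1), t / s1 ^+ 2 * (s1 ^+ 2 / t * v.1.2),
     t / s1 ^+ 2 * (s1 ^+ 2 / t * v.2))).
  by apply: (measurableT_comp mh); mfun.
rewrite [LHS](condEZ m1 m2 s r (Num.sqrt t) (aw0 t) mh2 (fun v => h0 _)).
have [t0|t0] := leP t 0; first by rewrite awn// !mul0e.
congr (_ * E _ _)%E; apply/funext => -[[u v] z] /=.
by congr (h (_, _, _)); field; rewrite !gt_eqF.
Qed.

Let E_fst_lty (aw : R -> R) (b : R -> R) :
  measurable_fun setT aw -> (forall t, 0 <= aw t) -> (forall t, t <= 0 -> aw t = 0) ->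
  measurable_fun setT b -> (forall u, 0 <= b u) ->
  (\int[Pi]_t (aw t)%:E < +oo)%E -> (\int[onR (@chi2_law R m1)]_u (b u)%:E < +oo)%E ->
  (\int[P]_x ((aw (tau x))%:E * (b (std x).1.1)%:E) < +oo)%E.
Proof.
move=> maw aw0 awn mb b0 awfin bfin.
have mh : measurable_fun [set: R * R * R] (fun v : R * R * R => (b v.1.1)%:E).
  by apply: mfun_EFin; apply: (measurableT_comp mb); mfun.
have h0 (v : R * R * R) : (0 <= (b v.1.1)%:E)%E by rewrite lee_fin.
rewrite (E_prod maw aw0 awn mh h0).
set I := (\int[onR (@chi2_law R m1)]_u (b u)%:E)%E in bfin *.
have I0 : (0 <= I)%E by apply: integral_ge0 => u _; rewrite lee_fin.
have If : I \is a fin_num by rewrite (ge0_fin_numE I0).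
have mawE : measurable_fun [set: R] (fun t => (aw t)%:E) by exact: mfun_EFin.
apply: (@le_lt_trans _ _ (\int[Pi]_t ((fine I)%:E * (aw t)%:E))%E).
  apply: ge0_le_integralT.
  - exact: mcond_prod.
  - exact: mfun_emul (measurable_cst _) mawE.
  - by move=> t; rewrite mule_ge0 ?lee_fin// condE_ge0.
  move=> t; rewrite muleC lee_wpmul2r ?lee_fin// fineK//.
  exact: condE_fst_le.
rewrite (ge0_integralTZ Pi mawE _ (fine_ge0 I0)); last by move=> t; rewrite lee_fin.
by rewrite lte_mul_pinfty ?lee_fin ?fine_ge0.
Qed.

Let good x := (0 < tau x) && ((0 < S1 x) && (0 < S2 x)).
Let mgood : measurable_fun [set: T] good.
Proof. by rewrite /good; mfun. Qed.

(** The loss is reset to [0] off an almost sure event, so that the identities between integrands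
    hold at every point. *)
Let risk_good (L : T -> R) : measurable_fun [set: T] L ->
  (\int[P]_x (L x)%:E = \int[P]_x (if good x then L x else 0)%:E)%E.
Proof.
move=> mL; apply: ae_eq_integral; first exact: measurableT.
- exact: mfun_EFin.
- by apply: mfun_EFin; apply: mfun_if => //; exact: measurable_cst.
have := mixture_ae_pos Pi_pos w_ord model.
apply: filterS => x [a b c] _.
by rewrite /good a b c.
Qed.

Lemma mixture_eq_integral (f g : T -> R) : measurable_fun [set: T] f ->
  measurable_fun [set: T] g ->
  (forall x, 0 < tau x -> 0 < S1 x -> 0 < S2 x -> f x = g x) ->
  (\int[P]_x (f x)%:E = \int[P]_x (g x)%:E)%E.
Proof.
move=> mf mg fg; rewrite (risk_good mf) (risk_good mg).
by apply: eq_integral => x _; case: ifP => // /and3P[? ? ?]; rewrite fg.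
Qed.

Let std_good x : good x -> (std x).1.1 / tau x = S1 x / s1 ^+ 2.
Proof.
move=> /and3P[t0 _ _] /=; field; rewrite !gt_eqF//.
Qed.

Let std_u_gt0 x : good x -> 0 < (std x).1.1.
Proof. by move=> /and3P[t0 S10 _] /=; rewrite mulr_gt0// divr_gt0. Qed.

Section factor.
Variables (al be f0 N : R).
Hypotheses (N_gt0 : 0 < N) (f0_gt0 : 0 < f0) (Nf0 : N * f0 = 1 + al).
Local Notation gap := (gap al be f0 N).

Let mgapstd : measurable_fun [set: T] (fun x => gap (std x)).
Proof. by apply: (measurableT_comp (measurable_gap al be f0 N)). Qed.

Let gap_good x : ~~ good x -> 0 < tau x -> gap (std x) = 0.
Proof.
rewrite /good => + t0; rewrite t0 /= => ng; have k0 : 0 < tau x / s1 ^+ 2 by rewrite divr_gt0.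
rewrite /gap ifF//; apply/negbTE; apply: contra ng => /and5P[/= a b _ _ _].
by move: a b; rewrite !(pmulr_rgt0 _ k0) => -> ->.
Qed.

Section squared_error.
Variable c : R.
Hypotheses (c_gt0 : 0 < c) (NE : N = (m1 + m2 + p + 2)%:R).
Hypothesis i2 : Pi.-integrable setT (fun t => (t ^- 2)%:E).
Hypothesis cE : c = inv_moment Pi 1 / inv_moment Pi 2.
Hypotheses (al_gt0 : 0 < al) (be_gt0 : 0 < be).

Let i1 : Pi.-integrable setT (fun t => (t ^- 1)%:E).
Proof. exact: integrable_inv1. Qed.

Lemma sq_risk_lt :
  (\int[P]_x ((c * (f0 - gap (std x)) * (S1 x / s1 ^+ 2) - 1) ^+ 2)%:E <
   \int[P]_x ((c * f0 * (S1 x / s1 ^+ 2) - 1) ^+ 2)%:E)%E.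
Proof.
have mW : measurable_fun [set: T] (fun x => S1 x / s1 ^+ 2).
  by apply: mfunM => //; exact: measurable_cst.
pose l1 x := (c * (f0 - gap (std x)) * (S1 x / s1 ^+ 2) - 1) ^+ 2.
pose l0 x := (c * f0 * (S1 x / s1 ^+ 2) - 1) ^+ 2.
have mfg : measurable_fun [set: T] (fun x => f0 - gap (std x)).
  by apply: mfunD; [exact: measurable_cst|exact: mfunN].
have ml1 : measurable_fun [set: T] l1.
  apply: mfunX; apply: mfunD; last exact: measurable_cst.
  by apply: mfunM => //; apply: mfunM => //; exact: measurable_cst.
have ml0 : measurable_fun [set: T] l0.
  apply: mfunX; apply: mfunD; last exact: measurable_cst.
  by apply: mfunM => //; exact: measurable_cst.
rewrite (risk_good ml1) (risk_good ml0).
(* With [S1 / s1 ^+ 2 = u / tau], the linear term of the loss brings a weight of order [1 / tau] and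
   the quadratic one a weight of order [1 / tau ^+ 2]. *)
pose aB t := 2 * c * ipow 1 t; pose aA t := c ^+ 2 * ipow 2 t.
have maB : measurable_fun [set: R] aB.
  by apply: mfunM; [exact: measurable_cst|exact: measurable_ipow].
have maA : measurable_fun [set: R] aA.
  by apply: mfunM; [exact: measurable_cst|exact: measurable_ipow].
have c2_ge0 : 0 <= c ^+ 2 by exact: sqr_ge0.
have tc_ge0 : 0 <= 2 * c by rewrite mulr_ge0// ltW.
have aB0 t : 0 <= aB t by rewrite mulr_ge0// ipow_ge0.
have aA0 t : 0 <= aA t by rewrite mulr_ge0// ipow_ge0.
have aBn t : t <= 0 -> aB t = 0 by move=> t0; rewrite /aB ipow_npos// mulr0.
have aAn t : t <= 0 -> aA t = 0 by move=> t0; rewrite /aA ipow_npos// mulr0.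
pose hB := ugap al be f0 N; pose hA := gapQ al be f0 N; pose h2 := gap2 al be f0 N.
have mhB : measurable_fun setT hB by exact: mfun_EFin (measurable_ugap al be f0 N).
have hB0 v : (0 <= hB v)%E by rewrite lee_fin ugap_ge0.
have mhA : measurable_fun setT hA by exact: measurable_gapQ.
have hA0 v : (0 <= hA v)%E by exact: gapQ_ge0.
have mh2 : measurable_fun setT h2 by exact: measurable_gap2.
have h20 v : (0 <= h2 v)%E by exact: gap2_ge0.
pose G t := E (Num.sqrt t) hB.
have mG : measurable_fun [set: R] G by exact: mcond.
have G0 t : (0 <= G t)%E by exact: condE_ge0.
have Gfin t : (G t < +oo)%E by exact: condE_ugap_lty.
pose X := (\int[Pi]_t ((ipow 1 t)%:E * G t))%E.
pose Y := (\int[Pi]_t ((ipow 2 t)%:E * G t))%E.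
pose Z := (\int[Pi]_t ((ipow 2 t)%:E * E (Num.sqrt t) h2))%E.
have mip k : measurable_fun [set: R] (fun t => (ipow k t)%:E : \bar R).
  by apply: mfun_EFin; exact: measurable_ipow.
have ip0 k t : (0 <= (ipow k t)%:E :> \bar R)%E by rewrite lee_fin ipow_ge0.
have mX k : measurable_fun [set: R] (fun t => (ipow k t)%:E * G t)%E.
  exact: mfun_emul.
have mZ : measurable_fun [set: R] (fun t => (ipow 2 t)%:E * E (Num.sqrt t) h2)%E.
  exact: mfun_emul (mip 2%N) (mcond mh2 h20).
have X0' k t : (0 <= (ipow k t)%:E * G t)%E by rewrite mule_ge0.
have Z0' t : (0 <= (ipow 2 t)%:E * E (Num.sqrt t) h2)%E.
  by rewrite mule_ge0// condE_ge0.
(* Chebyshev's inequality with weight [1 / t]: the masses involved are the inverse moments of orders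
   one and two, whose ratio is the factor [c] of the estimators. *)
have XY : (X <= c%:E * Y)%E.
  rewrite cE /Y.
  have -> : (fun t => (ipow 2 t)%:E * G t)%E = (fun t => (ipow 1 t / t)%:E * G t)%E.
    by apply/funext => t; rewrite ipowS.
  have Gd t t' : 0 < t -> t <= t' -> (G t' <= G t)%E.
    by move=> t0 tt'; exact: condE_ugap_noninc.
  have j2 : (\int[Pi]_t (ipow 1 t / t)%:E = (inv_moment Pi 2)%:E)%E.
    by under eq_integral do rewrite ipowS; exact: integral_ipow.
  exact: (chebyshev_inv (measurable_ipow 1) mG (ipow_ge0 1) (@ipow_npos _ 1)
    G0 Gfin Gd (integral_ipow Pi_pos i1) j2 (inv_moment_gt0 Pi_pos i1)
    (inv_moment_gt0 Pi_pos i2)).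
have Z_gt0 : (0 < Z)%E.
  apply: (integral_pos_gt0 Pi_pos mZ Z0') => t t0.
  by rewrite mule_gt0 ?lte_fin ?ipow_gt0//; exact: condE_gap2_gt0.
have X_ge0 : (0 <= X)%E by apply: integral_ge0.
have X_fin : (X < +oo)%E.
  set I := (\int[onR (@chi2_law R m1)]_u (`|u|)%:E)%E.
  have I0 : (0 <= I)%E by apply: integral_ge0 => u _; rewrite lee_fin.
  have If : I \is a fin_num by rewrite (ge0_fin_numE I0); exact: chi2_abs_lty.
  have k0 : 0 <= f0 * fine I by rewrite mulr_ge0 ?fine_ge0// ltW.
  apply: (@le_lt_trans _ _ (\int[Pi]_t ((f0 * fine I)%:E * (ipow 1 t)%:E))%E).
    apply: (ge0_le_integralT Pi (mX 1%N)
      (mfun_emul (measurable_cst _) (mip 1%N)) (X0' 1%N)).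
    move=> t; rewrite /= muleC; apply: lee_wpmul2r; first exact: ip0.
    by rewrite EFinM (fineK If); exact: condE_ugap_le.
  by rewrite (ge0_integralTZ Pi (mip 1%N) (ip0 1%N) k0) integral_ipow// -EFinM ltry.
have Xf : X \is a fin_num by rewrite (ge0_fin_numE X_ge0).
have BE : (\int[P]_x ((aB (tau x))%:E * hB (std x)) = (2 * c)%:E * X)%E.
  rewrite (E_prod maB aB0 aBn mhB hB0).
  rewrite -(ge0_integralTZ Pi (mX 1%N) (X0' 1%N) tc_ge0).
  by apply: eq_integral => t _; rewrite /aB EFinM muleA.
have AE : ((2 * c ^+ 2)%:E * Y + (c ^+ 2)%:E * Z <=
    \int[P]_x ((aA (tau x))%:E * hA (std x)))%E.
  have t2 : 0 <= 2 * c ^+ 2 by rewrite mulr_ge0.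
  rewrite (E_prod maA aA0 aAn mhA hA0).
  rewrite -(ge0_integralTZ Pi (mX 2%N) (X0' 2%N) t2).
  have xx t : (0 <= (2 * c ^+ 2)%:E * ((ipow 2 t)%:E * G t))%E.
    by apply: mule_ge0; [rewrite lee_fin|exact: X0'].
  have zz t : (0 <= (c ^+ 2)%:E * ((ipow 2 t)%:E * E (Num.sqrt t) h2))%E.
    by apply: mule_ge0; [rewrite lee_fin|exact: Z0'].
  have mxx := mfun_emul (measurable_cst (2 * c ^+ 2)%:E) (mX 2%N).
  have mzz := mfun_emul (measurable_cst (c ^+ 2)%:E) mZ.
  rewrite -(ge0_integralTZ Pi mZ Z0' c2_ge0) (ge0_integralTD Pi mxx mzz xx zz).
  apply: (ge0_le_integralT Pi (mfun_eadd mxx mzz) (mcond_prod maA mhA hA0)).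
    by move=> t; exact: adde_ge0.
  move=> t.
  apply: (@le_trans _ _ ((aA t)%:E * (2%:E * G t + E (Num.sqrt t) h2))%E); last first.
    rewrite lee_wpmul2l ?lee_fin//; apply: condE_gapQ => //.
    by rewrite size_s.
  have g20 : (0 <= 2%:E * G t)%E by apply: mule_ge0; [rewrite lee_fin|exact: G0].
  have e20 := condE_ge0 m1 m2 s r (Num.sqrt t) h20.
  have e : ((2 * c ^+ 2)%:E * ((ipow 2 t)%:E * G t) +
      (c ^+ 2)%:E * ((ipow 2 t)%:E * E (Num.sqrt t) h2) =
      (aA t)%:E * (2%:E * G t) + (aA t)%:E * E (Num.sqrt t) h2)%E.
    by rewrite !muleA -!EFinM; congr (_ * _ + _ * _)%E; congr EFin; rewrite /aA; ring.
  by rewrite (ge0_muleDr _ g20 e20) -e; exact: lexx.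
have BA : (\int[P]_x ((aB (tau x))%:E * hB (std x)) <
    \int[P]_x ((aA (tau x))%:E * hA (std x)))%E.
  rewrite [ltLHS]BE.
  exact: (lt_le_trans (lte_gap_combine c_gt0 Xf Z_gt0 XY) AE).
have ident x : ((if good x then l1 x else 0)%:E + (aA (tau x))%:E * hA (std x) =
    (if good x then l0 x else 0)%:E + (aB (tau x))%:E * hB (std x))%E.
  rewrite /hA /gapQ /hB /ugap -!EFinM -!EFinD; congr EFin.
  have [t0|t0] := leP (tau x) 0.
    by rewrite aAn// aBn// !mul0r /good ltNge t0.
  case: (boolP (good x)) => gx; last by rewrite (gap_good gx t0) !(mulr0, mul0r).
  rewrite /l1 /l0 -(std_good gx) /aA /aB /ipow t0.
  move: (gap _) ((std x).1.1) => g u; field.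
  by rewrite gt_eqF.
(* From [(y - 1) ^+ 2 <= 2 * y ^+ 2 + 2], finiteness reduces to the second inverse moment and the
   second chi-square moment. *)
have l0_fin : (\int[P]_x (if good x then l0 x else 0)%:E < +oo)%E.
  pose b1 (t : R) : R := 2 * (c * f0) ^+ 2 * ipow 2 t.
  pose b2 (t : R) : R := 2 * ipow 0 t.
  have k0 : 0 <= 2 * (c * f0) ^+ 2 by rewrite mulr_ge0// sqr_ge0.
  have mb1 : measurable_fun [set: R] b1.
    by apply: mfunM; [exact: measurable_cst|exact: measurable_ipow].
  have mb2 : measurable_fun [set: R] b2.
    by apply: mfunM; [exact: measurable_cst|exact: measurable_ipow].
  have b10 t : 0 <= b1 t by rewrite mulr_ge0// ipow_ge0.
  have b20 t : 0 <= b2 t by rewrite mulr_ge0// ipow_ge0.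
  have b1n t : t <= 0 -> b1 t = 0 by move=> t0; rewrite /b1 ipow_npos// mulr0.
  have b2n t : t <= 0 -> b2 t = 0 by move=> t0; rewrite /b2 ipow_npos// mulr0.
  have msq : measurable_fun [set: R] (fun u : R => u ^+ 2) by mfun.
  have msqs : measurable_fun [set: R * R * R] (fun v : R * R * R => (v.1.1 ^+ 2)%:E).
    by mfun.
  apply: (@le_lt_trans _ _ (\int[P]_x ((b1 (tau x))%:E * ((std x).1.1 ^+ 2)%:E +
      (b2 (tau x))%:E * 1%:E))%E).
    apply: ge0_le_integralT.
    - by apply: mfun_EFin; apply: mfun_if => //; exact: measurable_cst.
    - apply: mfun_eadd; first exact: (mprod mb1 msqs).
      exact: (mprod mb2 (measurable_cst 1%:E)).
    - by move=> x; rewrite lee_fin; case: ifP => // _; exact: sqr_ge0.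
    move=> x; rewrite -!EFinM -EFinD lee_fin.
    case: (boolP (good x)) => gx; last first.
      by apply: addr_ge0; apply: mulr_ge0 => //; exact: sqr_ge0.
    have /and3P[t0 _ _] := gx.
    rewrite /l0 -(std_good gx) /b1 /b2 /ipow t0 expr0 invr1 !mulr1.
    have W2 : tau x ^- 2 * (std x).1.1 ^+ 2 = ((std x).1.1 / tau x) ^+ 2.
      by rewrite [RHS]exprMn exprVn [LHS]mulrC.
    rewrite -[X in _ <= X + _]mulrA W2.
    move: ((std x).1.1 / tau x) (c * f0) => W0 k.
    by have := sqr_ge0 (k * W0 + 1); lra.
  rewrite -ge0_integralTD; last 4 first.
  - exact: (mprod mb1 msqs).
  - exact: (mprod mb2 (measurable_cst 1%:E)).
  - by move=> x; apply: mule_ge0; rewrite lee_fin// sqr_ge0.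
  - by move=> x; apply: mule_ge0; rewrite lee_fin.
  apply: lte_add_pinfty.
    apply: (E_fst_lty (b := fun u => u ^+ 2) mb1 b10 b1n msq (fun u => sqr_ge0 u)).
      rewrite (ge0_integralTZ Pi (mip 2%N) (ip0 2%N) k0) integral_ipow//.
      by rewrite -EFinM ltry.
    exact: chi2_sqr_lty.
  apply: (E_fst_lty (b := fun=> 1) mb2 b20 b2n (measurable_cst _) (fun=> ler01)).
    rewrite (ge0_integralTZ Pi (mip 0%N) (ip0 0%N) (ler0n _ 2)) integral_ipow0//.
    by rewrite mule1 ltry.
  by rewrite integral_cst// mul1e (le_lt_trans _ (ltry 1))//;
    exact: (@sprobability_setT _ _ _ (onR (@chi2_law R m1))).
have m0 : measurable_fun [set: T] (fun x => (if good x then l0 x else 0)%:E).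
  by apply: mfun_EFin; apply: mfun_if => //; exact: measurable_cst.
have m1' : measurable_fun [set: T] (fun x => (if good x then l1 x else 0)%:E).
  by apply: mfun_EFin; apply: mfun_if => //; exact: measurable_cst.
have l_ge0 (l : T -> R) x : (0 <= (if good x then l x ^+ 2 else 0)%:E)%E.
  by rewrite lee_fin; case: ifP => // _; exact: sqr_ge0.
have A0 x : (0 <= (aA (tau x))%:E * hA (std x))%E.
  by apply: mule_ge0; [rewrite lee_fin|exact: hA0].
have B0 x : (0 <= (aB (tau x))%:E * hB (std x))%E.
  by apply: mule_ge0; [rewrite lee_fin|exact: hB0].
have Bfin : (\int[P]_x ((aB (tau x))%:E * hB (std x)) < +oo)%E.
  by rewrite BE; apply: lte_mul_pinfty => //; rewrite lee_fin.
have [_ hs] := integral_compare m0 m1' (mprod maA mhA) (mprod maB mhB)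
  (l_ge0 _) (l_ge0 _) A0 B0 ident (ltW BA) Bfin.
exact: hs BA l0_fin.
Qed.

End squared_error.

Section entropy.
Variable c : R.
Hypotheses (c_gt0 : 0 < c) (NE : N = (m1 + m2 + p)%:R - 4).
Hypothesis i1 : Pi.-integrable setT (fun t => (t ^- 1)%:E).
Hypothesis cE : c = (inv_moment Pi 1)^-1.
Hypotheses (al_gt0 : 0 < al) (be_gt0 : 0 < be).

Let l1 x := c * (f0 - gap (std x)) * (S1 x / s1 ^+ 2) -
  ln (c * (f0 - gap (std x)) * (S1 x / s1 ^+ 2)) - 1.
Let l0 x := c * f0 * (S1 x / s1 ^+ 2) - ln (c * f0 * (S1 x / s1 ^+ 2)) - 1.

Let mW : measurable_fun [set: T] (fun x => S1 x / s1 ^+ 2).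
Proof. by apply: mfunM => //; exact: measurable_cst. Qed.

Let ml1 : measurable_fun [set: T] l1.
Proof.
have my : measurable_fun [set: T] (fun x => c * (f0 - gap (std x)) * (S1 x / s1 ^+ 2)).
  apply: mfunM => //; apply: mfunM; first exact: measurable_cst.
  by apply: mfunD; [exact: measurable_cst|exact: mfunN].
apply: mfunD; last exact: measurable_cst.
by apply: mfunD => //; apply: mfunN; exact: mfun_ln.
Qed.

Let ml0 : measurable_fun [set: T] l0.
Proof.
have my : measurable_fun [set: T] (fun x => c * f0 * (S1 x / s1 ^+ 2)).
  by apply: mfunM => //; exact: measurable_cst.
apply: mfunD; last exact: measurable_cst.
by apply: mfunD => //; apply: mfunN; exact: mfun_ln.
Qed.

Let loss_ge0 (y : R) : 0 < y -> 0 <= y - ln y - 1.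
Proof.
move=> y0; have /le_ln1Dx : -1 < y - 1 by lra.
by rewrite (_ : 1 + (y - 1) = y); [lra|ring].
Qed.

(** [hB] is the cost in the logarithm, [h1] its linear upper bound, and [hA] the gain in the linear
    term of the loss. *)
Let hB := gapln al be f0 N.
Let hA := ugap al be f0 N.
Let h1 := gapE0 al be f0 N.
Let aA t := c * ipow 1 t.

Let mip k : measurable_fun [set: R] (fun t => (ipow k t)%:E : \bar R).
Proof. by apply: mfun_EFin; exact: measurable_ipow. Qed.
Let ip0 k t : (0 <= (ipow k t)%:E :> \bar R)%E.
Proof. by rewrite lee_fin ipow_ge0. Qed.
Let maA : measurable_fun [set: R] aA.
Proof. by apply: mfunM; [exact: measurable_cst|exact: measurable_ipow]. Qed.
Let aA0 t : 0 <= aA t.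
Proof. by apply: mulr_ge0; [exact: ltW|exact: ipow_ge0]. Qed.
Let aAn t : t <= 0 -> aA t = 0.
Proof. by move=> t0; rewrite /aA ipow_npos// mulr0. Qed.
Let mhB : measurable_fun setT hB. Proof. exact: measurable_gapln. Qed.
Let hB0 v : (0 <= hB v)%E. Proof. exact: gapln_ge0. Qed.
Let mhA : measurable_fun setT hA.
Proof. exact: mfun_EFin (measurable_ugap al be f0 N). Qed.
Let hA0 v : (0 <= hA v)%E. Proof. by rewrite lee_fin ugap_ge0. Qed.
Let mh1 : measurable_fun setT h1. Proof. exact: measurable_gapE0. Qed.
Let h10 v : (0 <= h1 v)%E. Proof. exact: gapE0_ge0. Qed.

Let X := (\int[Pi]_t ((ipow 0 t)%:E * E (Num.sqrt t) h1))%E.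

Let mX : measurable_fun [set: R] (fun t => (ipow 0 t)%:E * E (Num.sqrt t) h1)%E.
Proof. by apply: mcond_prod => //; exact: measurable_ipow. Qed.
Let X0' t : (0 <= (ipow 0 t)%:E * E (Num.sqrt t) h1)%E.
Proof. by apply: mule_ge0; [exact: ip0|exact: condE_ge0]. Qed.

Let X_gt0 : (0 < X)%E.
Proof.
apply: (integral_pos_gt0 Pi_pos mX X0') => t t0.
by apply: mule_gt0; [rewrite lte_fin ipow_gt0|exact: condE_gapE0_gt0].
Qed.

Let X_lty : (X < +oo)%E.
Proof.
have c0 : 0 <= f0 * N by apply: mulr_ge0; exact: ltW.
apply: (@le_lt_trans _ _ (\int[Pi]_t ((f0 * N)%:E * (ipow 0 t)%:E))%E).
  apply: (ge0_le_integralT Pi mX (mfun_emul (measurable_cst _) (mip 0%N)) X0').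
  move=> t; rewrite /= muleC; apply: lee_wpmul2r; first exact: ip0.
  apply: (@le_trans _ _ (E (Num.sqrt t) (fun=> (f0 * N)%:E))).
    apply: (condE_le m1 m2 s r_ge1 _ mh1 (measurable_cst _) h10).
      by move=> v; rewrite lee_fin.
    by move=> u v z _ _ _; exact: gapE0_ub.
  apply: (le_trans (@condE_fst_le _ m1 m2 s r _ (fun=> f0 * N) (measurable_cst _) (fun=> c0))).
  rewrite integral_cst// -[leRHS]mule1 lee_wpmul2l ?lee_fin//.
  exact: (@sprobability_setT _ _ _ (onR (@chi2_law R m1))).
by rewrite (ge0_integralTZ Pi (mip 0%N) (ip0 0%N) c0) integral_ipow0// mule1 ltry.
Qed.

Let B_le : (\int[P]_x ((ipow 0 (tau x))%:E * hB (std x)) <= X)%E.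
Proof.
rewrite (E_prod (measurable_ipow 0) (ipow_ge0 0) (@ipow_npos _ 0) mhB hB0).
apply: (ge0_le_integralT Pi (mcond_prod (measurable_ipow 0) mhB hB0) mX).
  by move=> t; apply: mule_ge0; [exact: ip0|exact: condE_ge0].
move=> t; apply: lee_wpmul2l; first exact: ip0.
apply: (condE_le m1 m2 s r_ge1 _ mhB mh1 hB0 h10).
by move=> u v z _ _ _; exact: gapln_le.
Qed.

Let A_ge : (X + (4 / N)%:E * X <= \int[P]_x ((aA (tau x))%:E * hA (std x)))%E.
Proof.
have N40 : 0 <= 4 / N by apply: divr_ge0 => //; exact: ltW.
pose G t := E (Num.sqrt t) hA.
have mG : measurable_fun [set: R] G by exact: mcond.
have G0 t : (0 <= G t)%E by exact: condE_ge0.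
have Gfin t : (G t < +oo)%E by exact: condE_ugap_lty.
have Gd t t' : 0 < t -> t <= t' -> (G t' <= G t)%E.
  by move=> t0 tt'; exact: condE_ugap_noninc.
have mGk k : measurable_fun [set: R] (fun t => (ipow k t)%:E * G t)%E.
  exact: mfun_emul.
have G0k k t : (0 <= (ipow k t)%:E * G t)%E.
  by apply: mule_ge0; [exact: ip0|exact: G0].
have j2 : (\int[Pi]_t (ipow 0 t / t)%:E = (inv_moment Pi 1)%:E)%E.
  by under eq_integral do rewrite ipowS; exact: integral_ipow.
have := chebyshev_inv (measurable_ipow 0) mG (ipow_ge0 0) (@ipow_npos _ 0)
    G0 Gfin Gd (integral_ipow0 Pi_pos) j2 ltr01 (inv_moment_gt0 Pi_pos i1).
(* The weight here is [ipow 0], of mass one, so the ratio of masses is the inverse of the first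
   inverse moment, that is [c]. *)
rewrite div1r -cE => ch.
have -> : (\int[P]_x ((aA (tau x))%:E * hA (std x)) =
    c%:E * \int[Pi]_t ((ipow 0 t / t)%:E * G t))%E.
  rewrite (E_prod maA aA0 aAn mhA hA0).
  under [in RHS]eq_integral do rewrite ipowS.
  rewrite -(ge0_integralTZ Pi (mGk 1%N) (G0k 1%N) (ltW c_gt0)).
  by apply: eq_integral => t _; rewrite /aA EFinM muleA.
apply: le_trans ch.
have mk := mfun_emul (measurable_cst (4 / N)%:E) mX.
have k0 t : (0 <= (4 / N)%:E * ((ipow 0 t)%:E * E (Num.sqrt t) h1))%E.
  by apply: mule_ge0; [rewrite lee_fin|exact: X0'].
rewrite -(ge0_integralTZ Pi mX X0' N40) (ge0_integralTD Pi mX mk X0' k0).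
apply: (ge0_le_integralT Pi (mfun_eadd mX mk) (mGk 0%N)).
  by move=> t; apply: adde_ge0; [exact: X0'|exact: k0].
move=> t.
have e0 := condE_ge0 m1 m2 s r (Num.sqrt t) h10.
have f0' : (0 <= (4 / N)%:E * E (Num.sqrt t) h1)%E.
  by apply: mule_ge0 => //; rewrite lee_fin.
apply: (@le_trans _ _ ((ipow 0 t)%:E * (E (Num.sqrt t) h1 +
    (4 / N)%:E * E (Num.sqrt t) h1))%E).
  by rewrite (ge0_muleDr _ e0 f0') [X in (_ <= _ + X)%E]muleCA; exact: lexx.
apply: lee_wpmul2l; first exact: ip0.
by apply: condE_gapE0 => //; rewrite size_s.
Qed.

(** The surplus [4 / N * X] is positive and [X] is finite, which makes the comparison strict. *)
Let BA : (\int[P]_x ((ipow 0 (tau x))%:E * hB (std x)) <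
    \int[P]_x ((aA (tau x))%:E * hA (std x)))%E.
Proof.
apply: (le_lt_trans B_le); apply: (lt_le_trans _ A_ge).
have N40 : 0 < 4 / N by exact: divr_gt0.
rewrite lteDl; first by apply: mule_gt0 => //; rewrite lte_fin.
by rewrite (ge0_fin_numE (ltW X_gt0)).
Qed.

Let l_ge0 (l : T -> R) : (forall x, good x -> 0 <= l x) ->
  forall x, (0 <= (if good x then l x else 0)%:E)%E.
Proof. by move=> h x; rewrite lee_fin; case: ifP => // /h. Qed.

Let W_gt0 x : good x -> 0 < S1 x / s1 ^+ 2.
Proof. by move=> /and3P[_ S10 _]; exact: divr_gt0. Qed.

(** The logarithm of [S1 / s1 ^+ 2] occurs in both losses and cancels, which leaves [gapln]. *)
Let ident x : ((if good x then l1 x else 0)%:E + (aA (tau x))%:E * hA (std x) =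
    (if good x then l0 x else 0)%:E + (ipow 0 (tau x))%:E * hB (std x))%E.
Proof.
rewrite /hA /ugap /hB /gapln -!EFinM -!EFinD; congr EFin.
have [t0|t0] := leP (tau x) 0.
  by rewrite aAn// ipow_npos// !mul0r /good ltNge t0.
case: (boolP (good x)) => gx.
  have W0 := W_gt0 gx; have fg := @f0_gap_gt0 _ al be _ _ N_gt0 f0_gt0 (std x).
  have -> : aA (tau x) * ((std x).1.1 * gap (std x)) =
      c * gap (std x) * (S1 x / s1 ^+ 2).
    rewrite -(std_good gx) /aA /ipow t0; move: (gap _) ((std x).1.1) => g u.
    by field; rewrite gt_eqF.
  rewrite /l1 /l0 /ipow t0 expr0 invr1.
  move: (S1 x / s1 ^+ 2) W0 (gap (std x)) fg => W W0 g fg.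
  rewrite !lnM ?posrE ?mulr_gt0//; ring.
by rewrite (gap_good gx t0) !(mulr0, subr0) subrr mulr0.
Qed.

Let l0_ge0 x : good x -> 0 <= l0 x.
Proof.
move=> gx; apply: loss_ge0; apply: mulr_gt0; last exact: W_gt0.
exact: mulr_gt0.
Qed.

Let l1_ge0 x : good x -> 0 <= l1 x.
Proof.
move=> gx; apply: loss_ge0; apply: mulr_gt0; last exact: W_gt0.
by apply: mulr_gt0 => //; exact: f0_gap_gt0.
Qed.

Let compare :
  (\int[P]_x (if good x then l1 x else 0)%:E <=
   \int[P]_x (if good x then l0 x else 0)%:E)%E /\
  ((\int[P]_x (if good x then l0 x else 0)%:E < +oo)%E ->
  (\int[P]_x (if good x then l1 x else 0)%:E <
   \int[P]_x (if good x then l0 x else 0)%:E)%E).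
Proof.
have m0 : measurable_fun [set: T] (fun x => (if good x then l0 x else 0)%:E).
  by apply: mfun_EFin; apply: mfun_if => //; exact: measurable_cst.
have m1' : measurable_fun [set: T] (fun x => (if good x then l1 x else 0)%:E).
  by apply: mfun_EFin; apply: mfun_if => //; exact: measurable_cst.
have A0 x : (0 <= (aA (tau x))%:E * hA (std x))%E.
  by apply: mule_ge0; [rewrite lee_fin|exact: hA0].
have B0 x : (0 <= (ipow 0 (tau x))%:E * hB (std x))%E.
  by apply: mule_ge0; [exact: ip0|exact: hB0].
have [h hs] := integral_compare m0 m1' (mprod maA mhA)
  (mprod (measurable_ipow 0) mhB) (l_ge0 l0_ge0) (l_ge0 l1_ge0) A0 B0 ident
  (ltW BA) (le_lt_trans B_le X_lty).
by split=> //; exact: hs BA.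
Qed.

Lemma entropy_risk_le :
  (\int[P]_x (c * (f0 - gap (std x)) * (S1 x / s1 ^+ 2) -
      ln (c * (f0 - gap (std x)) * (S1 x / s1 ^+ 2)) - 1)%:E <=
   \int[P]_x (c * f0 * (S1 x / s1 ^+ 2) - ln (c * f0 * (S1 x / s1 ^+ 2)) - 1)%:E)%E.
Proof. by rewrite (risk_good ml1) (risk_good ml0); case: compare. Qed.

Hypothesis m1_gt0 : (0 < m1)%N.
Hypothesis iln : Pi.-integrable setT (fun t => (ln t)%:E).

(** The logarithm splits into those of [c * f0], [u] and [tau]. Only the negative part of [ln u]
    needs a bound, supplied by [chi2_Nln_lty]; [ln tau] is controlled by [iln] and the linear term
    by the first inverse moment. *)
Let l0_fin : (\int[P]_x (if good x then l0 x else 0)%:E < +oo)%E.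
Proof.
pose b1 (t : R) : R := c * f0 * ipow 1 t.
pose b2 (t : R) : R := `|ln (c * f0)| * ipow 0 t.
pose b3 (t : R) : R := `|ln t| * ipow 0 t.
have cf0 : 0 <= c * f0 by apply: mulr_ge0; exact: ltW.
have mb1 : measurable_fun [set: R] b1.
  by apply: mfunM; [exact: measurable_cst|exact: measurable_ipow].
have mb2 : measurable_fun [set: R] b2.
  by apply: mfunM; [exact: measurable_cst|exact: measurable_ipow].
have mab : measurable_fun [set: R] (fun u : R => `|u|) by exact: measurableT_comp.
have mb3 : measurable_fun [set: R] b3.
  apply: mfunM; last exact: measurable_ipow.
  by apply: (measurableT_comp mab); exact: measurable_ln.
have b10 t : 0 <= b1 t by apply: mulr_ge0 => //; exact: ipow_ge0.
have b20 t : 0 <= b2 t by apply: mulr_ge0 => //; exact: ipow_ge0.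
have b30 t : 0 <= b3 t by apply: mulr_ge0 => //; exact: ipow_ge0.
have b1n t : t <= 0 -> b1 t = 0 by move=> t0; rewrite /b1 ipow_npos// mulr0.
have b2n t : t <= 0 -> b2 t = 0 by move=> t0; rewrite /b2 ipow_npos// mulr0.
have b3n t : t <= 0 -> b3 t = 0 by move=> t0; rewrite /b3 ipow_npos// mulr0.
pose nl (u : R) : R := Num.max (- ln u) 0.
have mnl : measurable_fun [set: R] nl.
  by apply: measurable_maxr; [apply: mfunN; exact: measurable_ln|exact: measurable_cst].
have nl0 u : 0 <= nl u by rewrite le_max lexx orbT.
pose F1 x := ((b1 (tau x))%:E * (`|(std x).1.1|)%:E)%E.
pose F2 x := ((b2 (tau x))%:E * 1%:E)%E.
pose F3 x := ((ipow 0 (tau x))%:E * (nl (std x).1.1)%:E)%E.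
pose F4 x := ((b3 (tau x))%:E * 1%:E)%E.
have mu1 : measurable_fun [set: R * R * R] (fun v : R * R * R => v.1.1) by mfun.
have mF1 : measurable_fun [set: T] F1.
  apply: (@mprod b1 (fun v => (`|v.1.1|)%:E)) => //.
  by apply: mfun_EFin; exact: (measurableT_comp mab).
have mF2 : measurable_fun [set: T] F2 by exact: (mprod mb2 (measurable_cst _)).
have mF3 : measurable_fun [set: T] F3.
  apply: (@mprod (ipow 0) (fun v => (nl v.1.1)%:E)); first exact: measurable_ipow.
  by apply: mfun_EFin; exact: (measurableT_comp mnl).
have mF4 : measurable_fun [set: T] F4 by exact: (mprod mb3 (measurable_cst _)).
have F10 x : (0 <= F1 x)%E by apply: mule_ge0; rewrite lee_fin.
have F20 x : (0 <= F2 x)%E by apply: mule_ge0; rewrite lee_fin.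
have F30 x : (0 <= F3 x)%E by apply: mule_ge0; [exact: ip0|rewrite lee_fin].
have F40 x : (0 <= F4 x)%E by apply: mule_ge0; rewrite lee_fin.
have mass1 : (\int[onR (@chi2_law R m1)]_u (1%:E : \bar R) < +oo)%E.
  rewrite integral_cst// mul1e (le_lt_trans _ (ltry 1))//.
  exact: (@sprobability_setT _ _ _ (onR (@chi2_law R m1))).
have i1f : (\int[P]_x F1 x < +oo)%E.
  apply: (E_fst_lty mb1 b10 b1n mab (fun u => normr_ge0 u)); last exact: chi2_abs_lty.
  by rewrite (ge0_integralTZ Pi (mip 1%N) (ip0 1%N) cf0) integral_ipow// -EFinM ltry.
have i2f : (\int[P]_x F2 x < +oo)%E.
  apply: (E_fst_lty (b := fun=> 1) mb2 b20 b2n (measurable_cst _) (fun=> ler01)) => //.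
  rewrite (ge0_integralTZ Pi (mip 0%N) (ip0 0%N) (normr_ge0 _)) integral_ipow0//.
  by rewrite mule1 ltry.
have i3f : (\int[P]_x F3 x < +oo)%E.
  apply: (E_fst_lty (measurable_ipow 0) (ipow_ge0 0) (@ipow_npos _ 0) mnl nl0).
    by rewrite integral_ipow0// ltry.
  exact: chi2_Nln_lty.
have i4f : (\int[P]_x F4 x < +oo)%E.
  apply: (E_fst_lty (b := fun=> 1) mb3 b30 b3n (measurable_cst _) (fun=> ler01)) => //.
  move: iln => /integrableP[mln]; apply: le_lt_trans.
  apply: ge0_le_integralT.
  - exact: mfun_EFin.
  - exact: (measurableT_comp _ mln).
  - by move=> t; rewrite lee_fin.
  - move=> t; rewrite /= lee_fin /b3 /ipow; case: ifP => _.
      by rewrite expr0 invr1 mulr1.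
    by rewrite mulr0.
have mF12 := mfun_eadd mF1 mF2; have mF34 := mfun_eadd mF3 mF4.
have F120 x : (0 <= F1 x + F2 x)%E by exact: adde_ge0.
have F340 x : (0 <= F3 x + F4 x)%E by exact: adde_ge0.
apply: (@le_lt_trans _ _ (\int[P]_x ((F1 x + F2 x) + (F3 x + F4 x)))%E).
  apply: ge0_le_integralT.
  - by apply: mfun_EFin; apply: mfun_if => //; exact: measurable_cst.
  - exact: mfun_eadd.
  - exact: l_ge0 l0_ge0.
  move=> x; case: (boolP (good x)) => gx; last by apply: adde_ge0.
  have /and3P[t0 _ _] := gx; have u0 := std_u_gt0 gx.
  rewrite /F1 /F2 /F3 /F4 -!EFinM -!EFinD lee_fin /l0 -(std_good gx).
  rewrite /b1 /b2 /b3 /ipow t0 expr0 invr1 expr1 !mulr1 mul1r (gtr0_norm u0).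
  have lnW : ln ((std x).1.1 / tau x) = ln (std x).1.1 - ln (tau x).
    by rewrite lnM ?posrE ?invr_gt0// lnV ?posrE.
  have ut0 := divr_gt0 u0 t0; have cf1 := mulr_gt0 c_gt0 f0_gt0.
  have -> : ln (c * f0 * ((std x).1.1 / tau x)) =
      ln (c * f0) + (ln (std x).1.1 - ln (tau x)) by rewrite -lnW lnM.
  have h1' : - ln (std x).1.1 <= nl (std x).1.1 by rewrite le_max lexx.
  have h2 : - ln (c * f0) <= `|ln (c * f0)| by rewrite -normrN ler_norm.
  have h3 : ln (tau x) <= `|ln (tau x)| by rewrite ler_norm.
  have e : c * f0 * ((std x).1.1 / tau x) = c * f0 / tau x * (std x).1.1.
    by rewrite mulrA [LHS]mulrAC.
  rewrite e; lra.
rewrite -(ge0_integralTD P mF12 mF34 F120 F340).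
rewrite -(ge0_integralTD P mF1 mF2 F10 F20) -(ge0_integralTD P mF3 mF4 F30 F40).
by apply: lte_add_pinfty; exact: lte_add_pinfty.
Qed.

Lemma entropy_risk_lt :
  (\int[P]_x (c * (f0 - gap (std x)) * (S1 x / s1 ^+ 2) -
      ln (c * (f0 - gap (std x)) * (S1 x / s1 ^+ 2)) - 1)%:E <
   \int[P]_x (c * f0 * (S1 x / s1 ^+ 2) - ln (c * f0 * (S1 x / s1 ^+ 2)) - 1)%:E)%E.
Proof.
rewrite (risk_good ml1) (risk_good ml0); case: compare => _; apply.
exact: l0_fin.
Qed.

End entropy.
End factor.
End mixture_risk.

(** * The estimators in terms of the gap, and the theorem *)

Section estimators.
Context {R : realType} {p q : nat} (m1 m2 : nat) (Pi : probability R R).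
Variables (k a b : R) (x1 : p.-tuple R) (x2 : q.-tuple R).
Hypotheses (k_gt0 : 0 < k) (a_gt0 : 0 < a) (b_gt0 : 0 < b).

(** Region and gap are scale invariant, so any [k > 0] is allowed; it will be
    [tau / sigma1 ^+ 2]. *)
Lemma delta12QE :
  delta12Q m1 m2 Pi x1 a x2 b =
  inv_moment Pi 1 / inv_moment Pi 2 *
  ((m1%:R + 2)^-1 - gap ((m2%:R + p%:R) / (m1%:R + 2)) (m2%:R / (m1%:R + 2))
     (m1%:R + 2)^-1 (m1 + m2 + p + 2)%:R (k * a, k * b, k * sqnorm x1)) * a.
Proof.
rewrite /delta12Q -(region_ratio _ _ k_gt0 a_gt0 b_gt0 (sqnorm_ge0 x1)).
case: ifPn => rv; last by rewrite /gap (negbTE rv) subr0; ring.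
have N0 : 0 < (m1 + m2 + p + 2)%:R :> R by rewrite ltr0n addn2.
by rewrite (gap_ratio _ k_gt0 a_gt0 N0 rv) !natrD; ring.
Qed.

Lemma delta01QE : delta01Q m1 Pi x1 a x2 b =
  inv_moment Pi 1 / inv_moment Pi 2 * (m1%:R + 2)^-1 * a.
Proof. by rewrite /delta01Q invfM; ring. Qed.

Lemma delta12EE : (4 < m2 + p)%N ->
  delta12E m1 m2 Pi x1 a x2 b =
  (inv_moment Pi 1)^-1 *
  (m1%:R^-1 - gap ((m2%:R + p%:R - 4) / m1%:R) (m2%:R / m1%:R)
     m1%:R^-1 ((m1 + m2 + p)%:R - 4) (k * a, k * b, k * sqnorm x1)) * a.
Proof.
move=> mp; rewrite /delta12E -(region_ratio _ _ k_gt0 a_gt0 b_gt0 (sqnorm_ge0 x1)).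
case: ifPn => rv; last by rewrite /gap (negbTE rv) subr0; ring.
rewrite gap_ratio//; first by rewrite !natrD; ring.
by rewrite subr_gt0 ltr_nat -addnA (leq_trans mp)// leq_addl.
Qed.

Lemma delta01EE : delta01E m1 Pi x1 a x2 b =
  (inv_moment Pi 1)^-1 * m1%:R^-1 * a.
Proof. by rewrite /delta01E invfM; ring. Qed.

(* For m2 + p <= 4 the region of the entropy estimator is negligible. *)
Lemma delta12E_trivial : (m2 + p <= 4)%N ->
  delta12E m1 m2 Pi x1 a x2 b = delta01E m1 Pi x1 a x2 b.
Proof.
move=> mp; rewrite /delta12E -(region_ratio _ _ k_gt0 a_gt0 b_gt0 (sqnorm_ge0 x1)).
case: ifPn => [/and5P[/= u0 v0 z0 h _]|_]; last by rewrite /delta01E invfM mulrA.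
exfalso; move: h; apply/negP; rewrite -ltNge.
apply: (@le_lt_trans _ _ 0); last by rewrite ltr_pwDl.
have : m2%:R + p%:R <= 4 :> R by rewrite -natrD ler_nat.
move=> mp'; apply: mulr_le0_ge0; last exact: ltW.
by apply: mulr_le0_ge0; [lra|rewrite invr_ge0 ler0n].
Qed.

End estimators.

Theorem corollary2p6 (R : realType) (p q m1 m2 : nat)
    (p_gt0 : (0 < p)%N) (q_gt0 : (0 < q)%N)
    (m1_gt0 : (0 < m1)%N) (m2_gt0 : (0 < m2)%N)
    (Pi : probability R R) (Pi_pos : Pi [set t | 0 < t] = 1%E)
    (d : measure_display) (T : measurableType d)
    (P : param R p q -> probability T R)
    (tau : {mfun T >-> R})
    (X1 : {mfun T >-> p.-tuple R}) (S1 : {mfun T >-> R})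
    (X2 : {mfun T >-> q.-tuple R}) (S2 : {mfun T >-> R})
    (model : forall w, ordered_param w ->
      scale_mixture_model m1 m2 Pi (P w) w tau X1 S1 X2 S2) :
  (Pi.-integrable setT (fun t => (t ^- 2)%:E) ->
     dominates (risk sq_loss P X1 S1 X2 S2)
       (delta12Q m1 m2 Pi) (delta01Q m1 Pi))
  /\
  (Pi.-integrable setT (fun t => (t ^- 1)%:E) ->
     no_worse (risk entropy_loss P X1 S1 X2 S2)
       (delta12E m1 m2 Pi) (delta01E m1 Pi)
     /\
     ((4 < m2 + p)%N -> Pi.-integrable setT (fun t => (ln t)%:E) ->
      dominates (risk entropy_loss P X1 S1 X2 S2)
        (delta12E m1 m2 Pi) (delta01E m1 Pi))).
Proof.
have msq : measurable_fun [set: p.-tuple R] (@sqnorm R p) by exact: measurable_sqnorm.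
have mtau : measurable_fun [set: T] tau by exact: measurable_funPT.
have mX1 : measurable_fun [set: T] X1 by exact: measurable_funPT.
have mS1 : measurable_fun [set: T] S1 by exact: measurable_funPT.
have mS2 : measurable_fun [set: T] S2 by exact: measurable_funPT.
have mstd (s : R) : measurable_fun [set: T] (fun x => (tau x / s ^+ 2 * S1 x,
    tau x / s ^+ 2 * S2 x, tau x / s ^+ 2 * sqnorm (X1 x))).
  by mfun.
have mgapstd (al be f0 N c s : R) : measurable_fun [set: T] (fun x =>
    c * (f0 - gap al be f0 N (tau x / s ^+ 2 * S1 x,
    tau x / s ^+ 2 * S2 x, tau x / s ^+ 2 * sqnorm (X1 x))) * S1 x).
  apply: mfunM => //.
  apply: mfunM; first exact: measurable_cst.
  apply: mfunD; first exact: measurable_cst.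
  by apply: mfunN; exact: (measurableT_comp (measurable_gap al be f0 N) (mstd s)).
have msqloss (f : T -> R) (s : R) : measurable_fun [set: T] f ->
    measurable_fun [set: T] (fun x => sq_loss (f x) s).
  by move=> mf; rewrite /sq_loss; mfun.
have mentloss (f : T -> R) (s : R) : measurable_fun [set: T] f ->
    measurable_fun [set: T] (fun x => entropy_loss (f x) s).
  by move=> mf; rewrite /entropy_loss; mfun.
have p0 : 0 < p%:R :> R by rewrite ltr0n.
have m10 : 0 < m1%:R :> R by rewrite ltr0n.
have m20 : 0 < m2%:R :> R by rewrite ltr0n.
(* Witness for strictness. Any ordered parameter would serve, since the strict inequality is proved
   at each of them. *)
have word0 : ordered_param (Param [tuple (0 : R) | i < p] [tuple (0 : R) | i < q] 1 1).
  by split => //=; exact: ltr01.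
have mQ12 : measurable_fun [set: T] (fun x =>
    delta12Q m1 m2 Pi (X1 x) (S1 x) (X2 x) (S2 x)).
  by rewrite /delta12Q; mfun.
have mQ01 : measurable_fun [set: T] (fun x =>
    delta01Q m1 Pi (X1 x) (S1 x) (X2 x) (S2 x)).
  by rewrite /delta01Q; mfun.
have mE12 : measurable_fun [set: T] (fun x =>
    delta12E m1 m2 Pi (X1 x) (S1 x) (X2 x) (S2 x)).
  by rewrite /delta12E; mfun.
have mE01 : measurable_fun [set: T] (fun x =>
    delta01E m1 Pi (X1 x) (S1 x) (X2 x) (S2 x)).
  by rewrite /delta01E; mfun.
(* In a risk, the estimator may be replaced by any measurable expression that equals it where [tau],
   [S1] and [S2] are positive. *)
have riskE w (L : R -> R -> R) (delta : estimator R p q) (f : T -> R) :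
    ordered_param w ->
    (forall g s, measurable_fun [set: T] g ->
      measurable_fun [set: T] (fun x => L (g x) s)) ->
    measurable_fun [set: T] (fun x => delta (X1 x) (S1 x) (X2 x) (S2 x)) ->
    measurable_fun [set: T] f ->
    (forall x, 0 < tau x -> 0 < S1 x -> 0 < S2 x ->
      delta (X1 x) (S1 x) (X2 x) (S2 x) = f x) ->
    risk L P X1 S1 X2 S2 delta w = (\int[P w]_x (L (f x) (sigma1 w ^+ 2))%:E)%E.
  move=> ow mL md mf df; rewrite /risk unlock.
  have h := mixture_eq_integral Pi_pos ow (model _ ow)
    (mL _ (sigma1 w ^+ 2) md) (mL _ (sigma1 w ^+ 2) mf).
  by apply: h => x t0 S10 S20; rewrite df.
have mS1c (c : R) : measurable_fun [set: T] (fun x => c * S1 x) by mfun.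
split.
- move=> i2; have i1 := integrable_inv1 i2.
  have M1 := inv_moment_gt0 Pi_pos i1; have M2 := inv_moment_gt0 Pi_pos i2.
  pose c := inv_moment Pi 1 / inv_moment Pi 2.
  have c0 : 0 < c by exact: divr_gt0.
  have m12 : 0 < m1%:R + 2 :> R by rewrite addr_gt0.
  pose al := (m2%:R + p%:R) / (m1%:R + 2) : R.
  pose be := m2%:R / (m1%:R + 2) : R.
  have N0 : 0 < (m1 + m2 + p + 2)%:R :> R by rewrite ltr0n addn2.
  have f00 : 0 < (m1%:R + 2)^-1 :> R by rewrite invr_gt0.
  have Nf0 : (m1 + m2 + p + 2)%:R * (m1%:R + 2)^-1 = 1 + al :> R.
    by rewrite /al !natrD; field; rewrite gt_eqF.
  have al0 : 0 < al by rewrite divr_gt0// addr_gt0.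
  have be0 : 0 < be by exact: divr_gt0.
  have lt w : ordered_param w -> (risk sq_loss P X1 S1 X2 S2 (delta12Q m1 m2 Pi) w <
      risk sq_loss P X1 S1 X2 S2 (delta01Q m1 Pi) w)%E.
    move=> ow; have [s10 _ _] := ow.
    have s120 : 0 < sigma1 w ^+ 2 by exact: exprn_gt0.
    have := sq_risk_lt Pi_pos ow (model _ ow) N0 f00 Nf0 c0
      erefl i2 erefl al0 be0.
    rewrite (riskE _ _ _ _ ow msqloss mQ12 (mgapstd al be (m1%:R + 2)^-1
      (m1 + m2 + p + 2)%:R c (sigma1 w))); last first.
      move=> x t0 S10 S20.
      exact: (delta12QE m1 m2 Pi _ _ (divr_gt0 t0 s120) S10 S20).
    rewrite (riskE _ _ _ _ ow msqloss mQ01 (mS1c (c * (m1%:R + 2)^-1))); last first.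
      by move=> x _ _ _; exact: delta01QE.
    congr (_ < _)%E; apply: eq_integral => x _; by rewrite /sq_loss -[in RHS]mulrA.
  split=> [w ow|]; first exact/ltW/lt.
  by exists (Param [tuple (0 : R) | i < p] [tuple (0 : R) | i < q] 1 1); last exact: lt.
- move=> i1; have M1 := inv_moment_gt0 Pi_pos i1.
  pose c := (inv_moment Pi 1)^-1.
  have c0 : 0 < c by rewrite invr_gt0.
  (* In the first case the estimators agree almost surely and the risks are equal. In the second,
     [N] and [al] are positive and the general comparison applies. *)
  have [mp|mp] := leqP (m2 + p) 4.
    split=> // w ow; have [s10 _ _] := ow.
    have s120 : 0 < sigma1 w ^+ 2 by exact: exprn_gt0.
    rewrite (riskE _ _ _ _ ow mentloss mE12 mE01); last first.
      move=> x t0 S10 S20.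
      exact: (@delta12E_trivial R p q m1 m2 Pi _ _ _ _ _ (divr_gt0 t0 s120) S10 S20 mp).
    by rewrite /risk unlock; exact: lexx.
  pose al := (m2%:R + p%:R - 4) / m1%:R : R.
  pose be := m2%:R / m1%:R : R.
  have mp4 : 0 < m2%:R + p%:R - 4 :> R by rewrite subr_gt0 -natrD ltr_nat.
  have N0 : 0 < (m1 + m2 + p)%:R - 4 :> R by rewrite !natrD; lra.
  have f00 : 0 < m1%:R^-1 :> R by rewrite invr_gt0.
  have Nf0 : ((m1 + m2 + p)%:R - 4) * m1%:R^-1 = 1 + al :> R.
    by rewrite /al !natrD; field; rewrite gt_eqF.
  have al0 : 0 < al by exact: divr_gt0.
  have be0 : 0 < be by exact: divr_gt0.
  have risks w : ordered_param w ->
    (risk entropy_loss P X1 S1 X2 S2 (delta12E m1 m2 Pi) w =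
      \int[P w]_x (c * (m1%:R^-1 - gap al be m1%:R^-1 ((m1 + m2 + p)%:R - 4)
        (tau x / sigma1 w ^+ 2 * S1 x, tau x / sigma1 w ^+ 2 * S2 x,
         tau x / sigma1 w ^+ 2 * sqnorm (X1 x))) * (S1 x / sigma1 w ^+ 2) -
       ln (c * (m1%:R^-1 - gap al be m1%:R^-1 ((m1 + m2 + p)%:R - 4)
        (tau x / sigma1 w ^+ 2 * S1 x, tau x / sigma1 w ^+ 2 * S2 x,
         tau x / sigma1 w ^+ 2 * sqnorm (X1 x))) * (S1 x / sigma1 w ^+ 2)) - 1)%:E)%E /\
    (risk entropy_loss P X1 S1 X2 S2 (delta01E m1 Pi) w =
      \int[P w]_x (c * m1%:R^-1 * (S1 x / sigma1 w ^+ 2) -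
        ln (c * m1%:R^-1 * (S1 x / sigma1 w ^+ 2)) - 1)%:E)%E.
    move=> ow; have [s10 _ _] := ow.
    have s120 : 0 < sigma1 w ^+ 2 by exact: exprn_gt0.
    split.
      rewrite (riskE _ _ _ _ ow mentloss mE12 (mgapstd al be m1%:R^-1
        ((m1 + m2 + p)%:R - 4) c (sigma1 w))).
        by apply: eq_integral => x _; rewrite /entropy_loss -[in LHS]mulrA.
      move=> x t0 S10 S20.
      exact: (@delta12EE R p q m1 m2 Pi _ _ _ _ _ (divr_gt0 t0 s120) S10 S20 mp).
    rewrite (riskE _ _ _ _ ow mentloss mE01 (mS1c (c * m1%:R^-1))).
      by apply: eq_integral => x _; rewrite /entropy_loss -[in LHS]mulrA.
    by move=> x _ _ _; exact: delta01EE.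
  split=> [w ow|_ iln].
    have [-> ->] := risks w ow.
    exact: (entropy_risk_le Pi_pos ow (model _ ow) N0 f00 Nf0 c0
      erefl i1 erefl al0 be0).
  have lt w : ordered_param w -> (risk entropy_loss P X1 S1 X2 S2 (delta12E m1 m2 Pi) w <
      risk entropy_loss P X1 S1 X2 S2 (delta01E m1 Pi) w)%E.
    move=> ow; have [-> ->] := risks w ow.
    exact: (entropy_risk_lt Pi_pos ow (model _ ow) N0 f00 Nf0 c0
      erefl i1 erefl al0 be0 m1_gt0 iln).
  split=> [w ow|]; first exact/ltW/lt.
  by exists (Param [tuple (0 : R) | i < p] [tuple (0 : R) | i < q] 1 1); last exact: lt.
Qed.
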